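(* Let $\mathbf{A} \in \mathbb{R}^{n\times n}$ be a symmetric matrix. Draw a standard normal random matrix $\mathbf{\Omega} \in \mathbb{R}^{n\times \ell}$ with block size $\ell \ge 1$. Fix an integer depth $q \ge 0$, and let $q = q_1 + q_2$ be an arbitrary partition into nonnegative integers $q_1, q_2$. Let $\xi_{\max}(\mathbf{A};\mathbf{\Omega};q)$ be the block Krylov estimate of the maximum eigenvalue of $\mathbf{A}$, let $\mathrm{err}(\cdot)$ be the relative error, and let $\operatorname{srk}(\cdot)$ be the stable rank function of $\mathbf{A}$ (all defined in the context). Then: (1) The relative error in the eigenvalue estimate satisfies the probability bound $$ \mathbb{P}\left\{ \mathrm{err}(\xi_{\max}(\mathbf{A};\mathbf{\Omega};q)) \ge \varepsilon \right\} \le \min\left\{ 1,\ \sqrt{2}\left[ 8 \operatorname{srk}(q_1)\cdot \mathrm{e}^{-2(2q_2+1)\sqrt{\varepsilon}} \right]^{\ell/2} \right\} \quad\text{for } \varepsilon \in [0,1]. $$ (2) The expectation of the relative error satisfies $$ \mathbb{E}\, \mathrm{err}(\xi_{\max}(\mathbf{A};\mathbf{\Omega};q)) \le \min\left\{ 1,\ \left[ \frac{2.70\,\ell^{-1} + \log(8\operatorname{srk}(q_1))}{2(2q_2+1)} \right]^2 \right\}. $$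
   Context: A standard normal matrix $\mathbf{\Omega}\in\mathbb{R}^{n\times\ell}$ has statistically independent real Gaussian entries, each with mean zero and variance one. ${}^*$ denotes transpose; $\log$ is the natural logarithm. The convention $0/0=0$ is in force. For a symmetric $\mathbf{A}\in\mathbb{R}^{n\times n}$, a matrix $\mathbf{B}\in\mathbb{R}^{n\times\ell}$ and an integer $q\ge 0$, the block Krylov subspace is $$K_q(\mathbf{A};\mathbf{B}) := \operatorname{range}\begin{bmatrix}\mathbf{B} & \mathbf{A}\mathbf{B} & \mathbf{A}^2\mathbf{B} & \cdots & \mathbf{A}^q\mathbf{B}\end{bmatrix}\subset\mathbb{R}^n$$ (the highest power is $\mathbf{A}^q$). The maximum eigenvalue estimate is $$\xi_{\max}(\mathbf{A};\mathbf{B};q) := \max_{\mathbf{v}\in K_q(\mathbf{A};\mathbf{B}),\ \mathbf{v}\neq \mathbf{0}} \frac{\mathbf{v}^*\mathbf{A}\mathbf{v}}{\mathbf{v}^*\mathbf{v}}.$$ Write $a_{\max} = a_1\ge a_2\ge\dots\ge a_n = a_{\min}$ for the eigenvalues of $\mathbf{A}$, with multiplicity. The relative error of an estimate $\xi$ of $a_{\max}$ is $$\mathrm{err}(\xi) := \frac{a_{\max}-\xi}{a_{\max}-a_{\min}}.$$ For a nonnegative number $\nu$, the $\nu$-stable rank is $$\operatorname{srk}(\nu) := \sum_{i=1}^n\left(\frac{a_i-a_{\min}}{a_{\max}-a_{\min}}\right)^{2\nu}.$$ If $\mathbf{A}$ is a multiple of the identity, $\operatorname{srk}(\nu):=0$;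 otherwise $1\le \operatorname{srk}(\nu)\le \operatorname{rank}(\mathbf{A}-a_{\min}\mathbf{I})\le n-1$.
   Formalization: In part (1), the case where A is a multiple of the identity and ε = 0 is excluded: there err = 0, so the probability is 1, while srk(q_1) = 0 makes the claimed bound 0. *)

(* Defs.v *)
From HB Require Import structures.
From mathcomp Require Import all_boot all_order all_algebra.
From mathcomp Require Import all_classical all_reals all_analysis.
From mathcomp Require Import complex.

Set Implicit Arguments.
Unset Strict Implicit.
Unset Printing Implicit Defensive.

Import Order.TTheory GRing.Theory Num.Theory.

Local Open Scope classical_set_scope.
Local Open Scope ring_scope.

Section Spectrum.
Context {R : realType} {n : nat}.
Implicit Type A : 'M[R]_n.

Definition is_spectrum A (s : seq R) : Prop :=
  sorted >=%R s /\ char_poly A = \prod_(x <- s) ('X - x%:P).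

(* Nonincreasing, with multiplicity.  The default [::] is only taken when the
   characteristic polynomial does not split, which does not happen for
   symmetric matrices: see [eigenvaluesP]. *)
Definition eigenvalues A : seq R := xget [::] [set s | is_spectrum A s].

Lemma is_spectrum_exists A : A^T = A -> exists s, is_spectrum A s.
Proof.
move=> As.
pose f := real_complex R.
pose B := map_mx f A.
have hB : B \is hermsymmx.
  apply/is_hermitianmxP; rewrite expr0 scale1r.
  apply/matrixP => i j; rewrite !mxE.
  rewrite -[in LHS]As mxE.
  by rewrite /Num.conj /= /f /= oppr0.
have /orthomx_spectralP eB := hermitian_normalmx hB.
have dr := hermitian_spectral_diag_real hB.
set U := spectralmx B in eB; set d := spectral_diag B in eB dr.
have dE i : f (complex.Re (d 0 i)) = d 0 i.
  by apply: RRe_real; exact: (mxOverP dr).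
have cB : char_poly B = \prod_(i < n) ('X - (d 0 i)%:P).
  have Uu : U \in unitmx by exact: spectral_unit.
  have -> : char_poly B = char_poly (diag_mx d).
    rewrite /char_poly /char_poly_mx eB !map_mxM /= map_invmx.
    set V := map_mx polyC U.
    have Vu : V \in unitmx by rewrite map_unitmx.
    have -> : 'X%:M - invmx V *m map_mx polyC (diag_mx d) *m V =
              invmx V *m ('X%:M - map_mx polyC (diag_mx d)) *m V.
      by rewrite mulmxBr mulmxBl mul_mx_scalar -scalemxAl mulVmx// scalemx1.
    by rewrite !det_mulmx mulrAC -det_mulmx mulVmx// det1 mul1r.
  rewrite char_poly_trig ?diag_mx_is_trig//.
  by apply: eq_bigr => i _; rewrite mxE eqxx.
exists (sort >=%R [seq complex.Re (d 0 i) | i : 'I_n]); split.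
  by apply: sort_sorted => x y; rewrite le_total.
rewrite (perm_big _ (permEl (perm_sort _ _))) /= big_image /=.
apply: (map_poly_inj f); rewrite map_char_poly -/B cB rmorph_prod /=.
by apply: eq_bigr => i _; rewrite rmorphB /= map_polyX map_polyC /= -/f dE.
Qed.

Lemma eigenvaluesP A : A^T = A -> is_spectrum A (eigenvalues A).
Proof.
move=> /is_spectrum_exists [s sA].
by apply: (@xgetPex _ [::] [set s | is_spectrum A s]); exists s.
Qed.

Definition eig_max A : R := head 0 (eigenvalues A).

Definition eig_min A : R := last 0 (eigenvalues A).

(* Division by zero is zero, hence the error is zero when A is a multiple of
   the identity. *)
Definition relerr A (xi : R) : R :=
  (eig_max A - xi) / (eig_max A - eig_min A).

(* Terms with x = eig_min A are dropped because 0 to the power 0 has to count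
   as 0 (and not as 1, as for powR) for srk A nu <= rank (A - eig_min A) to hold
   at nu = 0.  If A is a multiple of the identity, the sum is empty. *)
Definition srk A (nu : R) : R :=
  \sum_(x <- eigenvalues A | x != eig_min A)
    ((x - eig_min A) / (eig_max A - eig_min A)) `^ (2 * nu).

End Spectrum.

Section Krylov.
Context {R : realType} {n l : nat}.
Implicit Types (A : 'M[R]_n) (B : 'M[R]_(n, l)).

Definition krylov_mx A B (q : nat) : 'M[R]_(n, \sum_(j < q.+1) l) :=
  \mxrow_(j < q.+1) (A ^+ j *m B).

Definition krylov A B (q : nat) : set 'cV[R]_n :=
  range (fun w => krylov_mx A B q *m w).

Definition rayleigh A (v : 'cV[R]_n) : R :=
  \tr (v^T *m A *m v) / \tr (v^T *m v).

(* The supremum is a maximum whenever B != 0; it is 0 by convention if B = 0. *)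
Definition xi_max A B (q : nat) : R :=
  sup [set rayleigh A v | v in krylov A B q `&` [set v | v != 0]].

End Krylov.

Section GaussianMatrix.
Context d {T : measurableType d} {R : realType} (P : probability T R).

Definition mutually_independent (I : finType) (X : I -> {RV P >-> R}) : Prop :=
  forall B : I -> set R, (forall i, measurable (B i)) ->
    P (\bigcap_i (X i @^-1` B i)) = (\prod_i P (X i @^-1` B i))%E.

Definition standard_normal_matrix (n l : nat)
    (X : 'I_n -> 'I_l -> {RV P >-> R}) : Prop :=
  (forall i j (B : set R), measurable B ->
     distribution P (X i j) B = normal_prob 0 1 B) /\
  mutually_independent (fun ij : 'I_n * 'I_l => X ij.1 ij.2).

End GaussianMatrix.

(* Main.v *)
From HB Require Import structures.
From mathcomp Require Import all_boot all_order all_algebra.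
From mathcomp Require Import all_classical all_reals all_analysis.
From mathcomp Require Import measurable_realfun.
From mathcomp Require Import ring lra.
Require Import Defs.

Set Implicit Arguments.
Unset Strict Implicit.
Unset Printing Implicit Defensive.

Import Order.TTheory GRing.Theory Num.Theory.
Import numFieldNormedType.Exports.

Local Open Scope classical_set_scope.
Local Open Scope ring_scope.

(** Diagonalise A = U^T diag(r) U and put W = U Omega. Since U is orthogonal, W
   is again a standard normal matrix (preserves_gauss_orth). Let a be its row
   along a top eigenvector, Y the square norm of a, and g_i the component of
   row i in the direction of a. Given a, the g_i are standard normal, because
   the law of a row is rotation invariant (ge0_integral_gauss_direction).

   The Krylov space contains phi (A) Omega c for all polynomials phi of degree
   at most q and all vectors c. For c = a, the coordinates of this vector in the
   eigenbasis are phi (r_i) g_i sqrt Y, and phi (r_i) Y at the top. Rescale the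
   spectrum to [0, 1], let u ^+ 2 be the error threshold, N = 2 q2 + 1 and
   E = exp (2 N u). For phi the monomial of degree q1 times a Chebyshev
   polynomial of degree q2 adapted to [0, 1 - u ^+ 2] (filter_poly), the Rayleigh
   quotient of this vector shows that an error at least u ^+ 2 entails
   (E - 2) Y <= 4 Q, where Q is the sum over the other eigenvalues of g_i ^+ 2
   weighted by the contributions of these eigenvalues to srk A q1
   (relerr_event). The weights add up to srk A q1 - 1. When q1 = 0 the weight of
   the least eigenvalue is 0 whatever its multiplicity, so phi has to vanish
   there; the Chebyshev polynomial is then shifted to move one of its zeros to
   0, at the cost of at most a constant factor (loss).

   For the tail bound, Chernoff's inequality is applied to the event
   (E - 2) Y <= 4 Q. By Jensen's inequality Q may be replaced by a multiple of
   one squared normal variable (chernoff_ratio), which yields the factor sqrt 2,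
   and the Laplace transform of Y, a power of exponent - l / 2, yields the rest.

   For the expectation, the event is solved for u: 2 N sqrt err is at most
   ln (4 + 8 Q) + B, with B the positive part of - ln Y (draw_err_log). The
   square of the right-hand side is concave as a function of 4 + 8 Q, so that Q
   may be replaced by its mean (sqr_ln_le_tangent), which leaves
   L = ln (8 srk A q1) plus B. The first two moments of B are at most 2 / l and
   8 / l ^+ 2, because Y <= t has probability at most t to the l / 2
   (sqnorm_top_le). *)


(** * Gaussian integrals and plane rotations *)

Section image_measure.
Context d1 d2 (T1 : measurableType d1) (T2 : measurableType d2) (R : realType).
Variables (mu : {measure set T1 -> \bar R}) (f : T1 -> T2).
Hypothesis mf : measurable_fun setT f.

(** The pushforward with its measure structure, so that it can be fed to
   uniqueness theorems and integrals. *)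
Definition image_measure : {measure set T2 -> \bar R} :=
  measure_function_pushforward__canonical__measure_function_Measure mu mf.

Lemma ge0_integral_image (g : T2 -> \bar R) :
  measurable_fun setT g -> (forall y, 0 <= g y)%E ->
  (\int[image_measure]_y g y = \int[mu]_x g (f x))%E.
Proof. by move=> mg g0; exact: ge0_integral_pushforward. Qed.
End image_measure.

Section density.
Context d (T : measurableType d) (R : realType).
Variables (mu nu : {measure set T -> \bar R}) (h : T -> R).
Hypothesis mh : measurable_fun setT h.
Hypothesis h0 : forall x, 0 <= h x.
Hypothesis nuE : forall A, measurable A -> nu A = (\int[mu]_(x in A) (h x)%:E)%E.
Local Open Scope ereal_scope.
Import HBNNSimple.

Let integral_density_nnsfun (f : {nnsfun T >-> R}) :
  \int[nu]_x (f x)%:E = \int[mu]_x ((f x)%:E * (h x)%:E).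
Proof.
under [LHS]eq_integral do rewrite fimfunE -fsumEFin//.
rewrite [LHS]ge0_integral_fsum//; last 2 first.
  - by move=> r; exact/measurable_EFinP/measurableT_comp.
  - by move=> n x _; rewrite EFinM nnfun_muleindic_ge0.
under [RHS]eq_integral.
  move=> x xD; rewrite fimfunE -fsumEFin// ge0_mule_fsuml; last first.
    by move=> r; rewrite /= EFinM nnfun_muleindic_ge0.
  over.
rewrite [RHS]ge0_integral_fsum//; last 2 first.
  - move=> r; apply: emeasurable_funM; last exact/measurable_EFinP.
    by apply/measurable_EFinP; do 2 apply/measurableT_comp => //.
  - move=> n x _; apply: mule_ge0; last by rewrite lee_fin.
    by rewrite EFinM nnfun_muleindic_ge0.
apply: eq_fsbigr => r _.
rewrite integralZl_indic_nnsfun// integral_indic// setIT nuE//.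
have [r0|r0] := leP 0%R r; last first.
  rewrite preimage_nnfun0// integral_set0 mule0 integral0_eq// => x _.
  by rewrite indicE in_set0 mulr0 mul0e.
under [RHS]eq_integral do rewrite EFinM -muleA.
rewrite ge0_integralZl//; last 2 first.
  - by apply: emeasurable_funM; apply/measurable_EFinP => //; exact: measurable_indic.
  - by move=> x _; rewrite mule_ge0// lee_fin.
congr *%E; rewrite integral_mkcond; apply: eq_integral => x _.
by rewrite patchE indicE; case: ifP => _; rewrite ?mul1e ?mul0e.
Qed.

Lemma ge0_integral_density (f : T -> \bar R) :
  measurable_fun setT f -> (forall x, 0 <= f x) ->
  \int[nu]_x f x = \int[mu]_x (f x * (h x)%:E).
Proof.
move=> mf f0.
pose f_ := nnsfun_approx measurableT mf.
transitivity (lim (\int[nu]_x (f_ n x)%:E @[n --> \oo])).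
  rewrite -monotone_convergence//=.
  - apply: eq_integral => ? /[!inE] xD; apply/esym/cvg_lim => //=.
    exact: cvg_nnsfun_approx.
  - by move=> n; exact/measurable_EFinP/measurable_funTS.
  - by move=> n ? _; rewrite lee_fin.
  - by move=> ? _ ? ? mn; rewrite lee_fin; exact/lefP/nd_nnsfun_approx.
under eq_fun do rewrite integral_density_nnsfun.
rewrite -monotone_convergence//=.
- apply: eq_integral => x /[!inE] xD; apply/cvg_lim => //=.
  apply: cvgeZr => //; exact: cvg_nnsfun_approx.
- move=> n; apply: emeasurable_funM; last exact/measurable_EFinP.
  exact/measurable_EFinP.
- by move=> n ? _; rewrite mule_ge0// lee_fin.
- move=> x _ a b ab; rewrite lee_wpmul2r ?lee_fin//.
  exact/lefP/nd_nnsfun_approx.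
Qed.
End density.

Section affine.
Context {R : realType}.
Local Notation mu := (@lebesgue_measure R).
Local Open Scope ereal_scope.

Definition affR (c b : R) (x : measurableTypeR R) : measurableTypeR R := (c * x + b)%R.

Lemma measurable_affR c b : measurable_fun setT (affR c b).
Proof. by apply: measurable_funD => //; exact: measurable_funM. Qed.

(** Lebesgue measure is characterised by its values on half-open intervals,
   which an affine map rescales. *)
Lemma lebesgue_measure_affine (c b : R) (A : set R) : (0 < c)%R -> measurable A ->
  mu (affR c b @^-1` A) = (c^-1)%:E * mu A.
Proof.
move=> c0 mA.
pose m1 := mscale (NngNum (ltW c0)) (image_measure mu (measurable_affR c b)) : {measure set _ -> \bar R}.
have -> : mu A = m1 A; last first.
  by rewrite /m1 /mscale /= /pushforward muleA -EFinM mulVf ?gt_eqF// mul1e.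
apply: lebesgue_measure_unique => // _ [[x y]] _ <-.
transitivity (c%:E * mu (affR c b @^-1` `]x, y]%classic)); last by [].
have -> : affR c b @^-1` `]x, y]%classic = `]((x - b) / c)%R, ((y - b) / c)%R]%classic.
  apply/seteqP; split => z /=; rewrite /affR !in_itv/= ltr_pdivrMr// ler_pdivlMr//;
   by rewrite ltrBlDr lerBrDr (mulrC c).
rewrite !lebesgue_measure_itv/= !lte_fin ltr_pM2r ?invr_gt0// ltrD2r.
case: ifP => _; rewrite ?mule0//.
by rewrite -!EFinD -EFinM; congr EFin; field; rewrite gt_eqF.
Qed.

Lemma lebesgue_measure_affineN (c b : R) (A : set R) : (c < 0)%R -> measurable A ->
  mu (affR c b @^-1` A) = (`|c|^-1)%:E * mu A.
Proof.
move=> c0 mA.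
have -> : affR c b @^-1` A = (-%R : _ -> measurableTypeR R) @^-1` (affR (- c) b @^-1` A).
  by apply/seteqP; split => x /=; rewrite /affR mulrNN.
have mB : measurable (affR (- c) b @^-1` A).
  by rewrite -[X in measurable X]setTI; exact: measurable_affR.
have := lebesgue_measureN mB; rewrite /pushforward => ->.
by rewrite lebesgue_measure_affine ?oppr_gt0// ltr0_norm.
Qed.

Lemma ge0_integral_affine (c b : R) (f : R -> \bar R) : c != 0%R ->
  measurable_fun setT f -> (forall x, 0 <= f x) ->
  \int[mu]_x f x = `|c|%:E * \int[mu]_x f (c * x + b)%R.
Proof.
move=> c0 mf f0.
rewrite -(ge0_integral_image mu (measurable_affR c b) mf f0).
pose m1 := mscale (NngNum (normr_ge0 c)) (image_measure mu (measurable_affR c b)) : {measure set _ -> \bar R}.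
rewrite -[X in _ = X * _]/((NngNum (normr_ge0 c))%:num%:E).
rewrite -ge0_integral_mscale//; apply: eq_measure_integral => A mA _.
rewrite /= /mscale /= /pushforward.
have [cp|cn|/eqP] := ltgtP c 0%R; last by rewrite (negbTE c0).
  by rewrite lebesgue_measure_affineN// muleA -EFinM divff ?mul1e// normr_eq0.
rewrite lebesgue_measure_affine// gtr0_norm// muleA -EFinM divff ?mul1e//.
Qed.
End affine.

Section gaussian.
Context {R : realType}.
Local Notation mu := (@lebesgue_measure R).
Local Notation gauss := (@normal_prob R 0 1).
Local Notation pdf := (@normal_pdf R 0 1).
Local Open Scope ereal_scope.

Lemma ge0_integral_normal (f : R -> \bar R) :
  measurable_fun setT f -> (forall x, 0 <= f x) ->
  \int[gauss]_x f x = \int[mu]_x (f x * (pdf x)%:E).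
Proof.
move=> mf f0; apply: (@ge0_integral_density _ _ R mu gauss pdf) => //.
  exact: measurable_normal_pdf.
exact: normal_pdf_ge0.
Qed.

Lemma normal_pdf01E (x : R) :
  pdf x = ((Num.sqrt (pi *+ 2))^-1 * expR (- x ^+ 2 / 2))%R.
Proof.
rewrite normal_pdfE ?oner_eq0// /normal_peak /normal_fun expr1n mul1r subr0.
by congr (_ * expR _)%R; congr (_ / _)%R; ring.
Qed.

(** The integrand times the standard normal density is a multiple of the
   normal density of variance 1 / (1 - 2 s). *)
Lemma integral_normal_expR_sqr (s : R) : (s < 2^-1)%R ->
  \int[gauss]_x (expR (s * x ^+ 2))%:E = ((Num.sqrt (1 - 2 * s))^-1)%:E.
Proof.
move=> s12.
have t0 : (0 < 1 - 2 * s)%R by lra.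
set r := Num.sqrt (1 - 2 * s).
have r0 : (0 < r)%R by rewrite sqrtr_gt0.
have r2 : (r ^+ 2 = 1 - 2 * s)%R by rewrite sqr_sqrtr// ltW.
rewrite ge0_integral_normal; last 2 first.
  apply/measurable_EFinP; apply: measurableT_comp => //.
  by apply: measurable_funM => //; exact: measurable_funX.
  by move=> x; rewrite lee_fin expR_ge0.
under eq_integral.
  move=> x _; rewrite -EFinM.
  have -> : (expR (s * x ^+ 2) * pdf x = r^-1 * normal_pdf 0 r^-1 x)%R.
    rewrite normal_pdf01E normal_pdfE ?invr_eq0 ?gt_eqF//.
    rewrite /normal_peak /normal_fun subr0.
    rewrite -mulrnAr sqrtrM ?sqr_ge0// sqrtr_sqr ger0_norm ?invr_ge0 ?ltW//.
    rewrite invfM invrK [in RHS]mulrA [in RHS]mulrA mulVf ?gt_eqF// mul1r.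
    rewrite mulrCA -expRD; congr (_ * expR _)%R.
    rewrite exprVn r2; field.
    by rewrite gt_eqF// mulr_natl.
  over.
rewrite /=.
under eq_integral do rewrite EFinM.
rewrite ge0_integralZl_EFin ?integral_normal_pdf ?mule1 ?invr_ge0 ?ltW//.
- by move=> x _; rewrite lee_fin normal_pdf_ge0.
- by apply/measurable_EFinP; exact: measurable_normal_pdf.
Qed.

(** Since 1 + s x ^+ 2 <= expR (s x ^+ 2), the second moment is at most a
   difference quotient of the exponential moment, which tends to 1 as s
   tends to 0; this replaces an integration by parts. *)
Lemma integral_normal_sqr_le1 : \int[gauss]_x (x ^+ 2)%:E <= 1.
Proof.
have m2 : measurable_fun [set: R] (fun x : R => (x ^+ 2)%:E).
  by apply/measurable_EFinP; exact: measurable_funX.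
have key (s : R) : (0 < s < 4^-1)%R ->
    \int[gauss]_x (x ^+ 2)%:E <= (1 + 4 * s)%:E.
  move=> /andP[s0 s1].
  have mexp : measurable_fun [set: R] (fun x : R => (expR (s * x ^+ 2))%:E).
    apply/measurable_EFinP; apply: measurableT_comp => //.
    by apply: measurable_funM => //; exact: measurable_funX.
  have H : \int[gauss]_x (1 + s%:E * (x ^+ 2)%:E) <=
           \int[gauss]_x (expR (s * x ^+ 2))%:E.
    apply: ge0_le_integral => //.
    - by move=> x _; rewrite adde_ge0// mule_ge0// lee_fin ?sqr_ge0// ltW.
    - by apply: emeasurable_funD => //; apply: emeasurable_funM.
    - by move=> x _; rewrite -EFinM -EFinD lee_fin expR_ge1Dx.
  rewrite ge0_integralD// in H; last 2 first.
  - by move=> x _; rewrite mule_ge0// lee_fin ?sqr_ge0// ltW.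
  - exact: emeasurable_funM.
  rewrite [X in X + _](_ : _ = 1) in H; last first.
    by rewrite integral_cst// mul1e; exact: integral_normal_pdf.
  rewrite ge0_integralZl_EFin// in H; last 2 first.
  - by move=> x _; rewrite lee_fin sqr_ge0.
  - exact: ltW.
  rewrite integral_normal_expR_sqr in H; last by lra.
  set I := integral _ _ _ in H *.
  have I0 : 0 <= I by apply: integral_ge0 => x _; rewrite lee_fin sqr_ge0.
  set r := Num.sqrt (1 - 2 * s) in H.
  have r0 : (0 < r)%R by rewrite sqrtr_gt0; lra.
  have r2 : (r ^+ 2 = 1 - 2 * s)%R by rewrite sqr_sqrtr//; lra.
  have rle : (r^-1 <= 1 + s * (1 + 4 * s))%R.
    rewrite -[leLHS]mul1r ler_pdivrMr//.
    have : (1 <= ((1 + s * (1 + 4 * s)) * r) ^+ 2)%R.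
      rewrite exprMn r2.
      have -> : ((1 + s * (1 + 4 * s)) ^+ 2 * (1 - 2 * s) =
                 1 + s ^+ 2 * (5 - 10 * s - 32 * s ^+ 3))%R by ring.
      have s3 : (s ^+ 3 <= 4^-1 ^+ 3)%R.
        by rewrite ler_pXn2r ?nnegrE ?(ltW s0) ?(ltW s1).
      by rewrite lerDl mulr_ge0 ?sqr_ge0//; lra.
    rewrite -[X in (X <= _)%R -> _](expr1n _ 2) ler_pXn2r// ?nnegrE//.
    by rewrite mulr_ge0 ?(ltW r0)//; nra.
  move: I I0 H => [i| |]//= I0; last by rewrite gt0_muley ?lte_fin// addey// leye_eq.
  rewrite -EFinM -EFinD !lee_fin => H.
  by rewrite -(ler_pM2l s0); lra.
apply/lee_addgt0Pr => e e0.
have s0 : (0 < Num.min (e / 4) 8^-1)%R by rewrite lt_min; apply/andP; split; lra.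
apply: (le_trans (key (Num.min (e / 4) 8^-1)%R _)).
  by rewrite s0 /= gt_min; apply/orP; right; lra.
rewrite -EFinD lee_fin lerD2l.
have : (Num.min (e / 4) 8^-1 <= e / 4)%R by rewrite ge_min lexx.
by move=> ?; lra.
Qed.

(** The standard normal density is at most 1 / 2, and the interval has
   length 2 t. *)
Lemma normal_prob_ball_le (t : R) : (0 <= t)%R ->
  gauss [set x : R | (x ^+ 2 <= t ^+ 2)%R] <= t%:E.
Proof.
move=> t0.
have -> : [set x : R | (x ^+ 2 <= t ^+ 2)%R] = `[(- t)%R, t]%classic.
  apply/seteqP; split => x /=;
    by rewrite in_itv/= -ler_norml -[(`|x| <= t)%R](@ler_pXn2r _ 2)// ?nnegrE//
      real_normK ?num_real.
rewrite /normal_prob.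
apply: (@le_trans _ _ (\int[mu]_(x in `[(- t)%R, t]) (2^-1)%:E)).
  apply: ge0_le_integral => //=.
  - by move=> x _; rewrite lee_fin normal_pdf_ge0.
  - by apply/measurable_EFinP/measurable_funTS; exact: measurable_normal_pdf.
  - move=> x _; rewrite lee_fin; apply: le_trans (normal_pdf_ub _ _ (oner_neq0 _)) _.
    rewrite /normal_peak expr1n mul1r lef_pV2 ?posrE//; last first.
      by rewrite sqrtr_gt0 pmulrn_lgt0// pi_gt0.
    rewrite -(@ler_pXn2r _ 2)// ?nnegrE ?sqrtr_ge0//.
    have p2 := @pi_ge2 R.
    by rewrite sqr_sqrtr; rewrite -mulr_natr; lra.
rewrite integral_cst//= lebesgue_measure_itv/= lte_fin.
case: ifP => _; last by rewrite mule0 lee_fin.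
by rewrite -EFinD -EFinM lee_fin opprK; lra.
Qed.

Definition rot2 (c s : R) (z : R * R) : R * R :=
  (c * z.1 + s * z.2, c * z.2 - s * z.1)%R.

Lemma measurable_rot2 c s : measurable_fun setT (rot2 c s).
Proof.
apply/measurable_fun_pairP; split.
  by apply: measurable_funD; apply: measurable_funM.
by apply: measurable_funB; apply: measurable_funM.
Qed.
End gaussian.

Section rotation.
Context {R : realType}.
Local Notation mu := (@lebesgue_measure R).
Local Notation gauss := (@normal_prob R 0 1).
Local Notation pdf := (@normal_pdf R 0 1).
Local Notation RR := (measurableTypeR R).
Local Open Scope ereal_scope.

Let iint (F : RR * RR -> \bar R) := \int[mu]_x \int[mu]_y F (x, y).

Let iint_swap F : measurable_fun setT F -> (forall z, 0 <= F z) ->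
  iint F = \int[mu]_y \int[mu]_x F (x, y).
Proof. by move=> mF F0; exact: (fubini_tonelli (m1 := mu) (m2 := mu)). Qed.

(** Unless it is a quarter turn, a rotation is a composition of two maps
   that each move one coordinate affinely: substitute in x with y fixed,
   exchange the integrals, then substitute in y with x fixed. *)
Let iint_rot2 c s F : (c ^+ 2 + s ^+ 2 = 1)%R ->
  measurable_fun setT F -> (forall z, 0 <= F z) ->
  iint (F \o rot2 c s) = iint F.
Proof.
move=> cs mF F0.
have mFr : measurable_fun setT (F \o rot2 c s).
  by apply: measurableT_comp => //; exact: measurable_rot2.
have mFy d' (T' : measurableType d') (f g : T' -> RR) : measurable_fun setT f -> measurable_fun setT g ->
    measurable_fun setT (fun x => F (f x, g x)).
  by move=> mf mg; apply: (measurableT_comp mF); exact/measurable_fun_pairP.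
have [c0|c0] := eqVneq c 0%R.
  have s0 : s != 0%R.
    by apply/eqP => s0; move: cs; rewrite c0 s0 expr0n addr0 => /eqP; rewrite eq_sym oner_eq0.
  have ns : (`|s| = 1)%R.
    apply/eqP; rewrite -(@eqrXn2 _ 2)// expr1n real_normK ?num_real//.
    by rewrite -cs c0 expr0n add0r.
  have E1 x : \int[mu]_y (F \o rot2 c s) (x, y) = \int[mu]_y F (y, - s * x)%R.
    rewrite (@ge0_integral_affine _ s 0 (fun y => F (y, (- s * x)%R)))//; last first.
      by apply: mFy => //; exact: measurable_cst.
    rewrite ns mul1e; apply: eq_integral => y _.
    by rewrite /rot2 /= c0 !mul0r !add0r addr0 mulNr.
  rewrite /iint; under eq_integral do rewrite E1.
  transitivity (iint (fun z => F (z.2, (- s * z.1)%R))); first by [].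
  have mG : measurable_fun setT (fun z : RR * RR => F (z.2, (- s * z.1)%R)).
    by apply: mFy => //; exact: measurable_funM.
  rewrite (iint_swap mG (fun z => F0 _)) /=.
  apply: eq_integral => y _.
  rewrite [RHS](@ge0_integral_affine _ (- s) 0 (fun x => F (y, x)))//.
  - by rewrite normrN ns mul1e; apply: eq_integral => x _; rewrite addr0.
  - by rewrite oppr_eq0.
  - by apply: mFy => //; exact: measurable_cst.
rewrite (iint_swap mFr (fun z => F0 _)).
have E1 y : \int[mu]_x (F \o rot2 c s) (x, y) =
    `|c^-1|%:E * \int[mu]_x F (x, (c^-1 * y + - (s / c) * x)%R).
  rewrite (@ge0_integral_affine _ c (s * y)%R (fun x => F (x, (c^-1 * y + - (s / c) * x)%R)))//; last first.
    apply: mFy => //; apply: measurable_funD; first exact: measurable_cst.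
    exact: measurable_funM.
  rewrite muleA -EFinM normfV mulVf ?normr_eq0// mul1e.
  apply: eq_integral => x _; rewrite /rot2 /=; congr (F (_, _)).
  rewrite -[X in (c * X - _)%R](mulfK c0 y).
  have -> : (c * (y * c / c) - s * x =
             (y * (1 - s ^+ 2) - s * c * x) / c)%R.
    by rewrite -cs; field.
  by field.
under eq_integral do rewrite E1.
rewrite ge0_integralZl//; last 2 first.
  apply: (measurable_fun_fubini_tonelli_G (m1 := mu) (fun z => F (z.1, (c^-1 * z.2 + - (s / c) * z.1)%R))) => //.
    apply: mFy => //; apply: measurable_funD; first exact: measurable_funM.
    exact: measurable_funM.
  by move=> y _; apply: integral_ge0.
rewrite -(@iint_swap (fun z => F (z.1, (c^-1 * z.2 + - (s / c) * z.1)%R)))//=; last first.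
  apply: mFy => //; apply: measurable_funD; first exact: measurable_funM.
  exact: measurable_funM.
rewrite -ge0_integralZl//; last 2 first.
  apply: (measurable_fun_fubini_tonelli_F (m2 := mu) (fun z => F (z.1, (c^-1 * z.2 + - (s / c) * z.1)%R))) => //.
    apply: mFy => //; apply: measurable_funD; first exact: measurable_funM.
    exact: measurable_funM.
  by move=> y _; apply: integral_ge0.
apply: eq_integral => x _.
rewrite [RHS](@ge0_integral_affine _ c^-1 (- (s / c) * x)%R (fun y => F (x, y)))//.
  by rewrite invr_eq0.
by apply: mFy => //; exact: measurable_cst.
Qed.

Let gauss2E (C : set (RR * RR)) : measurable C ->
  (gauss \x gauss) C =
  iint (fun z => (\1_C z * (pdf z.1 * pdf z.2))%:E).
Proof.
move=> mC.
have m1 (x : RR) : measurable_fun setT (fun y : RR => \1_C (x, y) : R).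
  apply: (measurableT_comp (f := \1_C : RR * RR -> R)); first exact: measurable_indic.
  exact: pair1_measurable.
rewrite -[C in LHS]setIT -integral_indic//.
rewrite (fubini_tonelli1 (m1 := gauss) (m2 := gauss) (fun z => (\1_C z)%:E))//; last first.
  exact/measurable_EFinP/measurable_indic.
rewrite ge0_integral_normal; last 2 first.
  apply: (measurable_fun_fubini_tonelli_F (m2 := gauss)).
    exact/measurable_EFinP/measurable_indic.
    by move=> ?; rewrite lee_fin.
  by move=> ?; apply: integral_ge0 => ? _; rewrite lee_fin.
apply: eq_integral => x _; rewrite /fubini_F.
rewrite ge0_integral_normal; last 2 first.
  by apply/measurable_EFinP; exact: m1.
  by move=> ?; rewrite lee_fin.
rewrite -ge0_integralZr//.
- by apply: eq_integral => y _ /=; rewrite -!EFinM; congr EFin; rewrite -mulrA [(pdf y * _)%R]mulrC.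
- apply: emeasurable_funM; apply/measurable_EFinP; first exact: m1.
  exact: measurable_normal_pdf.
- by move=> y _; rewrite mule_ge0// lee_fin normal_pdf_ge0.
- by rewrite lee_fin normal_pdf_ge0.
Qed.

(** The density of a pair of independent standard normal variables depends
   on the Euclidean norm only, and Lebesgue measure is rotation invariant. *)
Lemma gauss2_rot2 c s (C : set (RR * RR)) : (c ^+ 2 + s ^+ 2 = 1)%R ->
  measurable C -> (gauss \x gauss) (rot2 c s @^-1` C) = (gauss \x gauss) C.
Proof.
move=> cs mC.
have mrC : measurable (rot2 c s @^-1` C).
  by rewrite -[X in measurable X]setTI; exact: measurable_rot2.
rewrite (gauss2E mrC) (gauss2E mC).
pose D (z : RR * RR) := (\1_C z * (pdf z.1 * pdf z.2))%:E.
rewrite -[RHS](iint_rot2 (F := D) cs).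
- apply: eq_integral => x _; apply: eq_integral => y _ /=.
  congr EFin; congr (_ * _)%R.
  rewrite !normal_pdf01E mulrACA [RHS]mulrACA -!expRD; congr (_ * expR _)%R.
  have -> : (- (c * y - s * x) ^+ 2 / 2 = - ((c ^+ 2 + s ^+ 2) * (x ^+ 2 + y ^+ 2) - (c * x + s * y) ^+ 2) / 2)%R by ring.
  by rewrite cs /rot2 /=; field.
- apply/measurable_EFinP; apply: measurable_funM; first exact: measurable_indic.
  by apply: measurable_funM; apply: (measurableT_comp (measurable_normal_pdf 0 1)).
- by move=> z; rewrite lee_fin !mulr_ge0// normal_pdf_ge0.
Qed.
End rotation.

(** * Families of independent standard normal variables *)

Section uniqueness.
Context (R : realType).

(** Measurable rectangles form a pi-system generating the product
   sigma-algebra. *)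
Lemma eq_measure_rect d1 d2 (T1 : measurableType d1) (T2 : measurableType d2)
    (m1 m2 : {measure set (T1 * T2) -> \bar R}) :
  (m1 setT < +oo)%E ->
  (forall A B, measurable A -> measurable B -> m1 (A `*` B) = m2 (A `*` B)) ->
  forall C, measurable C -> m1 C = m2 C.
Proof.
move=> fin1 m12 C mC.
apply: (measure_unique [set A `*` B | A in measurable & B in measurable]
  (fun=> setT)) => //.
- by rewrite measurable_prod_measurableType.
- move=> _ _ [A mA [B mB <-]] [A' mA' [B' mB' <-]].
  by rewrite -setXI; exists (A `&` A'); [exact: measurableI|
    exists (B `&` B') => //; exact: measurableI].
- by move=> _; exists setT => //; exists setT => //; rewrite setXTT.
- by rewrite bigcup_const.
- by move=> _ [A mA [B mB <-]]; exact: m12.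
Qed.

Definition tuple_box d (T1 : measurableType d) n (B : 'I_n -> set T1) :
  set (n.-tuple T1) := [set x | forall i, B i (tnth x i)].

Lemma measurable_tuple_box d (T1 : measurableType d) n (B : 'I_n -> set T1) :
  (forall i, measurable (B i)) -> measurable (tuple_box B).
Proof.
move=> mB.
have -> : tuple_box B = \bigcap_i ((@tnth n T1 ^~ i) @^-1` B i).
  by apply/seteqP; split => [x Bx i _|x Bx i]; [exact: Bx|exact: (Bx i I)].
apply: fin_bigcap_measurable => // i _.
by rewrite -[X in measurable X]setTI; exact: measurable_tnth.
Qed.

(** Boxes form a pi-system generating the sigma-algebra on tuples. *)
Lemma eq_measure_box d (T1 : measurableType d) n
    (m1 m2 : {measure set (n.-tuple T1) -> \bar R}) :
  (m1 setT < +oo)%E ->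
  (forall B : 'I_n -> set T1, (forall i, measurable (B i)) ->
    m1 (tuple_box B) = m2 (tuple_box B)) ->
  forall C, measurable C -> m1 C = m2 C.
Proof.
move=> fin1 m12 C mC.
pose G : set (set (n.-tuple T1)) :=
  [set X | exists2 B : 'I_n -> set T1, (forall i, measurable (B i)) & X = tuple_box B].
have GT : G setT.
  by exists (fun=> setT) => //; apply/seteqP; split.
apply: (measure_unique G (fun=> setT)) => //.
- apply/seteqP; split.
    apply: smallest_sub; first exact: smallest_sigma_algebra.
    have sub i : preimage_set_system setT (@tnth n T1 ^~ i) measurable `<=` <<s G >>.
      move=> _ [A mA <-]; apply: sub_sigma_algebra.
      exists (fun j => if j == i then A else setT).
        by move=> j; case: ifP.
      apply/seteqP; split => [x /= [_ Ax] j|x /= Bx].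
        by case: eqP => // ->.
      by split => //; have := Bx i; rewrite eqxx.
    elim/big_ind : _ => // X Y XG YG; by rewrite subUset.
  apply: smallest_sub; first exact: sigma_algebra_measurable.
  by move=> _ [B mB ->]; exact: measurable_tuple_box.
- move=> _ _ [B mB ->] [B' mB' ->].
  exists (fun i => B i `&` B' i); first by move=> i; exact: measurableI.
  apply/seteqP; split => [x [h1 h2] i|x h]; first by split; [exact: h1|exact: h2].
  by split => i; have [] := h i.
- by rewrite bigcup_const.
- by move=> _ [B mB ->]; exact: m12.
Qed.
End uniqueness.

Section gauss_family.
Context d (T : measurableType d) (R : realType) (P : probability T R).
Local Notation gauss := (@normal_prob R 0 1).
Local Notation RR := (measurableTypeR R).

(** Mutual independence and the standard normal law in one product rule over
   all indices; taking the full line as B i recovers the rule for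
   subfamilies. *)
Definition gauss_family (I : finType) (Y : I -> T -> R) : Prop :=
  (forall i, measurable_fun setT (Y i)) /\
  forall B : I -> set R, (forall i, measurable (B i)) ->
    P (\bigcap_i (Y i @^-1` B i)) = (\prod_i gauss (B i))%E.

Lemma eq_gauss_family (I : finType) (Y Z : I -> T -> R) :
  (forall i t, Y i t = Z i t) -> gauss_family Y -> gauss_family Z.
Proof.
move=> YZ; suff -> : Y = Z by [].
by apply/funext => i; apply/funext => t.
Qed.

Lemma gauss_prob_fin (A : set R) : measurable A -> (gauss A) \is a fin_num.
Proof. by move=> mA; exact: fin_num_measure. Qed.

Lemma prod_gauss_fin (I : finType) (p : pred I) (B : I -> set R) :
  (forall i, measurable (B i)) -> ((\prod_(i | p i) gauss (B i))%E : \bar R) \is a fin_num.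
Proof.
move=> mB; elim/big_ind : _ => //; first by move=> x y; exact: fin_numM.
by move=> i _; exact: gauss_prob_fin.
Qed.

Definition rotate_family (I : finType) (i j : I) (c s : R) (Y : I -> T -> R) k t :=
  if k == i then c * Y i t + s * Y j t
  else if k == j then c * Y j t - s * Y i t else Y k t.

(** Restricted to an event depending on the other variables, the joint law
   of Y i and Y j is a multiple of the product of two standard normal laws,
   which a rotation preserves. *)
Lemma gauss_family_rotate (I : finType) (i j : I) c s (Y : I -> T -> R) :
  i != j -> c ^+ 2 + s ^+ 2 = 1 ->
  gauss_family Y -> gauss_family (rotate_family i j c s Y).
Proof.
move=> ij cs [mY hY]; split.
  move=> k; rewrite /rotate_family; case: eqP => [_|_]; last case: eqP => [_|_] //.
    by apply: measurable_funD; apply: measurable_funM => //; exact: measurable_cst.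
  by apply: measurable_funB; apply: measurable_funM => //; exact: measurable_cst.
move=> B mB.
pose E := \bigcap_(k in [set k | (k != i) && (k != j)]) (Y k @^-1` B k).
have mpre k (A : set R) : measurable A -> measurable (Y k @^-1` A).
  by move=> mA; rewrite -[X in measurable X]setTI; exact: mY.
have mE : measurable E.
  by apply: fin_bigcap_measurable => [|k _]; [exact: finite_finset|exact: mpre].
pose Z t : RR * RR := (Y i t, Y j t).
have mZ : measurable_fun setT Z by exact: measurable_fun_pair (mY i) (mY j).
pose K : \bar R := (\prod_(k | (k != i) && (k != j)) gauss (B k))%E.
have K0 : (0 <= K)%E by apply: prode_ge0 => k _; exact: measure_ge0.
have Kfin : K \is a fin_num by exact: prod_gauss_fin.
pose k0 : {nonneg R} := NngNum (fine_ge0 K0).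
have k0E : k0%:num%:E = K by rewrite /= fineK.
pose m1 := image_measure (mrestr P mE) mZ.
pose m2 : {measure set (RR * RR) -> \bar R} := mscale k0 (gauss \x gauss)%E.
have m12 C : measurable C -> m1 C = m2 C.
  apply: eq_measure_rect => //.
    rewrite /m1 /= /pushforward preimage_setT /mrestr setTI.
    by rewrite (le_lt_trans (probability_le1 P mE))// ltry.
  move=> A1 A2 mA1 mA2.
  rewrite /m1 /m2 /= /pushforward /mrestr /mscale /= product_measure1E//.
  pose B' k : set R := if k == i then A1 else if k == j then A2 else B k.
  have mB' k : measurable (B' k) by rewrite /B'; case: (k == i); last case: (k == j).
  have := hY B' mB'.
  rewrite (bigD1 i)//= (bigD1 j)/=; last by rewrite eq_sym.
  have -> : B' i = A1 by rewrite /B' eqxx.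
  have -> : B' j = A2 by rewrite /B' eqxx eq_sym (negbTE ij).
  rewrite (eq_bigr (fun k => gauss (B k))); last first.
    by move=> k /andP[ki kj]; rewrite /B' (negbTE ki) (negbTE kj).
  rewrite -/K fineK// muleA [X in _ = X -> _]muleC => <-; congr (P _).
  apply/seteqP; split => [t [[/= h1 h2] Et] k _ /=|t h].
    rewrite /B'; case: eqP => [->//|/eqP ki]; case: eqP => [->//|/eqP kj].
    by apply: Et; rewrite /= ki kj.
  split; last first.
    by move=> k /= /andP[ki kj]; have := h k Logic.I; rewrite /= /B' (negbTE ki) (negbTE kj).
  split => /=; first by have := h i Logic.I; rewrite /= /B' eqxx.
  by have := h j Logic.I; rewrite /= /B' eqxx eq_sym (negbTE ij).
have mBij : measurable (B i `*` B j : set (RR * RR)).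
  by apply: (@measurableX _ _ RR RR); exact: mB.
transitivity (m1 (rot2 c s @^-1` (B i `*` B j))).
  rewrite /m1 /= /pushforward /mrestr; congr (P _).
  apply/seteqP; split => [t h|t [[/= h1 h2] Et] k _ /=].
    split; last first.
      move=> k /= /andP[ki kj].
      by have := h k Logic.I; rewrite /= /rotate_family (negbTE ki) (negbTE kj).
    have := h i Logic.I; rewrite /= /rotate_family eqxx; split => //.
    by have := h j Logic.I; rewrite /= /rotate_family eqxx eq_sym (negbTE ij).
  rewrite /rotate_family; case: eqP => [->//|/eqP ki]; case: eqP => [->//|/eqP kj].
  by apply: Et; rewrite /= ki kj.
rewrite m12; last first.
  by rewrite -[X in measurable X]setTI; exact: measurable_rot2.
transitivity (K * (gauss \x gauss)%E (B i `*` B j))%E.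
  transitivity (k0%:num%:E * (gauss \x gauss)%E (rot2 c s @^-1` (B i `*` B j)))%E; first by [].
  by rewrite k0E (gauss2_rot2 cs mBij).
rewrite product_measure1E; [|exact: mB|exact: mB].
rewrite [RHS](bigD1 i)//= [in RHS](bigD1 j)/=; last by rewrite eq_sym.
by rewrite -/K muleA muleC.
Qed.
End gauss_family.

Section householder.
Context (R : realType) (n : nat).

Lemma sum_delta (v : 'I_n -> R) k : \sum_b (b == k)%:R * v b = v k.
Proof.
rewrite (bigD1 k)//= eqxx mul1r big1 ?addr0// => b /negbTE ->.
by rewrite mul0r.
Qed.

(** The Householder reflection exchanging the given unit vector and a basis
   vector. *)
Lemma orth_complete (c : 'I_n -> R) (i0 : 'I_n) : \sum_j c j ^+ 2 = 1 ->
  exists2 U : 'M[R]_n, U *m U^T = 1%:M & forall j, U i0 j = c j.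
Proof.
move=> c1.
have [ci|ci] := eqVneq (c i0) 1.
  exists 1%:M; first by rewrite trmx1 mulmx1.
  move=> j; rewrite mxE; have [<-//|ij] := eqVneq i0 j.
  have /eqP : \sum_(k | k != i0) c k ^+ 2 = 0.
    by move: c1; rewrite (bigD1 i0)//= ci expr1n => /(canRL (addKr _)) ->; rewrite addNr.
  rewrite psumr_eq0; last by move=> k _; exact: sqr_ge0.
  move=> /allP /(_ j (mem_index_enum _)) /implyP; rewrite eq_sym => /(_ ij).
  by rewrite sqrf_eq0 => /eqP ->.
pose w j := c j - (j == i0)%:R.
pose b := (1 - c i0)^-1.
have c0 : 1 - c i0 != 0 by rewrite subr_eq0 eq_sym.
have ww : \sum_j w j * w j = 2 * (1 - c i0).
  transitivity (\sum_j (c j ^+ 2 - 2 * ((j == i0)%:R * c j) + (j == i0)%:R * 1)).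
    apply: eq_bigr => j _; rewrite /w; case: (j == i0); rewrite ?mulr1n ?mulr0n; ring.
  by rewrite big_split sumrB/= c1 -mulr_sumr !sum_delta; ring.
pose U : 'M[R]_n := \matrix_(i, j) ((j == i)%:R - b * w i * w j).
exists U; last first.
  move=> j; rewrite mxE /w eqxx mulr1n; rewrite -[c i0 - 1]opprB mulrN mulVf//.
  by ring.
apply/matrixP => i j; rewrite mxE.
under eq_bigr do rewrite [X in _ * X]mxE.
transitivity (\sum_k (k == i)%:R * U j k - b * w i * (\sum_k (k == j)%:R * w k) +
   b * w i * (b * w j) * \sum_k w k * w k).
  rewrite !mulr_sumr -sumrB -big_split/=; apply: eq_bigr => k _.
  by rewrite !mxE; ring.
by rewrite !sum_delta ww !mxE (eq_sym i) /b; field.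
Qed.
End householder.

Section givens.
Context (R : realType) (n : nat).
Implicit Types (i j : 'I_n) (c s : R).

Definition givens i j c s : 'M[R]_n := \matrix_(a, b)
  (if a == i then c * (b == i)%:R + s * (b == j)%:R
   else if a == j then c * (b == j)%:R - s * (b == i)%:R else (b == a)%:R).

Lemma givensE i j c s (v : 'I_n -> R) a :
  \sum_b givens i j c s a b * v b =
  if a == i then c * v i + s * v j
  else if a == j then c * v j - s * v i else v a.
Proof.
transitivity (\sum_b
  (if a == i then c * ((b == i)%:R * v b) + s * ((b == j)%:R * v b)
  else if a == j then c * ((b == j)%:R * v b) - s * ((b == i)%:R * v b)
  else (b == a)%:R * v b)).
  apply: eq_bigr => b _; rewrite mxE.
  by case: (a == i); [ring|case: (a == j) => //; ring].
case: (a == i); first by rewrite big_split/= -!mulr_sumr !sum_delta.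
by case: (a == j); [rewrite sumrB -!mulr_sumr !sum_delta|rewrite sum_delta].
Qed.

Lemma givens_orth i j c s : i != j -> c ^+ 2 + s ^+ 2 = 1 ->
  givens i j c s *m (givens i j c s)^T = 1%:M.
Proof.
move=> ij cs; have ji : j != i by rewrite eq_sym.
apply/matrixP => a b; rewrite mxE.
under eq_bigr do rewrite [X in _ * X]mxE.
rewrite givensE !mxE !eqxx (negbTE ij) (negbTE ji).
have [ai|ai] := eqVneq a i.
  subst a; have [bi|bi] := eqVneq b i.
    by subst b; rewrite !mulr1n !mulr0n -[RHS]cs; ring.
  rewrite ?(eq_sym i) ?(negbTE bi) ?(eq_sym j); case: (b == j);
  by rewrite ?mulr1n ?mulr0n; ring.
have [aj|aj] := eqVneq a j.
  subst a; have [bi|bi] := eqVneq b i.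
    by subst b; rewrite ?(negbTE ji) !mulr1n !mulr0n; ring.
  have [bj|bj] := eqVneq b j.
    by subst b; rewrite !mulr1n !mulr0n -[RHS]cs; ring.
  by rewrite ?(eq_sym i) ?(eq_sym j) ?(negbTE bi) ?(negbTE bj) !mulr0n; ring.
have [bi|bi] := eqVneq b i.
  by subst b; rewrite ?(negbTE ai) !mulr0n; ring.
have [bj|//] := eqVneq b j.
by subst b; rewrite ?(negbTE aj) !mulr0n; ring.
Qed.
End givens.

Section orthogonal_invariance.
Context d (T : measurableType d) (R : realType) (P : probability T R).
Context (J : finType) (n : nat).
Local Notation gauss := (@normal_prob R 0 1).
Local Notation RR := (measurableTypeR R).
Implicit Types (U V : 'M[R]_n) (Y : 'I_n * J -> T -> R).

(** The rows of the family are mixed by U, the columns (indexed by J) are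
   left apart: this is the matrix product of U with the random matrix of
   entries Y. *)
Definition mx_family U Y (k : 'I_n * J) t := \sum_i U k.1 i * Y (i, k.2) t.

Definition preserves_gauss U :=
  forall Y, gauss_family P Y -> gauss_family P (mx_family U Y).

Lemma preserves_gaussM U V :
  preserves_gauss U -> preserves_gauss V -> preserves_gauss (U *m V).
Proof.
move=> pU pV Y gY; apply: eq_gauss_family (pU _ (pV _ gY)) => -[a j] t.
rewrite /mx_family /=; under [RHS]eq_bigr do rewrite mxE mulr_suml.
rewrite [RHS]exchange_big/=; apply: eq_bigr => i _.
by rewrite mulr_sumr; apply: eq_bigr => k _; rewrite mulrA.
Qed.

(** The rotation is applied to the columns one after the other; on a single
   column it only rotates two variables of the family. *)
Lemma preserves_gauss_givens (i j : 'I_n) c s : i != j ->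
  c ^+ 2 + s ^+ 2 = 1 -> preserves_gauss (givens i j c s).
Proof.
move=> ij cs Y gY.
have cols (l : seq J) : uniq l -> gauss_family P
    (fun k t => if k.2 \in l then mx_family (givens i j c s) Y k t else Y k t).
  elim: l => [_|x l IH /= /andP[xl ul]].
    by apply: eq_gauss_family gY => k t; rewrite in_nil.
  have ijx : (i, x) != (j, x) by apply: contra_neq ij => -[].
  apply: eq_gauss_family (gauss_family_rotate ijx cs (IH ul)) => -[a y] t.
  rewrite /rotate_family /= (negbTE xl) inE.
  have [->|yx] := eqVneq y x; last first.
    by rewrite !xpair_eqE (negbTE yx) !andbF.
  rewrite /mx_family givensE /= !xpair_eqE eqxx !andbT (negbTE xl).
  by [].
apply: eq_gauss_family (cols (enum J) (enum_uniq _)) => k t.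
by rewrite mem_enum.
Qed.

Lemma gaussN (A : set R) : measurable A -> gauss (-%R @^-1` A) = gauss A.
Proof.
move=> mA.
have E (B : set R) : measurable B ->
    gauss B = (\int[@lebesgue_measure R]_x ((\1_B x)%:E * (normal_pdf 0 1 x)%:E))%E.
  move=> mB; rewrite -ge0_integral_normal.
  - by rewrite integral_indic// setIT.
  - exact/measurable_EFinP/measurable_indic.
  - by move=> x; rewrite lee_fin.
have mNA : measurable (-%R @^-1` A : set R).
  by rewrite -[X in measurable X]setTI; exact: oppr_measurable.
rewrite (E _ mNA) (E _ mA).
rewrite [RHS](@ge0_integral_affine _ (-1) 0); last 3 first.
- by rewrite oppr_eq0 oner_eq0.
- apply: emeasurable_funM; apply/measurable_EFinP; first exact: measurable_indic.
  exact: measurable_normal_pdf.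
- by move=> x; rewrite mule_ge0// lee_fin normal_pdf_ge0.
rewrite normrN1 mul1e; apply: eq_integral => x _.
by rewrite addr0 mulN1r !normal_pdf01E sqrrN.
Qed.

(** An orthogonal diagonal matrix has entries 1 and -1, and the standard
   normal law is symmetric. *)
Lemma preserves_gauss_diag U : U *m U^T = 1%:M ->
  (forall i j, j != i -> U i j = 0) -> preserves_gauss U.
Proof.
move=> UU Ud Y [mY hY].
have E k t : mx_family U Y k t = U k.1 k.1 * Y k t.
  rewrite /mx_family (bigD1 k.1)//= big1 ?addr0; first by case: k.
  by move=> i ik; rewrite Ud// mul0r.
have U1 i : U i i = 1 \/ U i i = -1.
  have := congr1 (fun M : 'M[R]_n => M i i) UU; rewrite !mxE eqxx (bigD1 i)//=.
  rewrite big1 ?addr0 => [|k ki]; last by rewrite Ud// mul0r.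
  by rewrite mxE -expr2 => /eqP; rewrite sqrf_eq1 => /orP[]/eqP; [left|right].
apply: (eq_gauss_family (fun k t => esym (E k t))); split.
  by move=> k; apply: measurable_funM => //; exact: measurable_cst.
move=> B mB.
have pE k : (fun t => U k.1 k.1 * Y k t) @^-1` B k =
    Y k @^-1` ((fun x => U k.1 k.1 * x) @^-1` B k) by [].
under eq_bigcapr do rewrite pE.
rewrite hY => [|k].
  apply: eq_bigr => k _.
  have [->|->] := U1 k.1; last first.
    transitivity (gauss (-%R @^-1` B k)); last exact: gaussN (mB k).
    by congr (gauss _); apply/seteqP; split => x /=; rewrite mulN1r.
  by congr (gauss _); apply/seteqP; split => x /=; rewrite mul1r.
rewrite -[X in measurable X]setTI; apply: measurable_funM => //; exact: measurable_cst.
Qed.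

(** Givens rotations annihilate the off-diagonal entries of the rows one
   after the other, from the last row upwards, which reduces an orthogonal
   matrix to a diagonal one. *)
Lemma preserves_gauss_orth U : U *m U^T = 1%:M -> preserves_gauss U.
Proof.
suff H k : (k <= n)%N -> forall U, U *m U^T = 1%:M ->
    (forall i j : 'I_n, (k <= i)%N -> j != i -> U i j = 0) -> preserves_gauss U.
  by move=> UU; apply: (H n (leqnn n)) => // i j; rewrite leqNgt ltn_ord.
elim: k {U} => [_ U UU Ud|k IH kn U UU Ud].
  by apply: preserves_gauss_diag => // i j; exact: Ud.
pose K : 'I_n := Ordinal kn.
have [m] := ubnP #|[pred j : 'I_n | (j != K) && (U K j != 0)]|.
elim: m U UU Ud => // m IHm U UU Ud; rewrite ltnS => Um.
have [j /andP[jK UKj]|noj] := pickP [pred j : 'I_n | (j != K) && (U K j != 0)]; last first.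
  apply: IH => //; first exact: ltnW.
  move=> i j; rewrite leq_eqVlt => /predU1P[ki ji|]; last exact: Ud.
  have iK : i = K by exact/val_inj.
  have := noj j; rewrite /= -iK ji/= => /negbFE/eqP //.
(* A row below K is a multiple of a basis vector, so orthogonality of the rows
   forces a zero at its pivot column in row K. *)
have jlt (i : 'I_n) : (k < i)%N -> i != j.
  move=> ki; apply: contra_neq UKj => ij.
  have rowj b : b != j -> U j b = 0 by move=> bj; apply: Ud => //; rewrite -ij.
  have ent a : \sum_b U a b * U j b = (a == j)%:R.
    have := congr1 (fun M : 'M[R]_n => M a j) UU; rewrite !mxE => <-.
    by apply: eq_bigr => b _; rewrite mxE.
  have entj a : U a j * U j j = (a == j)%:R.
    rewrite -ent (bigD1 j)//= big1 ?addr0// => b bj.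
    by rewrite rowj// mulr0.
  have Ujj : U j j != 0.
    by apply/eqP => U0; have := entj j; rewrite U0 mulr0 eqxx => /eqP; rewrite eq_sym oner_eq0.
  by apply: (mulIf Ujj); rewrite entj mul0r eq_sym (negbTE jK).
set rho := Num.sqrt (U K K ^+ 2 + U K j ^+ 2).
have sq0 : 0 < U K K ^+ 2 + U K j ^+ 2.
  by rewrite ltr_wpDl ?sqr_ge0// lt_neqAle sqr_ge0 eq_sym sqrf_eq0 UKj.
have rho0 : 0 < rho by rewrite sqrtr_gt0.
have rho2 : rho ^+ 2 = U K K ^+ 2 + U K j ^+ 2 by rewrite sqr_sqrtr// ltW.
set c := U K K / rho; set s := U K j / rho.
have cs : c ^+ 2 + s ^+ 2 = 1.
  by rewrite /c /s !expr_div_n -mulrDl -rho2 divff// sqrf_eq0 gt_eqF.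
have Kj : K != j by rewrite eq_sym.
set G := givens K j c s.
have GG : G *m G^T = 1%:M by exact: givens_orth.
have GG' : G^T *m G = 1%:M by exact: mulmx1C.
rewrite -[U]mulmx1 -GG' mulmxA; apply: preserves_gaussM; last exact: preserves_gauss_givens.
have VE a b : (U *m G^T) a b = if b == K then c * U a K + s * U a j
    else if b == j then c * U a j - s * U a K else U a b.
  rewrite mxE -givensE; apply: eq_bigr => e _.
  by rewrite mulrC [X in X * _]mxE.
have VKj : (U *m G^T) K j = 0.
  by rewrite VE (negbTE jK) eqxx /c /s; ring.
apply: IHm.
- by rewrite trmx_mul trmxK mulmxA -[U *m _ *m G]mulmxA GG' mulmx1.
- move=> a b ka ba; rewrite VE.
  have aK : K != a by apply: contraTneq ka => <-; rewrite ltnn.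
  have ja : j != a by rewrite eq_sym jlt.
  by rewrite !(Ud a K)// !(Ud a j)// !mulr0 addr0 subr0; case: ifP => // _; case: ifP => // _; exact: Ud.
- apply: leq_trans Um; apply: proper_card; apply/properP; split.
    apply/fintype.subsetP => b; rewrite !inE VE => /andP[bK].
    by rewrite bK (negbTE bK) /=; have [->|_] := eqVneq b j.
  by exists j; rewrite !inE jK ?UKj// VKj eqxx.
Qed.
End orthogonal_invariance.

Section decoupling.
Context d (T : measurableType d) (R : realType) (P : probability T R).
Local Notation gauss := (@normal_prob R 0 1).
Local Notation RR := (measurableTypeR R).

Lemma gauss_family_inj (I I' : finType) (f : I' -> I) (Y : I -> T -> R) :
  injective f -> gauss_family P Y -> gauss_family P (fun i => Y (f i)).
Proof.
move=> injf [mY hY]; split => // B mB.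
pose B' i : set R := if [pick j | f j == i] is Some j then B j else setT.
have B'f j : B' (f j) = B j.
  rewrite /B'; case: pickP => [k /eqP/injf -> //|/(_ j)].
  by rewrite eqxx.
have mB' i : measurable (B' i) by rewrite /B'; case: pickP.
have := hY B' mB'.
rewrite (bigID (mem (codom f)))/= [X in (_ * X)%E]big1 ?mule1; last first.
  move=> i ifc; rewrite /B'; case: pickP => [j /eqP fj|_].
    by move: ifc; rewrite -fj codom_f.
  exact: integral_normal_pdf.
rewrite -big_uniq; last by rewrite map_inj_uniq// enum_uniq.
rewrite /= big_map big_enum /=; under eq_bigr do rewrite B'f.
move=> <-; congr (P _); apply/seteqP; split => [t h i _|t h j _]; last first.
  by have := h (f j) Logic.I; rewrite /= B'f.
rewrite /= /B'; case: pickP => // j /eqP <-; exact: h.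
Qed.

Lemma gauss_family_law (I : finType) (Y : I -> T -> R) (i : I) (A : set R) :
  gauss_family P Y -> measurable A -> P (Y i @^-1` A) = gauss A.
Proof.
move=> gY mA.
have inj1 : injective (fun _ : unit => i) by move=> [] [].
have [_ /(_ (fun=> A) (fun=> mA))] := gauss_family_inj inj1 gY.
rewrite big_const card_unit /= mule1 => <-; congr (P _).
by apply/seteqP; split => [t h _ _|t h]; [exact: h|exact: (h tt Logic.I)].
Qed.

Definition tuple_of_family (I : finType) p (Y : I -> T -> R) (f : 'I_p -> I) t :
  p.-tuple RR := [tuple Y (f j) t | j < p].

Lemma measurable_tuple_of_family (I : finType) p (Y : I -> T -> R) (f : 'I_p -> I) :
  gauss_family P Y -> measurable_fun setT (tuple_of_family Y f).
Proof.
move=> [mY _]; apply/measurable_fun_tnthP => j.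
by apply: (eq_measurable_fun (Y (f j))) => // t _; rewrite /= tnth_mktuple.
Qed.

Section two_blocks.
Context (I : finType) (p q : nat) (Y : I -> T -> R) (f : 'I_p -> I) (g : 'I_q -> I).
Hypotheses (gY : gauss_family P Y) (injf : injective f) (injg : injective g).
Hypothesis fg : forall i j, f i != g j.

Let X1 : {mfun T >-> p.-tuple RR} :=
  HB.pack (tuple_of_family Y f)
    (isMeasurableFun.Build _ _ _ _ _ (measurable_tuple_of_family f gY)).
Let X2 : {mfun T >-> q.-tuple RR} :=
  HB.pack (tuple_of_family Y g)
    (isMeasurableFun.Build _ _ _ _ _ (measurable_tuple_of_family g gY)).

Let box_indep (A : 'I_p -> set RR) (B : 'I_q -> set RR) :
  (forall i, measurable (A i)) -> (forall i, measurable (B i)) ->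
  P (X1 @^-1` tuple_box A `&` X2 @^-1` tuple_box B) =
  (P (X1 @^-1` tuple_box A) * P (X2 @^-1` tuple_box B))%E.
Proof.
move=> mA mB.
have marg m (h : 'I_m -> I) (C : 'I_m -> set RR) : injective h ->
    (forall i, measurable (C i)) ->
    P (tuple_of_family Y h @^-1` tuple_box C) = (\prod_i gauss (C i))%E.
  move=> injh mC; have [_ <- //] := gauss_family_inj injh gY.
  congr (P _); apply/seteqP; split => [t h1 i _|t h1 i].
    by have := h1 i; rewrite tnth_mktuple.
  by rewrite tnth_mktuple; exact: h1.
rewrite (marg _ f A)// (marg _ g B)//.
pose k (u : 'I_p + 'I_q) := match u with inl i => f i | inr j => g j end.
have injk : injective k.
  move=> [i|i] [j|j] /= h; [by rewrite (injf h)| | |by rewrite (injg h)].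
    by have := fg i j; rewrite h eqxx.
  by have := fg j i; rewrite h eqxx.
pose C u := match u with inl i => A i | inr j => B j end.
have mC u : measurable (C u) by case: u.
have [_ /(_ C mC)] := gauss_family_inj injk gY.
rewrite big_sumType /= => <-; congr (P _); apply/seteqP; split.
  move=> t [h1 h2] [i|i] _ /=.
    by have := h1 i; rewrite tnth_mktuple.
  by have := h2 i; rewrite tnth_mktuple.
move=> t h; split => i; rewrite tnth_mktuple.
  exact: (h (inl i) Logic.I).
exact: (h (inr i) Logic.I).
Qed.

Let mX1 A : measurable A -> measurable (X1 @^-1` A).
Proof. by move=> mA; rewrite -[X in measurable X]setTI; exact: measurable_funPT. Qed.

Let mX2 A : measurable A -> measurable (X2 @^-1` A).
Proof. by move=> mA; rewrite -[X in measurable X]setTI; exact: measurable_funPT. Qed.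

Let box_set_indep A (B : 'I_q -> set RR) :
  measurable A -> (forall i, measurable (B i)) ->
  P (X1 @^-1` A `&` X2 @^-1` tuple_box B) =
  (P (X1 @^-1` A) * P (X2 @^-1` tuple_box B))%E.
Proof.
move=> mA mB.
have mXB := mX2 (measurable_tuple_box mB).
have k0 : 0 <= fine (P (X2 @^-1` tuple_box B)) by exact: fine_ge0.
pose m1 := image_measure (mrestr P mXB) (measurable_tuple_of_family f gY).
pose m2 : {measure set (p.-tuple RR) -> \bar R} :=
  mscale (NngNum k0) (image_measure P (measurable_tuple_of_family f gY)).
have : m1 A = m2 A.
  apply: eq_measure_box => //.
    rewrite /m1 /= /pushforward preimage_setT /mrestr setTI.
    by rewrite (le_lt_trans (probability_le1 P mXB))// ltry.
  move=> C mC; rewrite /m1 /m2 /= /pushforward /mrestr /mscale /=.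
  by rewrite fineK ?fin_num_measure//; rewrite box_indep// muleC.
rewrite /m1 /m2 /= /pushforward /mrestr /mscale /= => ->.
by rewrite fineK ?fin_num_measure// muleC.
Qed.

Lemma block_law C : measurable C ->
  (distribution P X1 \x distribution P X2)%E C =
  P ((fun t => (X1 t, X2 t)) @^-1` C).
Proof.
move=> mC.
have mX12 : measurable_fun setT (fun t => (X1 t, X2 t)).
  by apply: measurable_fun_pair; exact: measurable_funPT.
apply: (@product_measure_unique _ _ _ _ R (distribution P X1) (distribution P X2)
  (image_measure P mX12)) => // A B mA mB.
have mXA := mX1 mA.
have k0 : 0 <= fine (P (X1 @^-1` A)) by exact: fine_ge0.
pose m1 := image_measure (mrestr P mXA) (measurable_tuple_of_family g gY).
pose m2 : {measure set (q.-tuple RR) -> \bar R} :=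
  mscale (NngNum k0) (image_measure P (measurable_tuple_of_family g gY)).
have : m1 B = m2 B.
  apply: eq_measure_box => //.
    rewrite /m1 /= /pushforward preimage_setT /mrestr setTI.
    by rewrite (le_lt_trans (probability_le1 P mXA))// ltry.
  move=> D mD; rewrite /m1 /m2 /= /pushforward /mrestr /mscale /=.
  by rewrite fineK ?fin_num_measure// setIC box_set_indep.
rewrite /m1 /m2 /= /pushforward /mrestr /mscale /= fineK ?fin_num_measure//.
by rewrite setIC => <-.
Qed.

(** Disjoint subfamilies are independent: the product rule holds for boxes,
   extends to all measurable sets in one block and then in both, and
   Fubini's theorem turns it into an iterated integral. *)
Lemma ge0_integral_blocks (H : p.-tuple RR * q.-tuple RR -> \bar R) :
  measurable_fun setT H -> (forall z, 0 <= H z)%E ->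
  (\int[P]_t H (tuple_of_family Y f t, tuple_of_family Y g t) =
   \int[P]_t \int[P]_t' H (tuple_of_family Y f t, tuple_of_family Y g t'))%E.
Proof.
move=> mH H0.
have mX12 : measurable_fun setT (fun t => (X1 t, X2 t)).
  by apply: measurable_fun_pair; exact: measurable_funPT.
transitivity (\int[distribution P X1 \x distribution P X2]_z H z)%E.
  transitivity (\int[image_measure P mX12]_z H z)%E.
    by rewrite ge0_integral_image.
  by apply: eq_measure_integral => C mC _; have := block_law mC.
rewrite fubini_tonelli1//.
rewrite ge0_integral_distribution; last 2 first.
- exact: measurable_fun_fubini_tonelli_F.
- by move=> x; apply: integral_ge0.
apply: eq_integral => t _; rewrite /= /fubini_F ge0_integral_distribution//.
exact: measurable_fun_pair2.
Qed.
End two_blocks.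
End decoupling.

Section gauss_rows.
Context d (T : measurableType d) (R : realType) (P : probability T R).
Local Notation gauss := (@normal_prob R 0 1).
Local Notation RR := (measurableTypeR R).

(** The coefficients c form the first row of an orthogonal matrix, so the
   combination is an entry of an orthogonally transformed family. *)
Lemma gauss_family_linear (I : finType) l (Y : I -> T -> R) (f : 'I_l -> I)
    (c : 'I_l -> R) (A : set R) : (0 < l)%N ->
  gauss_family P Y -> injective f -> \sum_j c j ^+ 2 = 1 -> measurable A ->
  P [set t | A (\sum_j c j * Y (f j) t)] = gauss A.
Proof.
case: l f c => // l f c _ gY injf c1 mA.
have [U UU Uc] := orth_complete ord0 c1.
have injf' : injective (fun k : 'I_l.+1 * unit => f k.1).
  by move=> [i []] [j []] /= /injf ->.
have gZ := preserves_gauss_orth UU (gauss_family_inj injf' gY).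
rewrite -(gauss_family_law (ord0, tt) gZ mA); congr (P _).
apply/funext => t /=; congr (A _).
by apply: eq_bigr => j _; rewrite Uc.
Qed.

(** Given one row, the component of another row in a unit direction chosen
   as a function of the first one is still standard normal: rotational
   invariance makes its conditional law independent of the direction. *)
Lemma ge0_integral_gauss_direction (n l : nat) (Y : 'I_n * 'I_l -> T -> R) (r r' : 'I_n)
    (dir : l.-tuple RR -> 'I_l -> R) (F : l.-tuple RR -> \bar R) (G : R -> \bar R) :
  (0 < l)%N -> gauss_family P Y -> r != r' ->
  (forall j, measurable_fun setT (dir ^~ j)) ->
  (forall x, \sum_j dir x j ^+ 2 = 1) ->
  measurable_fun setT F -> (forall x, 0 <= F x)%E ->
  measurable_fun setT G -> (forall x, 0 <= G x)%E ->
  let a t := tuple_of_family Y (pair r) t in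
  (\int[P]_t (F (a t) * G (\sum_j dir (a t) j * Y (r', j) t)%R) =
   (\int[P]_t F (a t)) * \int[gauss]_x G x)%E.
Proof.
move=> l0 gY rr' mdir dir1 mF F0 mG G0 a.
have injr : injective (pair r : 'I_l -> 'I_n * 'I_l) by move=> i j [].
have injr' : injective (pair r' : 'I_l -> 'I_n * 'I_l) by move=> i j [].
have disj (i j : 'I_l) : (r, i) != (r', j) by rewrite xpair_eqE (negbTE rr').
pose lin (z : l.-tuple RR * l.-tuple RR) : RR := \sum_j dir z.1 j * tnth z.2 j.
have mlin : measurable_fun setT lin.
  apply: measurable_sum => j; apply: measurable_funM.
    by apply: (measurableT_comp (mdir j)); exact: measurable_fst.
  by apply: (measurableT_comp (measurable_tnth j)); exact: measurable_snd.
pose H (z : l.-tuple RR * l.-tuple RR) : \bar R := (F z.1 * G (lin z))%E.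
have mH : measurable_fun setT H.
  apply: emeasurable_funM.
    by apply: (measurableT_comp mF); exact: measurable_fst.
  by apply: (measurableT_comp mG).
have H0 z : (0 <= H z)%E by rewrite /H mule_ge0.
have mY k := gY.1 k.
have E := ge0_integral_blocks gY injr injr' disj mH H0.
transitivity (\int[P]_t H (tuple_of_family Y (pair r) t, tuple_of_family Y (pair r') t))%E.
  apply: eq_integral => t _; rewrite /H /lin /=; congr (_ * G _)%E.
  by apply: eq_bigr => j _; rewrite /tuple_of_family !tnth_mktuple.
rewrite E -ge0_integralZr//; last 2 first.
- by apply: (measurableT_comp mF); exact: (measurable_tuple_of_family _ gY).
- by apply: integral_ge0.
apply: eq_integral => t _; rewrite /H /=.
have mlin2 : measurable_fun setT (fun t' => lin (a t, tuple_of_family Y (pair r') t')).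
  apply: (measurableT_comp mlin); apply: measurable_fun_pair => //.
  exact: (measurable_tuple_of_family _ gY).
rewrite ge0_integralZl//; last exact: (measurableT_comp mG mlin2).
congr (_ * _)%E.
rewrite -(ge0_integral_image P mlin2 mG G0).
apply: eq_measure_integral => A mA _; rewrite /= /pushforward.
rewrite -(gauss_family_linear l0 gY injr' (dir1 (a t)) mA); congr (P _).
apply/funext => t' /=; congr (A _).
by apply: eq_bigr => j _; rewrite /tuple_of_family tnth_mktuple.
Qed.

Lemma ge0_integral_gauss_prod (I : finType) (Y : I -> T -> R) (h : R -> R) (s : seq I) :
  gauss_family P Y -> uniq s -> measurable_fun setT h -> (forall x, 0 <= h x) ->
  (\int[P]_t (\prod_(i <- s) h (Y i t))%:E =
   \prod_(i <- s) \int[gauss]_x (h x)%:E)%E.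
Proof.
move=> gY + mh h0; elim: s => [_|i s IH /= /andP[is_ us]].
  rewrite !big_nil; under eq_integral do rewrite big_nil.
  by rewrite integral_cst// mul1e; exact: probability_setT.
rewrite big_cons -IH//.
have inj1 : injective (fun _ : 'I_1 => i) by move=> j k _; rewrite !ord1.
pose g (j : 'I_(size s)) := tnth (in_tuple s) j.
have injg : injective g.
  by apply/tuple_uniqP.
have disj (j : 'I_1) k : i != g k.
  by apply: contraNneq is_ => ->; rewrite /g mem_tnth.
pose H (z : 1.-tuple RR * (size s).-tuple RR) : \bar R :=
  ((h (tnth z.1 ord0))%:E * (\prod_j h (tnth z.2 j))%:E)%E.
have mH : measurable_fun setT H.
  apply: emeasurable_funM; apply/measurable_EFinP.
    apply: (measurableT_comp mh); apply: (measurableT_comp (measurable_tnth _)).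
    exact: measurable_fst.
  apply: measurable_prod => j _.
  apply: (measurableT_comp mh); apply: (measurableT_comp (measurable_tnth _)).
  exact: measurable_snd.
have H0 z : (0 <= H z)%E by rewrite /H mule_ge0// lee_fin ?prodr_ge0.
have := ge0_integral_blocks gY inj1 injg disj mH H0.
have prodE t : \prod_j h (tnth (tuple_of_family Y g t) j) = \prod_(k <- s) h (Y k t).
  rewrite [RHS](big_nth i) big_mkord; apply: eq_bigr => j _.
  by rewrite tnth_mktuple /g (tnth_nth i).
under eq_integral do rewrite /H /= prodE tnth_mktuple -EFinM.
move=> E; under [LHS]eq_integral do rewrite big_cons.
rewrite {}E.
have mY k := gY.1 k.
have mp : measurable_fun setT (fun t => \prod_(k <- s) h (Y k t)).
  by apply: measurable_prod => k _; apply: measurableT_comp.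
under eq_integral => t _.
  under eq_integral => t' _ do rewrite /H /= prodE tnth_mktuple.
  rewrite ge0_integralZl//; last 3 first.
  - exact/measurable_EFinP.
  - by move=> t' _; rewrite lee_fin prodr_ge0.
  - by rewrite lee_fin.
  over.
rewrite /= ge0_integralZr//; last 3 first.
- by apply/measurable_EFinP; exact: measurableT_comp.
- by move=> t _; rewrite lee_fin.
- by apply: integral_ge0 => t _; rewrite lee_fin prodr_ge0.
congr (_ * _)%E.
have mYi : measurable_fun setT (Y i : T -> RR) := mY i.
rewrite -(@ge0_integral_image _ _ _ _ _ P _ mYi (fun x => (h x)%:E))//.
- by apply: eq_measure_integral => A mA _; exact: (gauss_family_law i gY mA).
- exact/measurable_EFinP.
Qed.
End gauss_rows.

(** * Chebyshev filters *)

Section chebyshev.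
Context {R : realType}.
Implicit Types (x u v z : R) (q : nat).

Lemma ge0_derive_le (f df : R -> R) b : 0 <= b ->
  (forall x, 0 <= x <= b -> is_derive x 1 f (df x)) ->
  (forall x, 0 <= x <= b -> 0 <= df x) -> f 0 <= f b.
Proof.
move=> b0 fdf df0.
have D x : x \in `]0, b[ -> is_derive x 1 f (df x).
  by rewrite in_itv/= => /andP[x0 xb]; apply: fdf; rewrite !ltW.
have C : {within `[0, b], continuous f}.
  apply: derivable_within_continuous => x; rewrite in_itv/= => xb.
  by have := fdf x xb; case.
have [c] := MVT_segment b0 D C.
rewrite in_itv/= => cb E; rewrite -subr_ge0 E subr0 mulr_ge0//.
exact: df0.
Qed.

Lemma sin_le_id x : 0 <= x -> sin x <= x.
Proof.
move=> x0; rewrite -subr_ge0.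
have := @ge0_derive_le (fun y => y - sin y) (fun y => 1 - cos y) x x0.
by rewrite sin0 subr0; apply => y _; rewrite subr_ge0 cos_le1.
Qed.

Lemma cos_ge_quad x : 0 <= x -> 1 - x ^+ 2 / 2 <= cos x.
Proof.
move=> x0.
have -> : cos x = 1 - 2 * sin (x / 2) ^+ 2.
  have {1}-> : x = (x / 2) *+ 2 by rewrite -mulr_natr; field.
  by rewrite cos_mulr2n cos2sin2; ring.
have [s0|s0] := leP 0 (sin (x / 2)).
  have h : sin (x / 2) <= x / 2 by apply: sin_le_id; rewrite divr_ge0.
  have : sin (x / 2) ^+ 2 <= (x / 2) ^+ 2 by rewrite ler_pXn2r ?nnegrE ?divr_ge0.
  by move=> ?; lra.
have h : - sin (x / 2) <= x / 2.
  rewrite -subr_ge0 opprK.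
  have := @ge0_derive_le (fun y => y + sin y) (fun y => 1 + cos y) (x / 2).
  rewrite sin0 addr0 divr_ge0// => /(_ isT); apply => y _.
  by have := cos_geN1 y; lra.
have : sin (x / 2) ^+ 2 <= (x / 2) ^+ 2.
  rewrite -(sqrrN (sin _)) ler_pXn2r ?nnegrE ?divr_ge0//.
  by rewrite oppr_ge0 ltW.
by move=> ?; lra.
Qed.

Lemma sin_ge_cubic x : 0 <= x -> x - x ^+ 3 / 6 <= sin x.
Proof.
move=> x0; rewrite -subr_ge0.
have := @ge0_derive_le (fun y => sin y - (y - y ^+ 3 / 6))
  (fun y => cos y - (1 - y ^+ 2 / 2)) x x0.
rewrite sin0 expr0n /= mul0r !subr0; apply => y /andP[y0 _]; last first.
  by rewrite subr_ge0 cos_ge_quad.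
apply: is_deriveB; apply: is_deriveB.
by apply: is_derive_eq; rewrite /GRing.scale/=; field.
Qed.

(** From sin (pi / 6) = 1 / 2 and the cubic lower bound for the sine,
   iterated twice starting from pi < 4. *)
Lemma pi_le_16_5 : (pi : R) <= 16 / 5.
Proof.
set y : R := pi / 6.
have p4 : (pi : R) < 4 by have := @pihalf_lt2 R; lra.
have p0 := @pi_gt0 R.
have y0 : 0 <= y by rewrite /y; lra.
have s12 : sin y = 2^-1.
  have s3 : 3 * sin y - 4 * sin y ^+ 3 = 1.
    transitivity (sin (y *+ 2 + y)); last first.
      by rewrite -[RHS]sin_pihalf /y; congr sin; rewrite mulr2n; field.
    rewrite sinD cos_mulr2n sin_mulr2n !mulr2n.
    transitivity (sin y * (2 * cos y ^+ 2 - 1 + 2 * cos y ^+ 2)); last by ring.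
    by rewrite cos2sin2; ring.
  have sy0 : 0 <= sin y by apply: sin_ge0_pi; rewrite y0 /y; lra.
  have /eqP : (2 * sin y - 1) ^+ 2 * (sin y + 1) = 0 by lra.
  rewrite mulf_eq0 sqrf_eq0 => /orP[]/eqP ?; lra.
have := sin_ge_cubic y0; rewrite s12 => h.
have y23 : y <= 2 / 3 by rewrite /y; lra.
have step b : y <= b -> y * (1 - b ^+ 2 / 6) <= 2^-1.
  move=> yb; apply: le_trans h.
  have -> : y - y ^+ 3 / 6 = y * (1 - y ^+ 2 / 6) by ring.
  rewrite ler_wpM2l// lerD2l lerN2 ler_pM2r ?invr_gt0//.
  by rewrite ler_pXn2r ?nnegrE ?(le_trans y0 yb).
have y1 : y <= 27 / 50 by have := step _ y23; lra.
have : y <= 8 / 15; last by rewrite /y; lra.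
by have := step _ y1; lra.
Qed.
End chebyshev.

Section chebyshev_poly.
Context {R : realType}.
Implicit Types (x u v z : R) (q : nat).

Fixpoint cheb_pair q : {poly R} * {poly R} :=
  if q is q'.+1 then
    let: (a, b) := cheb_pair q' in (b, (4%:P * 'X - 2%:P) * b - a)
  else (1, 4%:P * 'X - 1).

(** The Chebyshev polynomials of the second kind of even degree, U_{2 q}, as
   polynomials in the square of the variable: cheb q evaluated at x ^+ 2 is
   U_{2 q} (x). *)
Definition cheb q : {poly R} := (cheb_pair q).1.

Lemma cheb0 : cheb 0 = 1. Proof. by []. Qed.

Lemma cheb1 : cheb 1 = 4%:P * 'X - 1. Proof. by []. Qed.

Lemma chebSS q : cheb q.+2 = (4%:P * 'X - 2%:P) * cheb q.+1 - cheb q.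
Proof. by rewrite /cheb /=; case: (cheb_pair q). Qed.

Lemma cheb_ind (Q : nat -> Prop) : Q 0%N -> Q 1%N ->
  (forall q, Q q -> Q q.+1 -> Q q.+2) -> forall q, Q q.
Proof.
move=> Q0 Q1 QSS q; suff : Q q /\ Q q.+1 by case.
by elim: q => // q [? ?]; split => //; exact: QSS.
Qed.

Lemma size_cheb q : (size (cheb q) <= q.+1)%N.
Proof.
have s1 (c : R) : (size ((4 : R)%:P * 'X - c%:P)%R <= 2)%N.
  rewrite (leq_trans (size_polyD _ _))// size_polyN geq_max.
  rewrite (leq_trans (size_polyC_leq1 _))// andbT.
  rewrite (leq_trans (size_polyMleq _ _))// size_polyX addn2/=.
  by rewrite ltnS size_polyC_leq1.
elim/cheb_ind: q => [|//|q H0 H1]; first by rewrite cheb0 size_poly1.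
  by rewrite cheb1 s1.
rewrite chebSS (leq_trans (size_polyD _ _))// size_polyN geq_max.
rewrite (leq_trans H0) ?andbT; last by rewrite ltnW.
rewrite (leq_trans (size_polyMleq _ _))//.
by have := leq_add (s1 2) H1; case: (_ + _)%N.
Qed.

Lemma cheb_sin q x : sin x * (cheb q).[cos x ^+ 2] = sin ((2 * q + 1)%:R * x).
Proof.
elim/cheb_ind: q => [|//|q H0 H1].
- by rewrite cheb0 hornerC mulr1 mul1r.
- rewrite cheb1 !hornerE /=.
  have -> : 3%:R * x = (x *+ 2 + x : R) by rewrite mulr2n; ring.
  rewrite sinD cos_mulr2n sin_mulr2n !mulr2n.
  by have := cos2Dsin2 x; move=> h; ring.
rewrite chebSS !hornerE /= mulrBr mulrCA H0 H1.
set A := (2 * q.+1 + 1)%:R * x.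
have -> : (2 * q.+2 + 1)%:R * x = A + x *+ 2.
  by rewrite /A mulr2n !mulnS !natrD; ring.
have -> : (2 * q + 1)%:R * x = A - x *+ 2.
  by rewrite /A mulr2n !mulnS !natrD; ring.
have C2 : cos (x *+ 2) = 2 * cos x ^+ 2 - 1 by rewrite cos_mulr2n mulr_natl.
by move: (x *+ 2) C2 => B C2; rewrite !sinD cosN sinN C2; ring.
Qed.

(** The counterpart of cheb_sin for the hyperbolic sine, with z for exp x. *)
Lemma cheb_hyp q z : z != 0 ->
  (z - z^-1) * (cheb q).[((z + z^-1) / 2) ^+ 2] =
  z ^+ (2 * q + 1) - z ^- (2 * q + 1).
Proof.
move=> z0; elim/cheb_ind: q => [|//|q H0 H1].
- by rewrite cheb0 hornerC mulr1 muln0 !expr1.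
- by rewrite cheb1 !hornerE /=; field.
rewrite chebSS !hornerE /= mulrBr mulrCA H0 H1.
set w := z ^+ (2 * q + 1).
have w0 : w != 0 by rewrite expf_neq0.
have -> : z ^+ (2 * q.+1 + 1) = z ^+ 2 * w by rewrite mulnS -addnA exprD.
have -> : z ^+ (2 * q.+2 + 1) = z ^+ 4 * w by rewrite !mulnS addnA -addnA exprD.
by field; rewrite w0.
Qed.

(** In the variable cos t ^+ 2, the left-hand side is sin ((2 q + 1) t) ^+
   2. *)
Lemma cheb_bound q x : 0 <= x <= 1 -> (1 - x) * (cheb q).[x] ^+ 2 <= 1.
Proof.
move=> /andP[x0 x1].
set t := acos (Num.sqrt x).
have ct : cos t ^+ 2 = x.
  rewrite /t acosK ?sqr_sqrtr// in_itv/= -sqrtr1 ler_sqrt// x1 andbT.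
  by apply: le_trans (sqrtr_ge0 _); rewrite sqrtr1 oppr_le0.
have -> : (1 - x) * (cheb q).[x] ^+ 2 = sin ((2 * q + 1)%:R * t) ^+ 2.
  by rewrite -cheb_sin exprMn ct sin2cos2 ct.
by rewrite sin2cos2 lerBlDr lerDl sqr_ge0.
Qed.

(** The least zero is sin (pi / (2 N)) ^+ 2 with N = 2 q + 1, of order N ^-
   2. *)
Lemma cheb_root q : (0 < q)%N ->
  exists x, [/\ (cheb q).[x] = 0, 0 < x &
    x * (2 * q + 1)%:R ^+ 2 <= 64 / 25].
Proof.
move=> q0.
set N : R := (2 * q + 1)%:R.
have N3 : 3 <= N by rewrite ler_nat addn1 ltnS (leq_mul (leqnn 2) q0).
set y : R := pi / (2 * N).
have p0 := @pi_gt0 R; have p16 := @pi_le_16_5 R.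
have y0 : 0 < y by rewrite divr_gt0//; lra.
have Ny : N * y = pi / 2 by rewrite /y; field; lra.
have yh : y < pi / 2.
  by rewrite -Ny -[ltLHS]mul1r ltr_pM2r//; lra.
have sy : 0 < sin y by apply: sin_gt0_pihalf; rewrite y0.
exists (sin y ^+ 2); split; last 2 first.
- by rewrite exprn_gt0.
- rewrite -exprMn mulrC; have -> : 64 / 25 = (8 / 5) ^+ 2 :> R by field.
  have N0 : 0 <= N by lra.
  rewrite ler_pXn2r ?nnegrE ?mulr_ge0 ?(ltW sy)//.
  apply: (@le_trans _ _ (N * y)); last by rewrite Ny; lra.
  by rewrite ler_wpM2l ?sin_le_id ?ltW//; lra.
have := cheb_sin q (pi / 2 - y).
have -> : cos (pi / 2 - y) = sin y.
  by rewrite -[RHS]cosBpihalf -cosN; congr cos; ring.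
have -> : (2 * q + 1)%:R * (pi / 2 - y) = pi *+ q.
  by rewrite mulrBr -/N Ny /N natrD natrM -[in RHS]mulr_natr; field.
have -> : sin (pi *+ q) = 0 :> R.
  elim: q {q0 N N3 y y0 Ny yh sy} => [|q IH]; first by rewrite mulr0n sin0.
  by rewrite mulrSr sinDpi IH oppr0.
move=> /eqP; rewrite mulf_eq0 => /orP[|/eqP//].
rewrite gt_eqF//.
have -> : sin (pi / 2 - y) = cos y.
  by rewrite addrC sinDpihalf cosN.
by apply: cos_gt0_pihalf; rewrite yh andbT (lt_trans _ y0)// oppr_lt0; lra.
Qed.

(** With z ^+ 2 = (1 + u) / (1 - u), the argument (1 - u ^+ 2)^-1 is the
   square of (z + 1 / z) / 2, so that cheb_hyp gives the value. *)
Lemma cheb_growth q u : 0 <= u < 1 ->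
  ((1 + u) / (1 - u)) ^+ (2 * q + 1) - 2 <=
  4 * (u ^+ 2 / (1 - u ^+ 2)) * (cheb q).[(1 - u ^+ 2)^-1] ^+ 2.
Proof.
move=> /andP[u0 u1].
have u1' : 0 < 1 - u by lra.
set w := (1 + u) / (1 - u).
have w0 : 0 < w by rewrite divr_gt0//; lra.
set z := Num.sqrt w.
have z0 : 0 < z by rewrite sqrtr_gt0.
have z2 : z ^+ 2 = w by rewrite sqr_sqrtr// ltW.
have d0 : 1 - u ^+ 2 != 0.
  have -> : 1 - u ^+ 2 = (1 - u) * (1 + u) by ring.
  by rewrite mulf_neq0//; lra.
have E1 : ((z + z^-1) / 2) ^+ 2 = (1 - u ^+ 2)^-1.
  have -> : ((z + z^-1) / 2) ^+ 2 = (z ^+ 2 + 2 + (z ^+ 2)^-1) / 4.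
    by field; rewrite gt_eqF.
  rewrite z2 /w; field; rewrite d0/=; lra.
have E2 : (z - z^-1) ^+ 2 = 4 * (u ^+ 2 / (1 - u ^+ 2)).
  have -> : (z - z^-1) ^+ 2 = z ^+ 2 - 2 + (z ^+ 2)^-1.
    by field; rewrite gt_eqF.
  rewrite z2 /w; field; rewrite d0/=; lra.
rewrite -E2 -E1 -exprMn cheb_hyp ?gt_eqF//.
set Z := z ^+ (2 * q + 1).
have Z0 : 0 < Z by rewrite exprn_gt0.
have -> : w ^+ (2 * q + 1) = Z ^+ 2 by rewrite -z2 -!exprM mulnC.
have -> : (Z - Z^-1) ^+ 2 = Z ^+ 2 - 2 + (Z^-1) ^+ 2.
  by field; rewrite gt_eqF.
by rewrite lerDl sqr_ge0.
Qed.

(** Half the logarithm of the right-hand side is artanh u, whose Taylor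
   series has nonnegative coefficients. The cubic term is kept for
   growth_loss. *)
Lemma mobius_ge_expR u : 0 <= u < 1 ->
  expR (2 * (u + u ^+ 3 / 3)) <= (1 + u) / (1 - u).
Proof.
move=> /andP[u0 u1].
have q0 : 0 < (1 + u) / (1 - u) by rewrite divr_gt0//; lra.
rewrite -[leRHS](lnK q0) ler_expR ln_div ?posrE; [|lra|lra].
have := @ge0_derive_le R (fun y => ln (1 + y) - ln (1 - y) - 2 * (y + y ^+ 3 / 3))
  (fun y => (1 + y)^-1 + (1 - y)^-1 - 2 * (1 + y ^+ 2)) u u0.
have -> : ln (1 + 0) - ln (1 - 0) - 2 * (0 + 0 ^+ 3 / 3) = 0 :> R.
  by rewrite addr0 subr0 ln1 expr0n /=; ring.
rewrite subr_ge0; apply.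
  move=> y /andP[y0 yu].
  have d1 : is_derive y 1 (fun y => ln (1 + y)) (1 + y)^-1.
    have dl : is_derive (1 + y) 1 (@ln R) (1 + y)^-1 by apply: is_derive1_ln; lra.
    apply: is_derive_eq (is_derive1_comp dl _) _.
    by rewrite add0r mulr1.
  have d2 : is_derive y 1 (fun y => ln (1 - y)) (- (1 - y)^-1).
    have dl : is_derive (1 - y) 1 (@ln R) (1 - y)^-1 by apply: is_derive1_ln; lra.
    have dg : is_derive y 1 (fun y : R => 1 - y) (-1).
      by apply: is_derive_eq (is_deriveB (is_derive_cst _ _ _) (is_derive_id _ _)) _; rewrite sub0r.
    by have := @is_derive1_comp R (@ln R) (fun y : R => 1 - y) y _ _ dl dg; rewrite mulrN1.
  have d3 : is_derive y 1 (fun y : R => 2 * (y + y ^+ 3 / 3)) (2 * (1 + y ^+ 2)).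
    by apply: is_derive_eq; rewrite /GRing.scale/=; field.
  by apply: is_derive_eq (is_deriveB (is_deriveB d1 d2) d3) _; rewrite opprK.
move=> y /andP[y0 yu].
have -> : (1 + y)^-1 + (1 - y)^-1 - 2 * (1 + y ^+ 2) =
          2 * y ^+ 4 / ((1 + y) * (1 - y)).
  by field; rewrite !lt0r_neq0//; lra.
by rewrite divr_ge0 ?mulr_ge0 ?exprn_ge0//; lra.
Qed.
End chebyshev_poly.

Section filter_bounds.
Context {R : realType}.
Implicit Types (u v c al : R).

(** The contribution to the stable rank of an eigenvalue at relative
   position al in the spectrum; the case distinction matters for m = 0 only,
   where al ^+ 0 = 1. *)
Definition kap (m : nat) al : R := if al == 0 then 0 else al ^+ (2 * m).

(** The factor by which the growth of the filter falls short of the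
   exponential when no power of the variable is available to kill the bottom
   of the spectrum (m = 0) and x = (2 q2 + 1) u is small. *)
Definition loss (m : nat) (x : R) : R :=
  if (0 < m)%N || (47 / 20 <= x) then 1 else 3 / 5.

Lemma loss_ge m (x : R) : 3 / 5 <= loss m x <= 1.
Proof. by rewrite /loss; case: ifP => _; lra. Qed.

(** The maximum on the unit interval is attained at 1 / sqrt 3, close to 577
   / 1000; the difference is, up to a small constant, the product of a
   square and a positive linear factor. *)
Lemma cubic_le u : 0 <= u <= 1 -> u * (1 - u ^+ 2) <= 771 / 2000.
Proof.
move=> /andP[u0 u1]; rewrite -subr_ge0.
have : 0 <= (u - 577 / 1000) ^+ 2 * (u + 577 / 500).
  by apply: mulr_ge0; [exact: sqr_ge0|lra].
by lra.
Qed.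

Lemma expRN46 : 3 / 5 <= expR (- (46 / 100) : R).
Proof.
have -> : (- (46 / 100) : R) = 4%:R * (- (23 / 200)) by field.
rewrite expRM_natl (exprM _ 2 2).
have h1 : 177 / 200 <= expR (- (23 / 200) : R).
  by have := expR_ge1Dx (- (23 / 200) : R); lra.
have sq_le (a b x : R) : 0 <= a -> b <= a * a -> a <= x -> b <= x ^+ 2.
  by move=> a0 ba ax; rewrite expr2; apply: le_trans ba _; exact: ler_pM.
by apply: (sq_le (78 / 100)); [lra|lra|apply: sq_le h1; lra].
Qed.

(** Displacing the interval to put a zero of the filter at the least
   eigenvalue lowers the growth rate from u to v, but N u - N v is bounded;
   for N u >= 47 / 20 the cubic term of artanh v makes up for the difference
   entirely, and otherwise a constant factor is lost. *)
Lemma growth_loss (N u t v : R) : 3 <= N -> 0 <= u < 1 -> 0 < t ->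
  t * N ^+ 2 <= 576 / 161 ->
  v = u / Num.sqrt (1 + (1 - u ^+ 2) * t) ->
  loss 0 (N * u) * expR (2 * N * u) <= expR (2 * N * (v + v ^+ 3 / 3)).
Proof.
move=> N3 /andP[u0 u1] t0 tN; set c := (1 - u ^+ 2) * t.
set s := Num.sqrt (1 + c); move=> vE.
have u21 : 0 <= 1 - u ^+ 2 <= 1.
  by rewrite subr_ge0 lerBlDr lerDl sqr_ge0 andbT expr_le1// ltW.
have [u20 u22] := andP u21.
have t12 : t <= 2 / 5.
  have N9 : 9 <= N ^+ 2 by rewrite expr2 (le_trans _ (ler_pM _ _ N3 N3))//; lra.
  by have : t * 9 <= t * N ^+ 2 by [rewrite ler_wpM2l// ltW]; lra.
have c0 : 0 <= c by rewrite mulr_ge0// ltW.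
have c12 : c <= 2 / 5 by rewrite /c; apply: le_trans t12; rewrite ler_piMl// ltW.
have s2 : s ^+ 2 = 1 + c by rewrite sqr_sqrtr//; lra.
have s0 : 0 < s by rewrite sqrtr_gt0; lra.
set r := s^-1.
have r0 : 0 < r by rewrite invr_gt0.
have rr : r ^+ 2 * (1 + c) = 1 by rewrite -s2 -exprMn mulVf ?expr1n// gt_eqF.
have v0 : 0 <= v by rewrite vE mulr_ge0 ?(ltW r0).
rewrite /loss /=; case: ifP => [Nu|_].
  rewrite mul1r ler_expR ler_wpM2l//; first by lra.
  have s1 : s <= 1 + c / 2.
    rewrite -(@ler_pXn2r _ 2)// ?nnegrE ?(ltW s0)//; last by lra.
    by rewrite s2 -subr_ge0; have := sqr_ge0 c; lra.
  have N0 : 0 < N by lra.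
  have key : 3 * c * (1 + c) <= 2 * u ^+ 2.
    have N20 : 0 < N ^+ 2 by rewrite exprn_gt0.
    have Nu2 : 2209 / 400 <= u ^+ 2 * N ^+ 2.
      rewrite -exprMn mulrC; apply: le_trans (_ : (47 / 20) * (47 / 20) <= _); first by lra.
      by rewrite expr2; apply: ler_pM => //; lra.
    have tu : t <= u ^+ 2 by rewrite -(ler_pM2r N20); lra.
    apply: le_trans (_ : 3 * t <= _).
      have -> : 3 * c * (1 + c) = 3 * t * ((1 - u ^+ 2) * (1 + (1 - u ^+ 2) * t)).
        by rewrite /c; ring.
      rewrite ler_piMr ?mulr_ge0 ?(ltW t0)//.
      apply: le_trans (_ : (1 - u ^+ 2) * (1 + u ^+ 2) <= _).
        rewrite ler_wpM2l// lerD2l; apply: le_trans tu.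
        by rewrite ler_piMl// ltW.
      by have := sqr_ge0 (u ^+ 2); lra.
    by rewrite -(ler_pM2r N20); lra.
  rewrite vE -/r; have -> : u * r + (u * r) ^+ 3 / 3 = u * (r * (1 + u ^+ 2 * r ^+ 2 / 3)) by field.
  rewrite -[leLHS]mulr1 ler_wpM2l// -(ler_pM2l s0) mulr1 mulrA divff ?gt_eqF// mul1r.
  apply: le_trans s1 _; rewrite lerD2l.
  have c1 : 0 < 1 + c by lra.
  rewrite -(ler_pM2r c1).
  have -> : u ^+ 2 * r ^+ 2 / 3 * (1 + c) = u ^+ 2 * (r ^+ 2 * (1 + c)) / 3 by field.
  by rewrite rr; lra.
apply: le_trans (_ : expR (- (46 / 100)) * expR (2 * N * u) <= _).
  by rewrite ler_wpM2r ?expR_ge0// expRN46.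
rewrite -expRD ler_expR.
have r1 : 1 - c / 2 <= r.
  rewrite -(@ler_pXn2r _ 2)// ?nnegrE ?(ltW r0)//; last by lra.
  have c1 : 0 < 1 + c by lra.
  rewrite -(ler_pM2r c1) rr -subr_ge0.
  have -> : 1 - (1 - c / 2) ^+ 2 * (1 + c) = c ^+ 2 * (3 - c) / 4 by field.
  by rewrite divr_ge0// mulr_ge0 ?sqr_ge0//; lra.
have uv : u - v <= u * c / 2.
  rewrite vE -/r; have : u * (1 - c / 2) <= u * r by rewrite ler_wpM2l.
  by lra.
have v3 : 0 <= v ^+ 3 by rewrite exprn_ge0.
have N0 : 0 <= N by lra.
suff : N * (u * c) <= 46 / 100.
  have : N * (u - v) <= N * (u * c / 2) by rewrite ler_wpM2l.
  have : 0 <= N * v ^+ 3 by rewrite mulr_ge0.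
  by lra.
have -> : N * (u * c) = u * (1 - u ^+ 2) * (N * t) by rewrite /c; ring.
have Nt : N * t <= 192 / 161.
  have N0' : 0 < N by lra.
  rewrite -(ler_pM2r N0'); apply: le_trans (_ : 192 / 161 * 3 <= _); first by lra.
  by apply: ler_wpM2l N3; lra.
apply: le_trans (_ : 771 / 2000 * (192 / 161) <= _); last by lra.
apply: ler_pM => //; first by rewrite mulr_ge0.
  by rewrite mulr_ge0// ltW.
by rewrite cubic_le// u0 ltW.
Qed.

End filter_bounds.

Section filter_polynomial.
Context {R : realType}.
Implicit Types (u v c al : R).

Lemma size_comp_affine (p : {poly R}) (c0 c1 : R) :
  (size (p \Po (c1 *: 'X + c0%:P))%R <= size p)%N.
Proof.
have [->|p0] := eqVneq p 0; first by rewrite comp_poly0.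
apply: leq_trans (size_comp_poly_leq _ _) _.
have s2 : (size (c1 *: 'X + c0%:P)%R <= 2)%N.
  rewrite (leq_trans (size_polyD _ _))// geq_max (leq_trans (size_polyC_leq1 _))// andbT.
  by rewrite (leq_trans (size_scale_leq _ _))// size_polyX.
have sp : (0 < size p)%N by rewrite lt0n size_poly_eq0.
rewrite -[X in (_ < X)%N](prednK sp) ltnS -[X in (_ <= X)%N]muln1 leq_mul//.
by case: (size _) s2 => // -[|[]].
Qed.

(** A polynomial phi bounded against the stable rank weights on the spectrum
   below 1 - u ^+ 2, and exponentially large at 1. For q1 > 0 it is the
   monomial of degree q1 times a Chebyshev polynomial rescaled to that
   interval. For q1 = 0 the weights do not see the eigenvalues at 0,
   whatever their multiplicity, so phi has to vanish there: the interval is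
   displaced to put the least zero of the Chebyshev polynomial at 0. *)
Lemma filter_poly (q1 q2 : nat) u : 0 <= u < 1 -> (0 < q1 + q2)%N ->
  exists (phi : {poly R}) (M : R), [/\ (size phi <= (q1 + q2).+1)%N, 0 < M,
    forall al, 0 <= al <= 1 -> (1 - u ^+ 2 - al) * phi.[al] ^+ 2 <= M * kap q1 al &
    M * (loss q1 ((2 * q2 + 1)%:R * u) * expR (2 * (2 * q2 + 1)%:R * u) - 2) <=
      4 * u ^+ 2 * phi.[1] ^+ 2].
Proof.
move=> u01 q12; have /andP[u0 u1] := u01.
set N : R := (2 * q2 + 1)%:R.
set b := 1 - u ^+ 2.
have b0 : 0 < b by rewrite subr_gt0 expr_lt1.
have hornerZ c0 c1 (p : {poly R}) x : (p \Po (c1 *: 'X + c0%:P)).[x] = p.[c1 * x + c0].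
  by rewrite horner_comp !hornerE.
have growE (w : R) : 0 <= w < 1 -> expR (2 * N * (w + w ^+ 3 / 3)) <=
    ((1 + w) / (1 - w)) ^+ (2 * q2 + 1).
  move=> w01; have w01' := andP w01.
  rewrite mulrAC mulrC /N expRM_natl ler_pXn2r ?nnegrE ?expR_ge0 ?addn1//.
    exact: mobius_ge_expR.
  by rewrite divr_ge0//; lra.
have [q1z|q1p] := posnP q1; last first.
  exists ('X^q1 * (cheb q2 \Po (b^-1 *: 'X + 0%:P))), b; split => //.
  - rewrite (leq_trans (size_polyMleq _ _))// size_polyXn addSn /= -addnS leq_add2l.
    exact: leq_trans (size_comp_affine _ _ _) (size_cheb q2).
  - move=> al /andP[al0 al1]; rewrite /kap hornerM hornerXn hornerZ addr0.
    have [->|aln0] := eqVneq al 0.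
      by rewrite expr0n (gtn_eqF q1p) mul0r expr0n !mulr0.
    rewrite mulnC exprM exprMn mulrCA [leRHS]mulrC ler_wpM2l ?sqr_ge0//.
    have [alb|alb] := leP al b; last first.
      apply: le_trans (ltW b0); rewrite mulr_le0_ge0 ?sqr_ge0//.
      by rewrite subr_le0 ltW.
    have xb : 0 <= b^-1 * al <= 1.
      by rewrite mulr_ge0 ?invr_ge0 ?(ltW b0)//= mulrC ler_pdivrMr// mul1r.
    have -> : b - al = b * (1 - b^-1 * al) by field; rewrite gt_eqF.
    by rewrite -mulrA -[leRHS]mulr1 ler_pM2l// cheb_bound.
  rewrite /loss q1p mul1r hornerM hornerXn expr1n mul1r hornerZ addr0 mulr1.
  have := cheb_growth q2 u01; rewrite -/b -(ler_pM2l b0) => H.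
  apply: le_trans (le_trans _ H) _.
    rewrite ler_wpM2l ?(ltW b0)// lerD2r; apply: le_trans (growE _ u01).
    rewrite ler_expR ler_wpM2l ?mulr_ge0 ?ler0n//.
    by rewrite lerDl divr_ge0 ?exprn_ge0.
  rewrite le_eqVlt; apply/orP; left; apply/eqP.
  by field; rewrite gt_eqF.
have q2p : (0 < q2)%N by move: q12; rewrite q1z.
have [s0 [rs0 s0p sN]] := @cheb_root R _ q2p.
rewrite -/N in sN.
have N3 : 3 <= N by rewrite ler_nat addn1 ltnS (leq_mul (leqnn 2) q2p).
have N9 : 9 <= N ^+ 2 by rewrite expr2 (le_trans _ (ler_pM _ _ N3 N3))//; lra.
have s01 : s0 <= 64 / 225.
  by have : s0 * 9 <= s0 * N ^+ 2 by [rewrite ler_wpM2l// ltW]; lra.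
pose t := s0 / (1 - s0).
have s1p : 0 < 1 - s0 by lra.
have t0 : 0 < t by rewrite divr_gt0.
(* 64 / 25 divided by the lower bound 1 - 64 / 225 of 1 - s0. *)
have tN : t * N ^+ 2 <= 576 / 161.
  by rewrite /t mulrAC ler_pdivrMr//; lra.
pose c := b * t.
have c0 : 0 < c by rewrite mulr_gt0.
have bc0 : 0 < b + c by rewrite addr_gt0.
have bcE : b + c = b / (1 - s0) by rewrite /c /t; field; rewrite gt_eqF.
exists (cheb q2 \Po ((b + c)^-1 *: 'X + (c / (b + c))%:P)), (b + c); split => //.
- by rewrite (leq_trans (leq_trans (size_comp_affine _ _ _) (size_cheb q2)))// q1z.
- move=> al /andP[al0 al1]; rewrite /kap hornerZ.
  have [->|aln0] := eqVneq al 0.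
    rewrite !mulr0 add0r; have -> : c / (b + c) = s0.
      by rewrite bcE /c /t; field; rewrite !gt_eqF.
    by rewrite rs0 expr0n mulr0.
  rewrite q1z muln0 expr0 mulr1.
  have [alb|alb] := leP al b; last first.
    apply: le_trans (ltW bc0); rewrite mulr_le0_ge0 ?sqr_ge0//.
    by rewrite subr_le0 ltW.
  set x := (b + c)^-1 * al + c / (b + c).
  have xb : 0 <= x <= 1.
    have -> : x = (al + c) / (b + c) by rewrite /x; field; rewrite gt_eqF.
    apply/andP; split; last by rewrite ler_pdivrMr// mul1r lerD2r.
    by rewrite divr_ge0// ?(ltW bc0)// addr_ge0// ltW.
  have -> : b - al = (b + c) * (1 - x) by rewrite /x; field; rewrite gt_eqF.
  by rewrite -mulrA -[leRHS]mulr1 ler_pM2l// cheb_bound.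
rewrite hornerZ q1z.
set v := u / Num.sqrt (1 + c).
have c1 : 0 < 1 + c by lra.
have v2 : v ^+ 2 = u ^+ 2 / (1 + c) by rewrite exprMn exprVn sqr_sqrtr// ltW.
have v0 : 0 <= v by rewrite divr_ge0// sqrtr_ge0.
have v01 : 0 <= v < 1.
  rewrite v0 /= -(@ltr_pXn2r _ 2)// ?nnegrE// expr1n v2 ltr_pdivrMr// mul1r.
  by apply: (@lt_trans _ _ 1); [rewrite expr_lt1|lra].
have vE : (1 - v ^+ 2)^-1 = (b + c)^-1 * 1 + c / (b + c).
  have -> : 1 - v ^+ 2 = (b + c) / (1 + c).
    by rewrite v2 /b; field; rewrite gt_eqF.
  by rewrite invf_div mulr1 mulrDl mul1r.
have := cheb_growth q2 v01; rewrite vE -(ler_pM2l bc0) => H.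
apply: le_trans (le_trans _ H) _.
  rewrite ler_wpM2l ?(ltW bc0)// lerD2r; apply: le_trans (growE _ v01).
  exact: (growth_loss N3 u01 t0 tN).
rewrite le_eqVlt; apply/orP; left; apply/eqP.
by rewrite v2; field; rewrite !gt_eqF.
Qed.
End filter_polynomial.

(** * Diagonalisation and the Krylov estimate *)

Section spectral.
Context {R : realType}.

Lemma symmetric_eigenvector n (A : 'M[R]_n.+1) : A^T = A ->
  exists (a : R) (v : 'rV[R]_n.+1), v != 0 /\ v *m A = a *: v.
Proof.
move=> /is_spectrum_exists [s [_ As]].
have : size s != 0%N.
  have := congr1 (fun p : {poly R} => size p) As.
  by rewrite size_char_poly size_prod_XsubC => -[<-].
case: s As => // a s As _; exists a.
have /eigenvalueP[v vA v0] : eigenvalue A a.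
  by rewrite eigenvalue_root_char As root_prod_XsubC inE eqxx.
by exists v.
Qed.

(** Induction on the dimension: the orthogonal complement of an eigenvector
   is invariant under a symmetric matrix. *)
Lemma symmetric_diag n (A : 'M[R]_n) : A^T = A ->
  exists (U : 'M[R]_n) (r : 'rV[R]_n),
    U *m U^T = 1%:M /\ A = U^T *m diag_mx r *m U.
Proof.
elim: n A => [|n IH] A As.
  by exists 1%:M, 0; rewrite [A]flatmx0 [1%:M]flatmx0 [_ *m _]flatmx0 [X in _ /\ _ = X]flatmx0.
have [a [v [v0 vA]]] := symmetric_eigenvector As.
pose nv := \sum_j v 0 j ^+ 2.
have nv0 : 0 < nv.
  rewrite lt_neqAle sumr_ge0 ?andbT => [|j _]; last exact: sqr_ge0.
  rewrite eq_sym psumr_eq0 => [|j _]; last exact: sqr_ge0.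
  apply: contraNN v0 => /allP v0; apply/eqP/rowP => j; rewrite mxE.
  by have := v0 j (mem_index_enum _); rewrite implyTb sqrf_eq0 => /eqP.
pose c j := v 0 j / Num.sqrt nv.
have c1 : \sum_j c j ^+ 2 = 1.
  under eq_bigr do rewrite exprMn exprVn sqr_sqrtr ?(ltW nv0)//.
  by rewrite -mulr_suml divff// gt_eqF.
have [U0 UU0 U0c] := orth_complete (ord0 : 'I_n.+1) c1.
have U0U : U0^T *m U0 = 1%:M by exact: mulmx1C.
pose B : 'M[R]_(1 + n) := U0 *m A *m U0^T.
have Bs : B^T = B by rewrite /B !trmx_mul trmxK As mulmxA.
have rowU0 : row ord0 U0 = (Num.sqrt nv)^-1 *: v.
  by apply/rowP => j; rewrite !mxE U0c mulrC.
have rowB : row ord0 B = a *: delta_mx 0 ord0.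
  rewrite /B !row_mul rowU0 -scalemxAl vA scalerA mulrC -scalerA -rowU0.
  by rewrite -scalemxAl -row_mul UU0 rowE mulmx1.
have ur : ursubmx B = 0.
  apply/matrixP => i j; rewrite !mxE ord1.
  have := congr1 (fun r : 'rV[R]_n.+1 => r 0 (rshift 1 j)) rowB.
  rewrite !mxE; have -> : lshift n (0 : 'I_1) = ord0 by exact/val_inj.
  by move=> ->; rewrite mulr0.
have dl : dlsubmx B = 0 by rewrite -[B]Bs -trmx_ursub ur trmx0.
pose A' := drsubmx B.
have A's : A'^T = A' by rewrite /A' trmx_drsub Bs.
have [U' [r' [UU' A'E]]] := IH A' A's.
have U'U : U'^T *m U' = 1%:M by exact: mulmx1C.
pose V : 'M[R]_(1 + n) := block_mx 1%:M 0 0 U'.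
have VT : V^T = block_mx 1%:M 0 0 U'^T by rewrite tr_block_mx trmx1 !trmx0.
have VV : V *m V^T = 1%:M.
  by rewrite VT mulmx_block !mulmx0 !mul0mx !addr0 add0r mulmx1 UU' -scalar_mx_block.
have BE : B = V^T *m diag_mx (row_mx (ulsubmx B) r') *m V.
  rewrite -[LHS]submxK ur dl -/A' diag_mx_row VT !mulmx_block.
  rewrite !mulmx0 !mul0mx !addr0 !add0r mul1mx mulmx1 -A'E.
  rewrite !mul0mx; congr block_mx.
  by apply/matrixP => i j; rewrite !mxE !ord1 eqxx mulr1n.
exists (V *m U0 : 'M[R]_n.+1), (row_mx (ulsubmx B) r' : 'rV[R]_n.+1); split.
  by rewrite trmx_mul mulmxA -[V *m U0 *m _]mulmxA UU0 mulmx1.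
have AE : A = U0^T *m (B *m U0).
  by rewrite /B !mulmxA U0U mul1mx -mulmxA U0U mulmx1.
by apply: etrans AE _; rewrite {1}BE trmx_mul !mulmxA.
Qed.
End spectral.

Section diagonalised.
Context {R : realType} (n : nat) (A U : 'M[R]_n) (r : 'rV[R]_n).
Hypotheses (As : A^T = A) (UU : U *m U^T = 1%:M) (AE : A = U^T *m diag_mx r *m U).

Let U'U : U^T *m U = 1%:M. Proof. exact: mulmx1C. Qed.

Lemma char_poly_diag : char_poly A = \prod_i ('X - (r 0 i)%:P).
Proof.
have -> : char_poly A = char_poly (diag_mx r).
  rewrite /char_poly /char_poly_mx AE !map_mxM /= -map_trmx.
  set V := map_mx polyC U.
  have VV : V^T *m V = 1%:M by rewrite /V map_trmx -map_mxM U'U map_mx1.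
  have VV' : V *m V^T = 1%:M by exact: mulmx1C.
  have -> : 'X%:M - V^T *m map_mx polyC (diag_mx r) *m V =
            V^T *m ('X%:M - map_mx polyC (diag_mx r)) *m V.
    by rewrite mulmxBr mulmxBl mul_mx_scalar -scalemxAl VV scalemx1.
  by rewrite !det_mulmx mulrAC -det_mulmx VV det1 mul1r.
rewrite char_poly_trig ?diag_mx_is_trig//.
by apply: eq_bigr => i _; rewrite mxE eqxx mulr1n.
Qed.

Lemma perm_eigenvalues : perm_eq (eigenvalues A) [seq r 0 i | i <- enum 'I_n].
Proof.
have [_ cA] := eigenvaluesP As.
apply: prod_XsubC_eq; rewrite -cA char_poly_diag big_map.
by rewrite big_enum.
Qed.

Lemma eig_bounds i : eig_min A <= r 0 i <= eig_max A.
Proof.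
have [sA _] := eigenvaluesP As.
have : r 0 i \in eigenvalues A by rewrite (perm_mem perm_eigenvalues) map_f// mem_enum.
rewrite /eig_min /eig_max; move: (eigenvalues A) sA => s ss ris.
have [k ks <-] := nthP 0 ris.
have tr : transitive (>=%R : rel R) by move=> x y z /= xy yz; exact: le_trans yz xy.
have ge x y : (x <= y < size s)%N -> s`_y <= s`_x.
  move=> /andP[xy ys].
  have H := sorted_leq_nth tr (fun x : R => lexx x) 0 ss.
  by apply: (H x y) => //; rewrite inE (leq_ltn_trans xy).
rewrite -nth0 -nth_last ge ?ge//= prednK ?(leq_ltn_trans _ ks)// leqnn andbT.
by rewrite -ltnS prednK// (leq_ltn_trans _ ks).
Qed.

Lemma eig_max_diag : (0 < n)%N -> exists i, r 0 i = eig_max A.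
Proof.
move=> n0; have /perm_size := perm_eigenvalues.
rewrite size_map size_enum_ord => sz.
have : eig_max A \in eigenvalues A.
  by rewrite /eig_max -nth0 mem_nth// sz.
by rewrite (perm_mem perm_eigenvalues) => /mapP[i _ ->]; exists i.
Qed.

Lemma srk_diag nu : srk A nu = \sum_(i | r 0 i != eig_min A)
  ((r 0 i - eig_min A) / (eig_max A - eig_min A)) `^ (2 * nu).
Proof.
rewrite /srk (perm_big _ perm_eigenvalues) /= big_map.
by rewrite big_enum_cond.
Qed.

Lemma quad_diag (c : R) (v : 'cV[R]_n) :
  \tr (v^T *m (A - c%:M) *m v) = \sum_i (r 0 i - c) * (U *m v) i 0 ^+ 2.
Proof.
have -> : A - c%:M = U^T *m (diag_mx r - c%:M) *m U.
  by rewrite mulmxBr mulmxBl -AE mul_mx_scalar -scalemxAl U'U scalemx1.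
have -> : v^T *m (U^T *m (diag_mx r - c%:M) *m U) *m v =
          (U *m v)^T *m (diag_mx r - c%:M) *m (U *m v).
  by rewrite trmx_mul !mulmxA.
set w := U *m v; rewrite /mxtrace big_ord1 mulmxBr mulmxBl mxE [X in _ + X]mxE.
rewrite mul_mx_diag mul_mx_scalar -scalemxAl !mxE mulr_sumr -sumrB.
by apply: eq_bigr => i _; rewrite !mxE; ring.
Qed.

Lemma norm_gt0 (v : 'cV[R]_n) : v != 0 -> 0 < \tr (v^T *m v).
Proof.
move=> v0; have -> : \tr (v^T *m v) = \sum_i v i 0 ^+ 2.
  rewrite /mxtrace big_ord1 mxE.
  by apply: eq_bigr => i _; rewrite mxE expr2.
rewrite lt_neqAle sumr_ge0 ?andbT => [|i _]; last exact: sqr_ge0.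
rewrite eq_sym psumr_eq0 => [|j _]; last exact: sqr_ge0.
apply: contraNN v0 => /allP v0; apply/eqP/colP => j; rewrite mxE.
by have := v0 j (mem_index_enum _); rewrite implyTb sqrf_eq0 => /eqP.
Qed.

Lemma rayleigh_bounds (v : 'cV[R]_n) : v != 0 ->
  eig_min A <= rayleigh A v <= eig_max A.
Proof.
move=> v0; have v1 := norm_gt0 v0.
have quad c : \tr (v^T *m A *m v) - c * \tr (v^T *m v) =
    \sum_i (r 0 i - c) * (U *m v) i 0 ^+ 2.
  rewrite -quad_diag mulmxBr mulmxBl mul_mx_scalar -scalemxAl.
  by rewrite raddfB /= mxtraceZ.
rewrite /rayleigh ler_pdivlMr// ler_pdivrMr// -subr_ge0 quad -[X in _ && X]subr_le0 quad.
apply/andP; split.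
  by apply: sumr_ge0 => i _; rewrite mulr_ge0 ?sqr_ge0// subr_ge0; case/andP: (eig_bounds i).
apply: sumr_le0 => i _; rewrite mulr_le0_ge0 ?sqr_ge0// subr_le0.
by case/andP: (eig_bounds i).
Qed.

Section krylov_space.
Context (l q : nat) (B : 'M[R]_(n, l)).

Lemma xi_max_ge (v : 'cV[R]_n) : krylov A B q v -> v != 0 ->
  rayleigh A v <= xi_max A B q.
Proof.
move=> Kv v0; apply: ub_le_sup; last by exists v.
exists (eig_max A) => _ [w [_ w0] <-].
by case/andP: (rayleigh_bounds w0).
Qed.

(** The Rayleigh quotients of Krylov vectors are at most tau, in a form that
   also covers the zero vector. *)
Lemma xi_max_quad (tau : R) (v : 'cV[R]_n) : xi_max A B q <= tau ->
  krylov A B q v -> \sum_i (r 0 i - tau) * (U *m v) i 0 ^+ 2 <= 0.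
Proof.
move=> xt Kv; have [->|v0] := eqVneq v 0.
  by rewrite mulmx0 big1// => i _; rewrite mxE expr0n mulr0.
have := le_trans (xi_max_ge Kv v0) xt.
rewrite /rayleigh ler_pdivrMr ?norm_gt0// -subr_le0 -quad_diag.
by rewrite mulmxBr mulmxBl mul_mx_scalar -scalemxAl raddfB /= mxtraceZ.
Qed.

Lemma diag_expr j (x : 'cV[R]_n) i :
  (U *m (A ^+ j *m x)) i 0 = r 0 i ^+ j * (U *m x) i 0.
Proof.
have UA (z : 'cV[R]_n) : (U *m (A *m z)) i 0 = r 0 i * (U *m z) i 0.
  rewrite mulmxA AE !mulmxA UU mul1mx -mulmxA mul_diag_mx mxE.
  by [].
elim: j => [|j IH]; first by rewrite !expr0 mul1mx mul1r.
by rewrite exprS -mulmxE -mulmxA UA IH mulrA -exprS.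
Qed.

Lemma krylov_poly (phi : {poly R}) (c : 'cV[R]_l) : (size phi <= q.+1)%N ->
  exists2 v, krylov A B q v &
    forall i, (U *m v) i 0 = phi.[r 0 i] * (U *m (B *m c)) i 0.
Proof.
move=> sphi.
exists (\sum_(j < q.+1) phi`_j *: (A ^+ j *m (B *m c))).
  exists (\mxcol_(j < q.+1) (phi`_j *: c)) => //.
  rewrite /krylov_mx mul_mxrow_mxcol; apply: eq_bigr => j _.
  by rewrite -scalemxAr mulmxA.
move=> i; rewrite mulmx_sumr summxE.
rewrite (horner_coef_wide _ sphi) mulr_suml; apply: eq_bigr => j _.
by rewrite -scalemxAr mxE diag_expr mulrA.
Qed.

Lemma krylov_nonzero : B != 0 -> exists v, krylov A B q v /\ v != 0.
Proof.
move=> B0.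
have [j Bj] : exists j, col j B != 0.
  apply/existsP; apply: contraNT B0; rewrite negb_exists => /forallP B0.
  apply/eqP/matrixP => i j; have := B0 j; rewrite negbK => /eqP/colP/(_ i).
  by rewrite !mxE.
exists (col j B); split => //.
have s1 : (size (1 : {poly R})%R <= q.+1)%N by rewrite size_poly1.
have [v Kv vE] := krylov_poly (delta_mx j 0) s1.
suff -> : col j B = v by [].
  have : U *m v = U *m col j B.
    by apply/colP => i; rewrite vE hornerC mul1r colE.
by move/(congr1 (mulmx U^T)); rewrite !mulmxA U'U !mul1mx.
Qed.

Lemma xi_max_bounds : B != 0 -> eig_min A <= xi_max A B q <= eig_max A.
Proof.
move=> /krylov_nonzero[b [Kv Bj]].
apply/andP; split.
  by apply: le_trans (xi_max_ge Kv Bj); case/andP: (rayleigh_bounds Bj).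
apply: ge_sup; first by exists (rayleigh A b), b.
by move=> _ [w [_ w0] <-]; case/andP: (rayleigh_bounds w0).
Qed.
End krylov_space.
End diagonalised.

Section event.
Context {R : realType} (n : nat) (A U : 'M[R]_n) (r : 'rV[R]_n) (i0 : 'I_n).
Hypotheses (As : A^T = A) (UU : U *m U^T = 1%:M) (AE : A = U^T *m diag_mx r *m U).
Hypotheses (ri0 : r 0 i0 = eig_max A).

Definition relpos i : R := (r 0 i - eig_min A) / (eig_max A - eig_min A).

Lemma relerr_bounds l (B : 'M[R]_(n, l)) q :
  B != 0 -> 0 <= relerr A (xi_max A B q) <= 1.
Proof.
move=> B0; have /andP[lo hi] := xi_max_bounds As UU AE q B0.
have [e|ne] := eqVneq (eig_max A - eig_min A) 0.
  by rewrite /relerr e invr0 mulr0 lexx ler01.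
have gap : 0 < eig_max A - eig_min A.
  by rewrite lt_neqAle eq_sym ne subr_ge0 (le_trans lo).
rewrite /relerr divr_ge0 ?subr_ge0 ?(le_trans lo)//= ler_pdivrMr// mul1r.
by rewrite lerD2l lerN2.
Qed.

Section gap.
Hypothesis gap : eig_min A < eig_max A.

Let gap0 : 0 < eig_max A - eig_min A. Proof. by rewrite subr_gt0. Qed.

Lemma relpos01 i : 0 <= relpos i <= 1.
Proof.
have /andP[lo hi] := eig_bounds As UU AE i.
rewrite /relpos divr_ge0 ?subr_ge0 ?(ltW gap)//= ler_pdivrMr// mul1r.
by rewrite lerD2r.
Qed.

Lemma relpos_max : relpos i0 = 1.
Proof. by rewrite /relpos ri0 divff// gt_eqF. Qed.

Lemma relpos_eq0 i : (relpos i == 0) = (r 0 i == eig_min A).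
Proof. by rewrite mulf_eq0 invr_eq0 (gt_eqF gap0) orbF subr_eq0. Qed.

Lemma sum_kap (q1 : nat) : \sum_i kap q1 (relpos i) = srk A q1%:R.
Proof.
rewrite (srk_diag As UU AE) [RHS]big_mkcond; apply: eq_bigr => i _.
rewrite /kap relpos_eq0; case: eqP => //= _.
have /andP[p0 _] := relpos01 i.
by rewrite -/(relpos i) -natrM powR_mulrn.
Qed.

Lemma kap_max (q1 : nat) : kap q1 (relpos i0) = 1.
Proof. by rewrite relpos_max /kap oner_eq0 expr1n. Qed.

Lemma kap_ge0 (q1 : nat) i : 0 <= kap q1 (relpos i).
Proof.
by rewrite /kap; case: eqP => // _; rewrite exprn_ge0//; case/andP: (relpos01 i).
Qed.

Lemma sum_kap_others (q1 : nat) :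
  \sum_(i | i != i0) kap q1 (relpos i) = srk A q1%:R - 1.
Proof. by rewrite -sum_kap [in RHS](bigD1 i0)//= kap_max addrAC subrr add0r. Qed.

Section draw.
Context (l : nat) (B : 'M[R]_(n, l)).
Let W := U *m B.
Let y := \sum_j W i0 j ^+ 2.
Let top : 'cV[R]_l := \col_j W i0 j.

Let Wtop i : (U *m (B *m top)) i 0 = \sum_j W i0 j * W i j.
Proof.
rewrite mulmxA mxE; apply: eq_bigr => j _.
by rewrite [top _ _]mxE mulrC.
Qed.

Let Wtop0 : (U *m (B *m top)) i0 0 = y.
Proof. by rewrite Wtop; apply: eq_bigr => j _; rewrite expr2. Qed.

Lemma relerr_le q (e : R) : e <= relerr A (xi_max A B q) ->
  xi_max A B q <= eig_max A - e * (eig_max A - eig_min A).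
Proof. by rewrite /relerr ler_pdivlMr// => h; rewrite lerBrDl -lerBrDr. Qed.

(** Otherwise the range of the test matrix alone contains a vector with
   Rayleigh quotient above the least eigenvalue, namely B times the top row
   of coefficients. *)
Lemma relerr_ge1 q : 1 <= relerr A (xi_max A B q) -> y = 0.
Proof.
move=> /relerr_le; rewrite mul1r opprB addrCA subrr addr0 => h.
have s1 : (size (1 : {poly R})%R <= q.+1)%N by rewrite size_poly1.
have [v Kv vE] := krylov_poly UU AE B top s1.
have := xi_max_quad As UU AE h Kv.
have -> : \sum_i (r 0 i - eig_min A) * (U *m v) i 0 ^+ 2 =
          \sum_i (r 0 i - eig_min A) * (U *m (B *m top)) i 0 ^+ 2.
  by apply: eq_bigr => i _; rewrite vE hornerC mul1r.
rewrite (bigD1 i0)//= Wtop0 ri0 => h2.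
have h3 : 0 <= \sum_(i | i != i0) (r 0 i - eig_min A) * (U *m (B *m top)) i 0 ^+ 2.
  apply: sumr_ge0 => i _; rewrite mulr_ge0 ?sqr_ge0// subr_ge0.
  by case/andP: (eig_bounds As UU AE i).
have h4 : (eig_max A - eig_min A) * y ^+ 2 <= 0 by lra.
move: h4; rewrite pmulr_rle0// => h4.
by apply/eqP; rewrite -sqrf_eq0 eq_le h4 sqr_ge0.
Qed.

(** Testing the Rayleigh quotient of the filtered vector phi (A) B a, where
   a is the row of coefficients along a top eigenvector: this choice makes
   the top coefficient of the test vector the square norm y of a, and the
   others inner products of a with independent rows. *)
Lemma relerr_event (q1 q2 : nat) (u : R) (g : 'I_n -> R) :
  (0 < q1 + q2)%N -> 0 <= u < 1 ->
  u ^+ 2 <= relerr A (xi_max A B (q1 + q2)) ->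
  (forall i, y * g i ^+ 2 = (\sum_j W i0 j * W i j) ^+ 2) ->
  (loss q1 ((2 * q2 + 1)%:R * u) * expR (2 * (2 * q2 + 1)%:R * u) - 2) * y <=
  4 * \sum_(i | i != i0) kap q1 (relpos i) * g i ^+ 2.
Proof.
move=> q12 u01 /relerr_le h gE.
have [phi [M [sphi M0 phi_le phi1]]] := filter_poly u01 q12.
have D0 := gap0; set D := eig_max A - eig_min A in h D0.
set E := (loss _ _ * _ - 2) in phi1 *.
pose psi := phi \Po (D^-1 *: 'X + (- (eig_min A / D))%:P).
have psiE x : psi.[x] = phi.[(x - eig_min A) / D].
  by rewrite /psi horner_comp !hornerE mulrBl [D^-1 * _]mulrC.
have spsi : (size psi <= (q1 + q2).+1)%N.
  exact: leq_trans (size_comp_affine _ _ _) sphi.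
have [v Kv vE] := krylov_poly UU AE B top spsi.
have := xi_max_quad As UU AE h Kv.
pose Q := \sum_(i | i != i0) kap q1 (relpos i) * g i ^+ 2.
have Q0 : 0 <= Q by apply: sumr_ge0 => i _; rewrite mulr_ge0 ?sqr_ge0 ?kap_ge0.
rewrite -/Q.
have y0 : 0 <= y by apply: sumr_ge0 => j _; exact: sqr_ge0.
have -> : \sum_i (r 0 i - (eig_max A - u ^+ 2 * D)) * (U *m v) i 0 ^+ 2 =
    D * (\sum_i - ((1 - u ^+ 2 - relpos i) * phi.[relpos i] ^+ 2 *
                   (U *m (B *m top)) i 0 ^+ 2)).
  rewrite mulr_sumr; apply: eq_bigr => i _; rewrite vE psiE.
  rewrite -/D -/(relpos i) exprMn.
  have -> : r 0 i - (eig_max A - u ^+ 2 * D) = - (D * (1 - u ^+ 2 - relpos i)).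
    have rp : D * relpos i = r 0 i - eig_min A.
      by rewrite /relpos mulrC divfK// gt_eqF.
    have DE : D = eig_max A - eig_min A by [].
    by lra.
  by ring.
rewrite pmulr_rle0// (bigD1 i0)//= relpos_max Wtop0 => h2.
have h3 : - (M * (y * Q)) <= \sum_(i | i != i0) - ((1 - u ^+ 2 - relpos i) *
    phi.[relpos i] ^+ 2 * (U *m (B *m top)) i 0 ^+ 2).
  rewrite /Q !mulr_sumr -sumrN; apply: ler_sum => i _; rewrite lerN2 Wtop -gE.
  have -> : M * (y * (kap q1 (relpos i) * g i ^+ 2)) =
            M * kap q1 (relpos i) * (y * g i ^+ 2) by ring.
  apply: ler_wpM2r; first by rewrite mulr_ge0 ?sqr_ge0.
  by apply: phi_le; exact: relpos01.
have [yz|yn] := eqVneq y 0; first by rewrite yz mulr0 mulr_ge0.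
have yp : 0 < y by rewrite lt_neqAle eq_sym yn.
have h4 : u ^+ 2 * phi.[1] ^+ 2 * y ^+ 2 <= M * (y * Q) by lra.
rewrite -(ler_pM2l M0) -(ler_pM2r yp).
have h5 : M * E * y ^+ 2 <= 4 * u ^+ 2 * phi.[1] ^+ 2 * y ^+ 2.
  by rewrite ler_wpM2r ?sqr_ge0.
by lra.
Qed.
End draw.
End gap.
End event.

(** * Measurability of the estimate *)

Section rational_direction.
Context {R : realType} (m : nat) (N : 'M[R]_m).

Let f (w : 'cV[R]_m) := \tr (w^T *m N *m w).

(** The coordinates are made rational one at a time, each by a perturbation
   small enough to keep the quadratic form positive. *)
Lemma rational_quad_gt0 (w : 'cV[R]_m) : 0 < f w ->
  exists w' : 'cV[rat]_m, 0 < f (map_mx ratr w').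
Proof.
move=> fw.
have H k : (k <= m)%N -> exists w1 : 'cV[R]_m, 0 < f w1 /\
    forall i : 'I_m, (i < k)%N -> exists x : rat, w1 i 0 = ratr x.
  elim: k => [_|k IH km]; first by exists w.
  have [w1 [fw1 rw1]] := IH (ltnW km).
  pose K : 'I_m := Ordinal km; pose e : 'cV[R]_m := delta_mx K 0.
  pose b := \tr (e^T *m N *m w1) + \tr (w1^T *m N *m e).
  pose c := \tr (e^T *m N *m e).
  have fE x : f (w1 + x *: e) = f w1 + x * b + x ^+ 2 * c.
    have -> : f (w1 + x *: e) = \tr ((w1^T + x *: e^T) *m N *m (w1 + x *: e)).
      by congr (\tr (_ *m _ *m _)); apply/matrixP => a a'; rewrite !mxE.
    rewrite /f /b /c !mulmxDl !mulmxDr !raddfD /=.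
    rewrite -!scalemxAl -!scalemxAr !mxtraceZ.
    by ring.
  pose del := Num.min 1 (f w1 / (`|b| + `|c| + 1)).
  have bc0 : 0 < `|b| + `|c| + 1 by rewrite ltr_wpDl// addr_ge0.
  have del0 : 0 < del by rewrite lt_min ltr01 divr_gt0.
  have [x] : exists x : rat, ratr x \in `]w1 K 0, (w1 K 0 + del)[.
    by apply: rat_in_itvoo; rewrite ltrDl.
  rewrite in_itv/= => /andP[x1 x2].
  pose y := ratr x - w1 K 0.
  have y0 : 0 < y by rewrite subr_gt0.
  have yd : y < del by rewrite ltrBlDl.
  exists (w1 + y *: e); split; last first.
    move=> i; rewrite ltnS leq_eqVlt => /predU1P[ik|ik].
      have -> : i = K by exact/val_inj.
      by exists x; rewrite !mxE !eqxx mulr1 /y addrC subrK.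
    have [z zE] := rw1 i ik; exists z.
    have iK : i != K by apply: contraTneq ik => ->; rewrite ltnn.
    by rewrite !mxE (negbTE iK) mulr0 addr0.
  rewrite fE.
  have y1 : y <= 1 by apply: (le_trans (ltW yd)); rewrite ge_min lexx.
  have yf : y * (`|b| + `|c| + 1) < f w1.
    by rewrite -ltr_pdivlMr//; apply: (lt_le_trans yd); rewrite ge_min lexx orbT.
  have yb : - (y * `|b|) <= y * b.
    by rewrite -mulrN ler_wpM2l ?(ltW y0)// lerNl -normrN ler_norm.
  have yc : - (y * `|c|) <= y ^+ 2 * c.
    apply: le_trans (_ : y ^+ 2 * - `|c| <= _); last first.
      by rewrite ler_wpM2l ?sqr_ge0// lerNl -normrN ler_norm.
    by rewrite mulrN lerN2 ler_wpM2r// expr2 ler_piMr// ltW.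
  by lra.
have [w1 [fw1 rw1]] := H m (leqnn m).
pose w2 : 'cV[rat]_m := \col_i projT1 (cid (rw1 i (ltn_ord i))).
exists w2; suff -> : map_mx ratr w2 = w1 by [].
by apply/colP => i; rewrite !mxE; case: (cid _).
Qed.
End rational_direction.

Section measurable_xi.
Context d (T : measurableType d) (R : realType).

Definition measurable_mx m n (M : T -> 'M[R]_(m, n)) :=
  forall i j, measurable_fun setT (fun t => M t i j).

Lemma measurable_mx_cst m n (M : 'M[R]_(m, n)) : measurable_mx (fun=> M).
Proof. by move=> i j; exact: measurable_cst. Qed.

Lemma measurable_mx_mul m n p (M : T -> 'M[R]_(m, n)) (N : T -> 'M[R]_(n, p)) :
  measurable_mx M -> measurable_mx N -> measurable_mx (fun t => M t *m N t).
Proof.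
move=> mM mN i j.
apply: (eq_measurable_fun (fun t => \sum_k M t i k * N t k j)).
  by move=> t _; rewrite mxE.
by apply: measurable_sum => k; exact: measurable_funM.
Qed.

Lemma measurable_mx_tr m n (M : T -> 'M[R]_(m, n)) :
  measurable_mx M -> measurable_mx (fun t => (M t)^T).
Proof.
move=> mM i j; apply: (eq_measurable_fun (fun t => M t j i)) => //.
by move=> t _; rewrite mxE.
Qed.

Lemma measurable_krylov_mx n l (A : 'M[R]_n) (B : T -> 'M[R]_(n, l)) q :
  measurable_mx B -> measurable_mx (fun t => krylov_mx A (B t) q).
Proof.
move=> mB i k.
have mA j : measurable_mx (fun t => A ^+ j *m B t).
  by apply: measurable_mx_mul => //; exact: measurable_mx_cst.
apply: (eq_measurable_fun
  (fun t => (A ^+ (tagnat.sig1 k) *m B t) i (tagnat.sig2 k))).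
  by move=> t _; rewrite /krylov_mx [in RHS]mxE.
exact: mA.
Qed.

(** The estimate exceeds s exactly when the quadratic form of A - s takes a
   positive value on the Krylov space, hence at a rational combination of
   the generators: a countable union of measurable events. The null matrix,
   where the supremum is over the empty set, is treated apart. *)
Lemma measurable_xi_max n l (A : 'M[R]_n) (B : T -> 'M[R]_(n, l)) q :
  A^T = A -> measurable_mx B -> measurable_fun setT (fun t => xi_max A (B t) q).
Proof.
move=> As mB.
have [U [r [UU AE]]] := symmetric_diag As.
pose K t := krylov_mx A (B t) q.
have mK : measurable_mx K by exact: measurable_krylov_mx.
have mR (s : R) : measurable [set t | s < xi_max A (B t) q].
  pose N t := (K t)^T *m (A - s%:M) *m K t.
  have mN : measurable_mx N.
    apply: measurable_mx_mul => //; apply: measurable_mx_mul.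
      exact: measurable_mx_tr.
    exact: measurable_mx_cst.
  pose F (w : 'cV[rat]_(\sum_(j < q.+1) l)) :=
    [set t | 0 < \tr ((map_mx ratr w)^T *m N t *m map_mx ratr w)].
  have mF w : measurable (F w).
    have mf : measurable_fun setT
        (fun t => \tr ((map_mx ratr w)^T *m N t *m map_mx ratr w : 'M[R]_1)).
      apply: (eq_measurable_fun (fun t => ((map_mx ratr w)^T *m N t *m map_mx ratr w : 'M[R]_1) 0 0)).
        by move=> t _; rewrite /mxtrace big_ord1.
      apply: measurable_mx_mul; last exact: measurable_mx_cst.
      by apply: measurable_mx_mul => //; exact: measurable_mx_cst.
    have -> : F w = (fun t => \tr ((map_mx ratr w)^T *m N t *m map_mx ratr w : 'M[R]_1)) @^-1` `]0, +oo[%classic.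
      by apply/seteqP; split => t /=; rewrite in_itv/= andbT.
    by rewrite -[X in measurable X]setTI; exact: mf.
  have mZ : measurable [set t | B t = 0].
    have -> : [set t | B t = 0] = \bigcap_(ij : 'I_n * 'I_l) ((fun t => B t ij.1 ij.2) @^-1` [set 0]).
      apply/seteqP; split => [t /= Bt [i j] _ /=|t h /=]; first by rewrite Bt mxE.
      by apply/matrixP => i j; rewrite mxE; exact: (h (i, j) I).
    apply: fin_bigcap_measurable => [|[i j] _]; first exact: finite_finset.
    by rewrite -[X in measurable X]setTI; apply: mB.
  have xi0 t : B t = 0 -> xi_max A (B t) q = 0.
    move=> B0; rewrite /xi_max.
    suff -> : [set rayleigh A v | v in krylov A (B t) q `&` [set v | v != 0]] = set0.
      exact: sup0.
    apply/seteqP; split => // x [v [[w _ <-] /= v0] _].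
    case/eqP: v0; apply/colP => i; rewrite !mxE big1// => k _.
    by rewrite /krylov_mx !mxE big1 ?mul0r// => j _; rewrite B0 mxE mulr0.
  have -> : [set t | s < xi_max A (B t) q] =
      \bigcup_w F w `|` ([set t | B t = 0] `&` [set t | s < 0]).
    apply/seteqP; split => [t /= st|t].
      have [B0|B0] := eqVneq (B t) 0.
        by right; split => //=; rewrite -(xi0 t B0).
      left.
      have [|_ [v [[w _ <-] v0] <-] sv] := sup_gt _ st.
        have [v [Kv v0]] := krylov_nonzero UU AE q B0.
        by exists (rayleigh A v), v.
      have [w' w'P] : exists w' : 'cV[rat]_(\sum_(j < q.+1) l),
          0 < \tr ((map_mx ratr w')^T *m N t *m map_mx ratr w').
        apply: (@rational_quad_gt0 _ _ (N t) w).
        have -> : w^T *m N t *m w = (K t *m w)^T *m (A - s%:M) *m (K t *m w).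
          by rewrite /N trmx_mul !mulmxA.
        move: sv; rewrite /rayleigh ltr_pdivlMr ?norm_gt0// -subr_gt0.
        by rewrite mulmxBr mulmxBl mul_mx_scalar -scalemxAl raddfB /= mxtraceZ.
      by exists w'.
    case=> [[w _ /= Fw]|[/= B0 s0]]; last by rewrite xi0.
    pose v := K t *m map_mx ratr w.
    have vq : 0 < \tr (v^T *m (A - s%:M) *m v).
      by move: Fw; rewrite /F /N /v /= trmx_mul !mulmxA.
    have v0 : v != 0.
      by apply: contraTneq vq => ->; rewrite mulmx0 mxtrace0 ltxx.
    have Kv : krylov A (B t) q v by exists (map_mx ratr w).
    apply: lt_le_trans (xi_max_ge As UU AE Kv v0).
    rewrite /rayleigh ltr_pdivlMr ?norm_gt0// -subr_gt0.
    by move: vq; rewrite mulmxBr mulmxBl mul_mx_scalar -scalemxAl raddfB /= mxtraceZ.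
  apply: measurableU.
    by apply: countable_bigcupT_measurable.
  apply: measurableI => //.
  have [s0|s0] := boolP (s < 0).
    by rewrite (_ : [set _ | _] = setT)//; apply/seteqP; split.
  by rewrite (_ : [set _ | _] = set0)//; apply/seteqP; split => // t /=; rewrite (negbTE s0).
move=> mT; apply: (measurability _ (RGenOInfty.measurableE R)) => //.
move=> _ [_ [x ->] <-]; rewrite setTI.
rewrite (_ : _ @^-1` _ = [set t | x < xi_max A (B t) q])//.
by apply/seteqP; split => t /=; rewrite in_itv/= andbT.
Qed.
End measurable_xi.

(** * The ratio of the filtered part to the top component *)

Section direction.
Context {R : realType} (l : nat).
Local Notation RR := (measurableTypeR R).
Hypothesis l0 : (0 < l)%N.

Definition sqnorm (x : l.-tuple RR) : R := \sum_j tnth x j ^+ 2.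

(** The value at 0 is any unit vector, because ge0_integral_gauss_direction
   asks for one everywhere. *)
Definition dir (x : l.-tuple RR) (j : 'I_l) : R :=
  if sqnorm x == 0 then (j == Ordinal l0)%:R else tnth x j / Num.sqrt (sqnorm x).

Lemma sqnorm_ge0 x : 0 <= sqnorm x.
Proof. by apply: sumr_ge0 => j _; exact: sqr_ge0. Qed.

Lemma measurable_sqnorm : measurable_fun setT sqnorm.
Proof.
apply: measurable_sum => j; apply: measurable_funX; exact: measurable_tnth.
Qed.

Lemma measurable_dir j : measurable_fun setT (dir ^~ j).
Proof.
apply: measurable_fun_ifT => //.
- apply: (measurable_fun_eqr measurable_sqnorm); exact: measurable_cst.
- apply: measurable_funM; first exact: measurable_tnth.
  apply: (eq_measurable_fun (fun x => sqnorm x `^ (- 2^-1))).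
    by move=> x _; rewrite powRN powR12_sqrt// sqnorm_ge0.
  exact: (measurableT_comp (measurable_powR _) measurable_sqnorm).
Qed.

Lemma dir_unit x : \sum_j dir x j ^+ 2 = 1.
Proof.
rewrite /dir; have [s0|s0] := eqVneq (sqnorm x) 0.
  rewrite (bigD1 (Ordinal l0))//= expr1n big1 ?addr0// => j /negbTE ->.
  by rewrite expr0n.
under eq_bigr do rewrite exprMn exprVn sqr_sqrtr ?sqnorm_ge0//.
by rewrite -mulr_suml divff.
Qed.

Lemma dir_proj x (b : 'I_l -> R) :
  sqnorm x * (\sum_j dir x j * b j) ^+ 2 = (\sum_j tnth x j * b j) ^+ 2.
Proof.
rewrite /dir; have [s0|s0] := eqVneq (sqnorm x) 0.
  rewrite s0 mul0r big1 ?expr0n// => j _.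
  move/eqP: s0; rewrite psumr_eq0 => [|k _]; last exact: sqr_ge0.
  move=> /allP /(_ j (mem_index_enum _)); rewrite implyTb sqrf_eq0 => /eqP ->.
  by rewrite mul0r.
rewrite -{1}[sqnorm x]sqr_sqrtr ?sqnorm_ge0// -exprMn mulr_sumr; congr (_ ^+ 2).
apply: eq_bigr => j _; rewrite mulrA mulrCA divff ?mulr1// gt_eqF// sqrtr_gt0.
by rewrite lt_neqAle eq_sym s0 sqnorm_ge0.
Qed.
End direction.

(** Jensen's inequality from the tangent line of the exponential at the
   mean; the missing weight is put at 0. *)
Lemma expR_jensen (R : realType) (I : finType) (Q : pred I) (p x : I -> R) :
  (forall i, Q i -> 0 <= p i) -> \sum_(i | Q i) p i <= 1 ->
  expR (\sum_(i | Q i) p i * x i) <=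
  \sum_(i | Q i) p i * expR (x i) + (1 - \sum_(i | Q i) p i).
Proof.
move=> p0 p1; set m := \sum_(i | Q i) p i * x i.
have tangent y : expR m * (1 + (y - m)) <= expR y.
  have -> : expR y = expR m * expR (y - m) by rewrite -expRD addrC subrK.
  by rewrite ler_wpM2l ?expR_ge0// expR_ge1Dx.
have : \sum_(i | Q i) p i * (expR m * (1 + (x i - m))) <= \sum_(i | Q i) p i * expR (x i).
  by apply: ler_sum => i Qi; rewrite ler_wpM2l ?p0.
have -> : \sum_(i | Q i) p i * (expR m * (1 + (x i - m))) =
    expR m * ((1 - m) * \sum_(i | Q i) p i + m).
  rewrite mulr_sumr /m -big_split mulr_sumr/=.
  by apply: eq_bigr => i _; ring.
have := tangent 0; rewrite expR0.
set s := \sum_(i | Q i) p i in p1 *.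
have : 0 <= 1 - s by lra.
move=> s1 h1 h2.
have h3 : (1 - s) * (expR m * (1 + (0 - m))) <= (1 - s) * 1 by rewrite ler_wpM2l.
by lra.
Qed.

Section laplace.
Context d (T : measurableType d) (R : realType) (P : probability T R).
Local Notation gauss := (@normal_prob R 0 1).
Local Notation RR := (measurableTypeR R).
Context (n l : nat) (l0 : (0 < l)%N) (W : 'I_n * 'I_l -> T -> R) (i0 : 'I_n).
Hypothesis gW : gauss_family P W.

Definition top_row t : l.-tuple RR := tuple_of_family W (pair i0) t.
(** The component of row i along the direction of row i0, which makes a
   linear form in row i0 factor as in dir_proj. *)
Definition component i t : R := \sum_j dir l0 (top_row t) j * W (i, j) t.

Lemma measurable_top_row : measurable_fun setT top_row.
Proof. exact: measurable_tuple_of_family gW. Qed.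

Lemma measurable_sqnorm_top : measurable_fun setT (fun t => sqnorm (top_row t)).
Proof. exact: (measurableT_comp (@measurable_sqnorm R l) measurable_top_row). Qed.

Lemma measurable_component i : measurable_fun setT (component i).
Proof.
apply: measurable_sum => j; apply: measurable_funM; last exact: gW.1.
exact: (measurableT_comp (measurable_dir l0 j) measurable_top_row).
Qed.

Lemma measurable_component_form (w : 'I_n -> R) :
  measurable_fun setT (fun t => \sum_(i | i != i0) w i * component i t ^+ 2).
Proof.
apply: (eq_measurable_fun
    (fun t => \sum_i (if i != i0 then w i * component i t ^+ 2 else 0))).
  by move=> t _; rewrite [RHS]big_mkcond.
apply: measurable_sum => i; case: (i != i0) => //.
by apply: measurable_funM => //; apply: measurable_funX; exact: measurable_component.
Qed.

(** The component is standard normal and independent of the norm of row i0. *)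
Lemma integral_component (F : R -> R) (G : R -> R) i : i != i0 ->
  measurable_fun setT F -> (forall x, 0 <= F x) ->
  measurable_fun setT G -> (forall x, 0 <= G x) ->
  (\int[P]_t (F (sqnorm (top_row t)) * G (component i t))%:E =
   (\int[P]_t (F (sqnorm (top_row t)))%:E) * \int[gauss]_x (G x)%:E)%E.
Proof.
move=> ii0 mF F0 mG G0.
have i0i : i0 != i by rewrite eq_sym.
rewrite -(@ge0_integral_gauss_direction _ _ _ P n l W i0 i (dir l0)
  (fun x => (F (sqnorm x))%:E) (fun x => (G x)%:E))//.
- exact: measurable_dir.
- exact: dir_unit.
- by apply/measurable_EFinP; exact: (measurableT_comp mF (@measurable_sqnorm R l)).
- by move=> x; rewrite lee_fin.
- exact/measurable_EFinP.
Qed.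

Lemma integral_mixture (w : 'I_n -> R) (F : R -> R) (G : R -> R) :
  (forall i, 0 <= w i) ->
  measurable_fun setT F -> (forall x, 0 <= F x) ->
  measurable_fun setT G -> (forall x, 0 <= G x) ->
  (\int[P]_t (\sum_(i | i != i0) w i * (F (sqnorm (top_row t)) * G (component i t)))%:E =
   (\sum_(i | i != i0) w i)%:E *
   ((\int[P]_t (F (sqnorm (top_row t)))%:E) * \int[gauss]_x (G x)%:E))%E.
Proof.
move=> w0 mF F0 mG G0.
have mc i := measurable_component i.
have mY := measurable_sqnorm_top.
have mFG i : measurable_fun setT (fun t => F (sqnorm (top_row t)) * G (component i t)).
  by apply: measurable_funM; exact: measurableT_comp.
under eq_integral do rewrite -big_filter -sumEFin.
rewrite ge0_integral_sum//; last 2 first.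
- by move=> i; apply/measurable_EFinP; exact: measurable_funM.
- by move=> i t _; rewrite lee_fin !mulr_ge0.
rewrite big_filter -sumEFin ge0_sume_distrl => [|i _]; last by rewrite lee_fin.
apply: eq_bigr => i ii0; under eq_integral do rewrite EFinM.
rewrite ge0_integralZl//; last 3 first.
- exact/measurable_EFinP.
- by move=> t _; rewrite lee_fin mulr_ge0.
- by rewrite lee_fin.
by rewrite (integral_component ii0 mF F0 mG G0).
Qed.

Lemma laplace_sqnorm (k : R) : 0 <= k ->
  (\int[P]_t (expR (- k * sqnorm (top_row t)))%:E =
   ((Num.sqrt (1 + 2 * k))^-1 ^+ l)%:E)%E.
Proof.
move=> k0.
pose h x : R := expR (- k * x ^+ 2).
have mh : measurable_fun setT h.
  by apply: measurableT_comp => //; apply: measurable_funM => //; exact: measurable_funX.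
have h0 x : 0 <= h x by exact: expR_ge0.
pose s := [seq (i0, j) | j <- enum 'I_l].
have us : uniq s by rewrite map_inj_uniq ?enum_uniq// => j j' [].
have := ge0_integral_gauss_prod gW us mh h0.
rewrite integral_normal_expR_sqr; last by lra.
rewrite big_const_seq count_predT size_map size_enum_ord.
rewrite (_ : 1 - 2 * - k = 1 + 2 * k); last by ring.
have -> m (x : R) : iter m ( *%E x%:E) 1%E = (x ^+ m)%:E.
  by elim: m => //= m ->; rewrite -EFinM -exprS.
move=> <-; apply: eq_integral => t _; congr EFin.
rewrite big_map big_enum/= /h -expR_sum -mulr_sumr.
by congr (expR (_ * _)); apply: eq_bigr => j _; rewrite tnth_mktuple.
Qed.

(** Chernoff's bound with the exponent lam (Q - k Y). By Jensen's inequality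
   the weighted sum Q of squares, whatever the weights, may be replaced by S
   times a single squared standard normal variable; for lam = 1 / (4 S) its
   exponential moment is sqrt 2. *)
Lemma chernoff_ratio (w : 'I_n -> R) (S k : R) : 0 <= k -> 0 < S ->
  (forall i, 0 <= w i) -> \sum_(i | i != i0) w i <= S ->
  (P [set t | (k * sqnorm (top_row t) <= \sum_(i | i != i0) w i * component i t ^+ 2)%R] <=
   (Num.sqrt 2 * (Num.sqrt (1 + k / (2 * S)))^-1 ^+ l)%:E)%E.
Proof.
move=> k0 S0 w0 wS.
pose Y t := sqnorm (top_row t).
pose Q t := \sum_(i | i != i0) w i * component i t ^+ 2.
pose lam := (4 * S)^-1.
have lam0 : 0 < lam by rewrite invr_gt0 mulr_gt0.
have mY : measurable_fun setT Y := measurable_sqnorm_top.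
have mc i := measurable_component i.
have mF c : measurable_fun setT (fun x : R => expR (c * x)).
  by apply: measurableT_comp => //; exact: measurable_funM.
have mQ : measurable_fun setT Q := measurable_component_form w.
pose p i := w i / S.
have p0 i : 0 <= p i by rewrite divr_ge0// ltW.
have p1 : \sum_(i | i != i0) p i <= 1.
  by rewrite -mulr_suml ler_pdivrMr// mul1r.
pose s := \sum_(i | i != i0) p i.
pose G x : R := expR (4^-1 * x ^+ 2).
have mG : measurable_fun setT G.
  by apply: (measurableT_comp (mF _)); exact: measurable_funX.
pose F x : R := expR (- (lam * k) * x).
pose up t := \sum_(i | i != i0) p i * (F (Y t) * G (component i t)) + (1 - s) * F (Y t).
have mFY : measurable_fun setT (fun t => F (Y t)) by exact: (measurableT_comp (mF _)).
have mFG i : measurable_fun setT (fun t => F (Y t) * G (component i t)).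
  by apply: measurable_funM => //; exact: measurableT_comp.
have up_ge t : expR (lam * (Q t - k * Y t)) <= up t.
  have -> : lam * (Q t - k * Y t) =
      \sum_(i | i != i0) p i * (4^-1 * component i t ^+ 2) + - (lam * k) * Y t.
    rewrite mulrBr /Q mulr_sumr mulrA mulNr; congr (_ - _).
    apply: eq_bigr => i _; rewrite /p /lam invfM; ring.
  rewrite expRD.
  have /(ler_wpM2r (expR_ge0 (- (lam * k) * Y t))) :=
    expR_jensen (fun i => 4^-1 * component i t ^+ 2) (fun i _ => p0 i) p1.
  move=> /le_trans; apply.
  rewrite mulrDl mulr_suml /up lerD2r; apply: ler_sum => i _.
  by rewrite /F /G -mulrA [expR (4^-1 * _) * _]mulrC.
have mE : measurable [set t | k * Y t <= Q t].
  rewrite -[X in measurable X]setTI; apply: measurable_fun_le => //.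
  exact: measurable_funM.
rewrite -[[set t | _]]setIT -integral_indic//.
apply: (@le_trans _ _ (\int[P]_t (up t)%:E)%E).
  apply: ge0_le_integral => //.
  - by apply/measurable_EFinP; exact: measurable_indic.
  - apply/measurable_EFinP; apply: measurable_funD; last exact: measurable_funM.
    apply: (eq_measurable_fun (fun t => \sum_i
      (if i != i0 then p i * (F (Y t) * G (component i t)) else 0))).
      by move=> t _; rewrite [RHS]big_mkcond.
    apply: measurable_sum => i; case: (i != i0) => //; exact: measurable_funM.
  - move=> t _; rewrite lee_fin indicE; apply: le_trans (up_ge t).
    case: (boolP (t \in _)); last by rewrite expR_ge0.
    rewrite inE/= => le; rewrite -[X in X <= _]expR0 ler_expR.
    by rewrite mulr_ge0 ?subr_ge0// ltW.
have FY : (\int[P]_t (F (Y t))%:E = ((Num.sqrt (1 + k / (2 * S)))^-1 ^+ l)%:E)%E.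
  rewrite laplace_sqnorm ?mulr_ge0// 1?ltW//; congr (((Num.sqrt (1 + _))^-1 ^+ l)%:E).
  by rewrite /lam; field; rewrite gt_eqF.
have F0 x : 0 <= F x by exact: expR_ge0.
have G0 x : 0 <= G x by exact: expR_ge0.
have GG : (\int[gauss]_x (G x)%:E = (Num.sqrt 2)%:E)%E.
  rewrite (integral_normal_expR_sqr (s := 4^-1)); last by lra.
  by rewrite -sqrtrV; [congr (Num.sqrt _)%:E; field|lra].
set c := (Num.sqrt (1 + k / (2 * S)))^-1 ^+ l in FY *.
have c0 : 0 <= c by rewrite exprn_ge0// invr_ge0 sqrtr_ge0.
have mM : measurable_fun setT
    (fun t => \sum_(i | i != i0) p i * (F (Y t) * G (component i t))).
  apply: (eq_measurable_fun (fun t => \sum_i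
    (if i != i0 then p i * (F (Y t) * G (component i t)) else 0))).
    by move=> t _; rewrite [RHS]big_mkcond.
  apply: measurable_sum => i; case: (i != i0) => //; exact: measurable_funM.
under eq_integral do rewrite /up EFinD.
rewrite ge0_integralD//=; last 4 first.
- by move=> t _; rewrite lee_fin sumr_ge0// => i _; do 2!rewrite mulr_ge0//.
- exact/measurable_EFinP.
- by move=> t _; rewrite lee_fin mulr_ge0// subr_ge0.
- by apply/measurable_EFinP; exact: measurable_funM.
rewrite (integral_mixture p0 (mF (- (lam * k))) F0 mG G0) GG.
under [X in (_ + X)%E]eq_integral do rewrite EFinM.
rewrite ge0_integralZl//; last 3 first.
- exact/measurable_EFinP.
- by move=> t _; rewrite lee_fin.
- by rewrite lee_fin subr_ge0.
rewrite FY -/s -!EFinM -EFinD lee_fin.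
have s2 : 1 <= Num.sqrt 2 :> R by rewrite -[X in X <= _]sqrtr1 ler_wsqrtr// ler1n.
have s0 : 0 <= 1 - s by rewrite subr_ge0.
have : 0 <= (1 - s) * c * (Num.sqrt 2 - 1) by rewrite mulr_ge0 ?subr_ge0 ?mulr_ge0.
by lra.
Qed.
End laplace.

Section small_ball.
Context d (T : measurableType d) (R : realType) (P : probability T R).
Local Notation gauss := (@normal_prob R 0 1).
Context (n l : nat) (W : 'I_n * 'I_l -> T -> R) (i0 : 'I_n).
Hypothesis gW : gauss_family P W.

(** Each of the l independent coordinates has to lie in [-t, t]. *)
Lemma sqnorm_top_le (t : R) : 0 <= t ->
  (P [set w | (sqnorm (top_row W i0 w) <= t ^+ 2)%R] <= (t ^+ l)%:E)%E.
Proof.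
move=> t0; pose D := [set x : R | x ^+ 2 <= t ^+ 2].
pose h x : R := \1_D x.
have mD : measurable D.
  have mX : measurable_fun [set: R] (fun x : R => x ^+ 2) by exact: measurable_funX.
  have mt : measurable_fun [set: R] (fun=> t ^+ 2 : R) by exact: measurable_cst.
  by rewrite -[X in measurable X]setTI; exact: measurable_fun_le mX mt.
have mh : measurable_fun setT h by exact: measurable_indic.
have h0 x : 0 <= h x by rewrite /h indicE.
pose s := [seq (i0, j) | j <- enum 'I_l].
have us : uniq s by rewrite map_inj_uniq ?enum_uniq// => j j' [].
have mE : measurable [set w | sqnorm (top_row W i0 w) <= t ^+ 2].
  rewrite -[X in measurable X]setTI; apply: measurable_fun_le => //.
  exact: (measurable_sqnorm_top i0 gW).
have mW k := gW.1 k.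
rewrite -[[set _ | _]]setIT -integral_indic//.
apply: (@le_trans _ _ (\int[P]_w (\prod_(k <- s) h (W k w))%:E)%E).
  apply: ge0_le_integral => //.
  - by apply/measurable_EFinP; exact: measurable_indic.
  - by apply/measurable_EFinP; apply: measurable_prod => k _; exact: measurableT_comp.
  move=> w _; rewrite lee_fin indicE.
  case: (boolP (w \in _)) => [|_]; last exact: prodr_ge0.
  rewrite inE/= => le; rewrite big_map big_enum/= big1// => j _.
  rewrite /h indicE mem_set// /D/=; apply: le_trans le.
  rewrite /sqnorm (bigD1 j)//= tnth_mktuple lerDl.
  by apply: sumr_ge0 => k _; exact: sqr_ge0.
rewrite (ge0_integral_gauss_prod gW us mh h0).
have -> : (\int[gauss]_x (h x)%:E = gauss D)%E.
  by rewrite integral_indic// setIT.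
have le := normal_prob_ball_le t0.
rewrite big_const_seq count_predT size_map size_enum_ord.
have pw_ge0 m : (0 <= iter m ( *%E (gauss D)) 1)%E.
  by elim: m => //= m IH; rewrite mule_ge0.
elim: l => [|m IH] /=; first by rewrite expr0.
by rewrite exprS EFinM; apply: lee_pmul.
Qed.

Lemma sqnorm_top_ae_gt0 : (0 < l)%N ->
  {ae P, forall w, 0 < sqnorm (top_row W i0 w)}.
Proof.
move=> l0; have := sqnorm_top_le (lexx 0); rewrite !expr0n/= eqn0Ngt l0/=.
move=> le0; exists [set w | sqnorm (top_row W i0 w) <= 0]; split.
- rewrite -[X in measurable X]setTI; apply: measurable_fun_le => //.
  exact: (measurable_sqnorm_top i0 gW).
- by apply/eqP; rewrite eq_le le0 measure_ge0.
- by move=> w /= /negP; rewrite -leNgt.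
Qed.
End small_ball.

(** * Scalar inequalities *)

Section scalar_bounds.
Context {R : realType}.
Implicit Types (x sigma : R) (m : nat).

(** Squaring a lower bound for exp y at a small y, repeatedly, gives the
   numerical bounds below. *)
Lemma expR_double_le (a b y : R) : 0 <= a -> a <= expR y -> b <= a ^+ 2 -> b <= expR (2 * y).
Proof.
move=> a0 ay /le_trans; apply; by rewrite expRM_natl ler_pXn2r// ?nnegrE ?expR_ge0.
Qed.

Lemma expR_inv_le (c y : R) : 0 < c -> c^-1 <= expR (- y) -> expR y <= c.
Proof.
by move=> c0; rewrite expRN lef_pV2 ?posrE ?expR_gt0.
Qed.

(** Each fraction is the square of the preceding one, rounded down. *)
Lemma expR2_le8 : expR 2 <= 8 :> R.
Proof.
have h : 15 / 16 <= expR (- (1 / 16)) :> R by apply: le_trans (expR_ge1Dx _); lra.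
have {}h : 29 / 33 <= expR (2 * (- (1 / 16))) :> R by apply: (expR_double_le _ h); lra.
have {}h : 44 / 57 <= expR (2 * (2 * (- (1 / 16)))) :> R by apply: (expR_double_le _ h); lra.
have {}h : 28 / 47 <= expR (2 * (2 * (2 * (- (1 / 16))))) :> R by apply: (expR_double_le _ h); lra.
have {}h : 11 / 31 <= expR (2 * (2 * (2 * (2 * (- (1 / 16)))))) :> R by apply: (expR_double_le _ h); lra.
have {}h : 18 / 143 <= expR (2 * (2 * (2 * (2 * (2 * (- (1 / 16))))))) :> R by apply: (expR_double_le _ h); lra.
apply: expR_inv_le; first by clear h; lra.
rewrite (_ : - 2 = 2 * (2 * (2 * (2 * (2 * (- (1 / 16))))))); last by lra.
by apply: le_trans h; lra.
Qed.

Lemma expR47_10_le130 : expR (47 / 10) <= 130 :> R.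
Proof.
have h : 26 / 27 <= expR (- (47 / 1280)) :> R by apply: le_trans (expR_ge1Dx _); lra.
have {}h : 51 / 55 <= expR (2 * (- (47 / 1280))) :> R by apply: (expR_double_le _ h); lra.
have {}h : 92 / 107 <= expR (2 * (2 * (- (47 / 1280)))) :> R by apply: (expR_double_le _ h); lra.
have {}h : 17 / 23 <= expR (2 * (2 * (2 * (- (47 / 1280))))) :> R by apply: (expR_double_le _ h); lra.
have {}h : 59 / 108 <= expR (2 * (2 * (2 * (2 * (- (47 / 1280)))))) :> R by apply: (expR_double_le _ h); lra.
have {}h : 37 / 124 <= expR (2 * (2 * (2 * (2 * (2 * (- (47 / 1280))))))) :> R by apply: (expR_double_le _ h); lra.
have {}h : 4 / 45 <= expR (2 * (2 * (2 * (2 * (2 * (2 * (- (47 / 1280)))))))) :> R by apply: (expR_double_le _ h); lra.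
have {}h : 1 / 127 <= expR (2 * (2 * (2 * (2 * (2 * (2 * (2 * (- (47 / 1280))))))))) :> R by apply: (expR_double_le _ h); lra.
apply: expR_inv_le; first by clear h; lra.
rewrite (_ : - (47 / 10) = 2 * (2 * (2 * (2 * (2 * (2 * (2 * (- (47 / 1280))))))))); last by clear h; lra.
by apply: le_trans h; lra.
Qed.

Lemma ln8_ge2 : 2 <= ln 8 :> R.
Proof. by rewrite -[X in X <= _]expRK ler_ln ?posrE ?expR_gt0 ?expR2_le8//; lra. Qed.

Lemma sqrt_exprn_powR (z : R) (l : nat) : 0 <= z -> Num.sqrt z ^+ l = z `^ (l%:R / 2).
Proof.
move=> z0; rewrite -powR12_sqrt// -powR_mulrn ?powR_ge0// -powRrM.
by congr (_ `^ _); lra.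
Qed.

(** With S the larger of 1 / 2 and sigma - 1, this compares the quantity 1 +
   k / (2 S) of chernoff_ratio with E / (8 sigma). When the constant factor
   3 / 5 is lost, x < 47 / 20, hence E <= 130, which settles the case of a
   large sigma. *)
Lemma tail_exponent m x sigma (E := expR (2 * x)) (S := Num.max (sigma - 1) (2^-1))
    (k := (loss m x * E - 2) / 4) :
  1 <= sigma -> 8 * sigma <= E ->
  0 <= k /\ E <= 8 * sigma * (1 + k / (2 * S)).
Proof.
move=> s1 sE; have /andP[l1 l2] := loss_ge m x.
have k0 : 0 <= k.
  have : 3 / 5 * E <= loss m x * E by rewrite ler_wpM2r ?expR_ge0.
  by rewrite /k; lra.
split=> //.
have [S0 hS] : 0 < S /\ (S = 2^-1 \/ S = sigma - 1 /\ 2^-1 <= sigma - 1).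
  rewrite /S; have [h|/ltW h] := leP (sigma - 1) 2^-1.
    by split; [lra|left].
  by split; [lra|right].
have E130 : loss m x = 1 \/ loss m x = 3 / 5 /\ E <= 130.
  rewrite /loss; case: ifPn => h; [by left|right; split=> //].
  apply: le_trans expR47_10_le130; rewrite ler_expR.
  by move: h; rewrite negb_or -ltNge => /andP[_]; lra.
have -> : 8 * sigma * (1 + k / (2 * S)) = (8 * sigma * S + sigma * (loss m x * E - 2)) / S.
  by rewrite /k; field; rewrite gt_eqF.
rewrite ler_pdivlMr//.
case: hS => [->|[-> s2]]; case: E130 => [->|[-> E130]].
- nra.
- nra.
- nra.
have [s3|/ltW s3] := leP sigma (5 / 2).
  have : 0 <= (E - 8 * sigma) * (5 / 2 - sigma) by rewrite mulr_ge0 ?subr_ge0.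
  nra.
have : 0 <= (130 - E) * (sigma - 5 / 2) by rewrite mulr_ge0 ?subr_ge0.
have : 0 <= (sigma - 31 / 8) ^+ 2 by exact: sqr_ge0.
rewrite expr2; lra.
Qed.
End scalar_bounds.

Section log_tangent.
Context {R : realType}.
Implicit Types (s v z L B : R).

Lemma expR_ge_quad s : 0 <= s -> s ^+ 2 / 2 <= expR s - 1 - s.
Proof.
move=> s0; rewrite -subr_ge0.
have := @ge0_derive_le R (fun y => expR y - 1 - y - y ^+ 2 / 2) (fun y => expR y - 1 - y) s s0.
rewrite expR0 expr0n/= mul0r !subr0 subrr; apply => y _.
  by apply: is_derive_eq; rewrite /GRing.scale/=; field.
by have := expR_ge1Dx y; lra.
Qed.

Lemma expRN_ge v : 0 <= v -> 2 - v ^+ 2 <= 2 * (1 + v) * expR (- v).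
Proof.
move=> v0; rewrite -subr_ge0.
have := @ge0_derive_le R (fun y => 2 * (1 + y) * expR (- y) - (2 - y ^+ 2))
  (fun y => 2 * y * (1 - expR (- y))) v v0.
rewrite oppr0 expR0 expr0n/= addr0 subr0 !mulr1 subrr; apply => y /andP[y0 _].
  by apply: is_derive_eq; rewrite /GRing.scale/=; ring.
rewrite mulr_ge0 ?mulr_ge0// subr_ge0 -[leRHS]expR0 ler_expR; lra.
Qed.

(** The right-hand side is, in z, a tangent line at exp L: the square of ln
   z + B is concave in z as long as ln z + B >= 1. *)
Lemma sqr_ln_le_tangent L B z : 1 <= L -> 0 <= B -> 0 < z -> 1 <= ln z ->
  (ln z + B) ^+ 2 <= (L + B) ^+ 2 + 2 * (L + B) * (z / expR L - 1).
Proof.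
move=> L1 B0 z0 lz.
set s := ln z - L.
have -> : z / expR L = expR s by rewrite /s expRB lnK ?posrE.
have -> : ln z = L + s by rewrite /s; ring.
have lz' : 1 <= L + s by rewrite /s; lra.
suff : s ^+ 2 <= 2 * (L + B) * (expR s - 1 - s).
  by rewrite -subr_ge0 => h; rewrite -subr_ge0; apply: le_trans h _; lra.
have [s0|/ltW s0] := leP 0 s.
  have h := expR_ge_quad s0.
  have h1 : s ^+ 2 <= 2 * (expR s - 1 - s) by lra.
  apply: (le_trans h1); rewrite ler_wpM2r//; last by lra.
  have := sqr_ge0 s; lra.
have v0 : 0 <= - s by lra.
have := expRN_ge v0; rewrite opprK sqrrN => h.
have g0 : 0 <= expR s - 1 - s by have := expR_ge1Dx s; lra.
have : 0 <= (L + B - (1 - s)) * (expR s - 1 - s) by rewrite mulr_ge0//; lra.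
move: h; rewrite !expr2; lra.
Qed.

End log_tangent.

(** * Moments from tail bounds *)

Section tail_moments.
Context d (T : measurableType d) (R : realType) (P : probability T R).
Local Notation leb := (@lebesgue_measure R).

Lemma ge0_integral_finite (f : T -> R) (c : R) : (forall t, 0 <= f t) ->
  (\int[P]_t (f t)%:E <= c%:E)%E ->
  exists m, [/\ 0 <= m, m <= c & (\int[P]_t (f t)%:E = m%:E)%E].
Proof.
move=> f0 fc; have I0 : (0 <= \int[P]_t (f t)%:E)%E by apply: integral_ge0 => t _; rewrite lee_fin.
move: I0 fc; case: (\int[P]_t (f t)%:E)%E => [m| |]//; rewrite !lee_fin => m0 mc.
by exists m.
Qed.

Lemma integral_affine2 (f g : T -> R) (a b c m1 m2 : R) :
  measurable_fun setT f -> (forall t, 0 <= f t) ->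
  measurable_fun setT g -> (forall t, 0 <= g t) ->
  0 <= a -> 0 <= b -> 0 <= c ->
  (\int[P]_t (f t)%:E = m1%:E)%E -> (\int[P]_t (g t)%:E = m2%:E)%E ->
  (\int[P]_t (a + b * f t + c * g t)%:E = (a + b * m1 + c * m2)%:E)%E.
Proof.
move=> mf f0 mg g0 a0 b0 c0 If Ig.
have mZ (k : R) (h : T -> R) : measurable_fun setT h -> measurable_fun setT (fun t => (k * h t)%:E).
  by move=> mh; apply/measurable_EFinP; exact: measurable_funM.
have IZ (k : R) (h : T -> R) m : measurable_fun setT h -> (forall t, 0 <= h t) -> 0 <= k ->
    (\int[P]_t (h t)%:E = m%:E)%E -> (\int[P]_t (k * h t)%:E = (k * m)%:E)%E.
  move=> mh h0 k0 Ih; under eq_integral do rewrite EFinM.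
  by rewrite ge0_integralZl// ?Ih//; [exact/measurable_EFinP|move=> t _; rewrite lee_fin].
have nn (k : R) (h : T -> R) t : 0 <= k -> (forall t, 0 <= h t) -> (0 <= (k * h t)%:E)%E.
  by move=> k0 h0; rewrite lee_fin mulr_ge0.
under eq_integral do rewrite !EFinD.
rewrite ge0_integralD//=; last 4 first.
- by move=> t _; rewrite adde_ge0 ?lee_fin ?mulr_ge0.
- by apply: emeasurable_funD => //; exact: mZ.
- by move=> t _; exact: nn.
- exact: mZ.
rewrite ge0_integralD//=; last 2 first.
- by move=> t _; exact: nn.
- exact: mZ.
rewrite (IZ _ _ _ mf f0 b0 If) (IZ _ _ _ mg g0 c0 Ig) integral_cst//.
by have /= -> := @probability_setT _ _ _ P; rewrite mule1.
Qed.

Lemma measurable_gt_set (X : T -> R) (x : R) :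
  measurable_fun setT X -> measurable [set t | x < X t].
Proof.
move=> mX; have -> : [set t | x < X t] = setT `&` X @^-1` `]x, +oo[.
  by rewrite setTI; apply/seteqP; split => t /=; rewrite in_itv/= andbT.
exact: mX.
Qed.

(** The layer cake formula for the expectation, with an antiderivative F of
   the tail bound f that vanishes at infinity. *)
Lemma expectation_tail_le (X : T -> R) (f F : R -> R) :
  measurable_fun setT X -> (forall t, 0 <= X t) ->
  (forall x, 0 <= x -> (P [set t | (x < X t)%R] <= (f x)%:E)%E) ->
  (forall x, 0 <= f x) -> continuous f -> continuous F ->
  (forall x : R, 0 < x -> is_derive x (1 : R) F (f x)) ->
  F x @[x --> +oo] --> (0 : R) ->
  (\int[P]_t (X t)%:E <= (- F 0)%:E)%E.
Proof.
move=> mX X0 tail f0 cf cF dF F0.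
pose mfX := isMeasurableFun.Build _ _ _ _ X mX.
pose X' : {RV P >-> R} := HB.pack X mfX.
have := @ge0_expectation_ccdf _ _ _ P X' X0; rewrite expectation_def => ->.
apply: (@le_trans _ _ (\int[leb]_(x in `[0%R, +oo[) (f x)%:E)%E).
  apply: ge0_le_integral => //.
  - by apply: measurable_funTS; exact: ccdf_measurable.
  - apply/measurable_EFinP/measurable_funTS; exact: continuous_measurable_fun.
  move=> x /=; rewrite in_itv/= andbT => x0; apply: le_trans (tail x x0).
  rewrite /ccdf /distribution/= /pushforward; apply: le_measure; rewrite ?inE.
  - rewrite -[X in measurable X]setTI; exact: (measurable_funPT X').
  - exact: (measurable_gt_set x (measurable_funPT X')).
  - by move=> t /=; rewrite in_itv/= andbT.
rewrite (@ge0_continuous_FTC2y _ f F 0 0).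
- by rewrite -EFinB sub0r.
- by move=> x _.
- exact: continuous_subspaceT.
- by [].
- by move=> x x0; have [] := dF x x0.
- by apply: cvg_at_right_filter; exact: cF.
- by move=> x; rewrite in_itv/= andbT => x0; rewrite derive1E; have [_ ->] := dF x x0.
Qed.

Section moments.
Context (c : R) (B : T -> R).
Hypotheses (c0 : 0 < c) (mB : measurable_fun setT B) (B0 : forall t, 0 <= B t).
Hypothesis tail : forall s, 0 <= s -> (P [set t | (s < B t)%R] <= (expR (- (c * s)))%:E)%E.

Lemma continuous_expRZ (a : R) : continuous (fun x : R => expR (a * x)).
Proof.
move=> x; apply: continuous_comp; last exact: continuous_expR.
by apply: cvgM; [exact: cvg_cst|exact: cvg_id].
Qed.

Lemma cvg_expRNZ (a : R) : 0 < a -> expR (- a * x) @[x --> +oo] --> (0 : R).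
Proof.
move=> a0; apply/cvgr0Pnorm_lt => e e0; near=> x.
rewrite ger0_norm ?expR_ge0// -[ltRHS]lnK ?posrE// ltr_expR mulNr ltrNl mulrC.
by rewrite -ltr_pdivrMr//; near: x; apply: nbhs_pinfty_gt; rewrite num_real.
Unshelve. all: end_near. Qed.

Lemma first_moment_le : (\int[P]_t (B t)%:E <= (c^-1)%:E)%E.
Proof.
pose F (x : R) := - c^-1 * expR (- c * x).
rewrite (_ : c^-1 = - F 0); last by rewrite /F mulr0 expR0 mulr1 opprK.
apply: (@expectation_tail_le B (fun x => expR (- c * x)) F) => //.
- by move=> s s0; rewrite mulNr; exact: tail.
- exact: continuous_expRZ.
- by move=> x; apply: cvgM; [exact: cvg_cst|exact: continuous_expRZ].
- move=> x _; apply: is_derive_eq; rewrite /GRing.scale/=.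
  by field; rewrite gt_eqF.
- by rewrite -[X in _ --> X](mulr0 (- c^-1)); apply: cvgM; [exact: cvg_cst|exact: cvg_expRNZ].
Qed.

(** The square of B exceeds x with probability at most exp (- c sqrt x), of
   which F below is an antiderivative. *)
Lemma second_moment_le : (\int[P]_t (B t ^+ 2)%:E <= (2 / c ^+ 2)%:E)%E.
Proof.
pose F (x : R) := - (2 / c) * ((Num.sqrt x + c^-1) * expR (- c * Num.sqrt x)).
rewrite (_ : 2 / c ^+ 2 = - F 0); last first.
  by rewrite /F sqrtr0 mulr0 expR0 mulr1 add0r; field; rewrite gt_eqF.
have csqrt : continuous (fun x => expR (- c * Num.sqrt x)).
  move=> x; apply: (@continuous_comp _ _ _ (@Num.sqrt R) (fun y => expR (- c * y))).
    exact: sqrt_continuous.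
  exact: continuous_expRZ.
apply: (@expectation_tail_le (fun t => B t ^+ 2) (fun x => expR (- c * Num.sqrt x)) F).
- exact: measurable_funX.
- by move=> t; exact: sqr_ge0.
- move=> x x0; rewrite mulNr; apply: le_trans (tail (sqrtr_ge0 x)).
  apply: le_measure; rewrite ?inE.
  + apply: measurable_gt_set; exact: measurable_funX.
  + exact: measurable_gt_set.
  move=> t /= xB; rewrite -(ltr_pXn2r (n := 2)) ?nnegrE ?sqrtr_ge0//.
  by rewrite sqr_sqrtr.
- by move=> x; exact: expR_ge0.
- exact: csqrt.
- move=> x; apply: cvgM; first exact: cvg_cst.
  by apply: cvgM; [apply: cvgD; [exact: sqrt_continuous|exact: cvg_cst]|exact: csqrt].
- move=> x x0.
  have h := is_derive1_sqrt x0.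
  apply: is_derive_eq; rewrite /GRing.scale/=.
  by field; rewrite !gt_eqF// sqrtr_gt0.
- have c1 : 0 < c / 2 by rewrite divr_gt0.
  apply/cvgr0Pnorm_lt => e e0; near=> x.
  set s := Num.sqrt x.
  have s0 : 0 <= s by exact: sqrtr_ge0.
  (* 1 + cs <= 2 exp(cs/2) absorbs the linear factor. *)
  have E : expR (- c * s) = expR (- (c / 2) * s) * expR (- (c / 2) * s).
    by rewrite -expRD; congr expR; field.
  have E1 : (s + c^-1) * expR (- (c / 2) * s) <= 2 / c.
    rewrite mulNr expRN ler_pdivrMr ?expR_gt0//.
    have h := expR_ge1Dx (c / 2 * s).
    apply: (@le_trans _ _ (2 / c * (1 + c / 2 * s))); last by rewrite ler_wpM2l// ltW ?divr_gt0.
    rewrite (_ : 2 / c * _ = s + c^-1 + c^-1); last by field; rewrite gt_eqF.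
    by rewrite lerDl invr_ge0 ltW.
  have c2 : 0 <= 2 / c by rewrite divr_ge0// ltW.
  have p0 : 0 <= (s + c^-1) * expR (- (c / 2) * s) * expR (- (c / 2) * s).
    by rewrite !mulr_ge0 ?expR_ge0// addr_ge0// invr_ge0 ltW.
  rewrite /F -/s E [(s + _) * _]mulrA normrM normrN (ger0_norm c2) (ger0_norm p0).
  apply: (@le_lt_trans _ _ (2 / c * (2 / c * expR (- (c / 2) * s)))).
    by rewrite ler_wpM2l// ler_wpM2r// expR_ge0.
  rewrite mulrA -ltr_pdivlMl ?mulr_gt0 ?invr_gt0//.
  set e' := _^-1 * e; have e'0 : 0 < e' by rewrite mulr_gt0// invr_gt0 mulr_gt0// divr_gt0.
  rewrite -[ltRHS]lnK ?posrE// ltr_expR mulNr ltrNl mulrC -ltr_pdivrMr//.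
  apply: (le_lt_trans (ler_norm _)).
  rewrite -(ltr_pXn2r (n := 2)) ?nnegrE// sqr_sqrtr.
    near: x; apply: nbhs_pinfty_gt; rewrite num_real//.
  near: x; apply: nbhs_pinfty_ge; rewrite num_real//.
Unshelve. all: end_near. Qed.
End moments.
End tail_moments.

(** * Tail and expectation of the error *)

Section gaussian_draw.
Context d (T : measurableType d) (R : realType) (P : probability T R).
Context (n l : nat) (l0 : (0 < l)%N) (A U : 'M[R]_n) (r : 'rV[R]_n) (i0 : 'I_n).
Hypotheses (As : A^T = A) (UU : U *m U^T = 1%:M) (AE : A = U^T *m diag_mx r *m U).
Hypotheses (ri0 : r 0 i0 = eig_max A) (gap : eig_min A < eig_max A).
Context (X : 'I_n * 'I_l -> T -> R).
Hypothesis gX : gauss_family P X.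

Definition draw t : 'M[R]_(n, l) := \matrix_(i, j) X (i, j) t.
Definition draw_err q t : R := relerr A (xi_max A (draw t) q).

Let W := mx_family U X.

Let gW : gauss_family P W. Proof. exact: preserves_gauss_orth. Qed.

Let Y t := sqnorm (top_row W i0 t).

Let drawE t i j : (U *m draw t) i j = W (i, j) t.
Proof. by rewrite mxE; apply: eq_bigr => k _; rewrite mxE. Qed.

Let YE t : \sum_j (U *m draw t) i0 j ^+ 2 = Y t.
Proof. by apply: eq_bigr => j _; rewrite drawE tnth_mktuple. Qed.

Lemma measurable_draw_err q : measurable_fun setT (draw_err q).
Proof.
apply: measurable_funM => //; apply: measurable_funB => //.
apply: measurable_xi_max => // i j.
by under eq_fun do rewrite mxE; exact: gX.1.
Qed.

Lemma draw_err_bounds q t : 0 < Y t -> 0 <= draw_err q t < 1.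
Proof.
move=> Y0; have B0 : draw t != 0.
  apply: contraTneq Y0 => B0; rewrite -YE B0 mulmx0 big1 ?ltxx// => j _.
  by rewrite mxE expr0n.
have /andP[-> e1] := relerr_bounds As UU AE q B0.
rewrite lt_neqAle e1 andbT; apply: contraTneq Y0 => e.
by rewrite -YE (relerr_ge1 As UU AE ri0 gap (q := q)) ?ltxx// -/(draw_err q t) e.
Qed.

Lemma draw_err_event q1 q2 (u : R) t : (0 < q1 + q2)%N -> 0 <= u < 1 ->
  u ^+ 2 <= draw_err (q1 + q2) t ->
  (loss q1 ((2 * q2 + 1)%:R * u) * expR (2 * (2 * q2 + 1)%:R * u) - 2) * Y t <=
  4 * \sum_(i | i != i0) kap q1 (relpos A r i) * component l0 W i0 i t ^+ 2.
Proof.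
move=> q0 u01 ue; rewrite -YE.
apply: (relerr_event As UU AE ri0 gap q0 u01 ue) => i.
rewrite YE dir_proj; congr (_ ^+ 2); apply: eq_bigr => j _.
by rewrite !drawE tnth_mktuple.
Qed.

Lemma srk_ge1 q1 : 1 <= srk A q1%:R.
Proof.
rewrite -subr_ge0 -(sum_kap_others As UU AE ri0 gap).
by apply: sumr_ge0 => i _; exact: (kap_ge0 As UU AE gap).
Qed.

(** The error event is contained in the event k Y <= Q of chernoff_ratio,
   with k = (loss E - 2) / 4 and E = exp (2 N u). The cases that
   relerr_event leaves out are trivial: the bound is at least 1 when E <= 8
   srk, in particular when q1 = q2 = 0, and an error equal to 1 has
   probability 0. *)
Lemma draw_err_tail q1 q2 (u : R) : 0 <= u <= 1 ->
  (P [set t | (u ^+ 2 <= draw_err (q1 + q2) t)%R] <=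
   (Num.sqrt 2 * (8 * srk A q1%:R * expR (- 2 * (2 * q2%:R + 1) * u))
     `^ (l%:R / 2))%:E)%E.
Proof.
move=> /andP[u0 u1].
set z := 8 * srk A q1%:R * _.
pose x := (2 * q2 + 1)%:R * u.
pose sigma := srk A q1%:R.
have s1 : 1 <= sigma := srk_ge1 q1.
have xE : x = (2 * q2%:R + 1) * u by rewrite /x natrD natrM.
have zE : z = 8 * sigma / expR (2 * x).
  by rewrite /z -expRN; congr (_ * expR _); rewrite xE; ring.
have E0 := expR_gt0 (2 * x).
have z0 : 0 <= z by rewrite zE divr_ge0 ?expR_ge0// mulr_ge0// (le_trans ler01).
have sq2 : 1 <= Num.sqrt 2 :> R by rewrite -[X in X <= _]sqrtr1 ler_wsqrtr// ler1n.
have me : measurable [set t | u ^+ 2 <= draw_err (q1 + q2) t].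
  rewrite -[X in measurable X]setTI; apply: measurable_fun_le => //.
  exact: measurable_draw_err.
have [z1|z1] := leP 1 z.
  apply: le_trans (probability_le1 P me) _; rewrite lee_fin.
  have zl : 1 <= z `^ (l%:R / 2).
    have : 1 `^ (l%:R / 2) <= z `^ (l%:R / 2) by rewrite ge0_ler_powR// ?nnegrE// divr_ge0.
    by rewrite powR1.
  by rewrite -[X in X <= _]mulr1 ler_pM.
have sE : 8 * sigma < expR (2 * x) by move: z1; rewrite zE ltr_pdivrMr// mul1r.
(* An error equal to 1 forces the top row to vanish. *)
have [u_lt1|u_ge1] := ltP u 1; last first.
  apply: (@le_trans _ _ (P [set t | Y t <= 0 ^+ 2])).
    apply: le_measure; rewrite ?inE//.
      rewrite -[X in measurable X]setTI; apply: measurable_fun_le => //.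
      exact: (measurable_sqnorm_top i0 gW).
    move=> t /= ut; rewrite expr0n/= leNgt; apply/negP => /(draw_err_bounds (q1 + q2)).
    rewrite ltNge => /andP[_ /negP]; apply; apply: le_trans ut.
    by rewrite -[X in X <= _](expr1n _ 2) lerXn2r ?nnegrE.
  apply: le_trans (sqnorm_top_le i0 gW (lexx 0)) _.
  rewrite expr0n eqn0Ngt l0/= lee_fin mulr_ge0// ?powR_ge0//.
have q0 : (0 < q1 + q2)%N.
  rewrite lt0n; apply: contraTneq sE => /eqP; rewrite addn_eq0 => /andP[/eqP q10 /eqP q20].
  rewrite -leNgt; apply: (@le_trans _ _ 8); last by lra.
  apply: le_trans expR2_le8; rewrite ler_expR xE q20; lra.
have [k0 kE] := tail_exponent q1 s1 (ltW sE).
set S := Num.max _ _ in k0 kE; set k := (_ / 4) in k0 kE.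
have S0 : 0 < S by rewrite lt_max; apply/orP; right; lra.
have kS : \sum_(i | i != i0) kap q1 (relpos A r i) <= S.
  by rewrite (sum_kap_others As UU AE ri0 gap) le_max lexx.
have kap0 i : 0 <= kap q1 (relpos A r i) by exact: (kap_ge0 As UU AE gap).
apply: le_trans (le_trans (chernoff_ratio l0 gW k0 S0 kap0 kS) _).
  apply: le_measure; rewrite ?inE//.
    rewrite -[X in measurable X]setTI; apply: measurable_fun_le => //.
      by apply: measurable_funM => //; exact: (measurable_sqnorm_top i0 gW).
    exact: (measurable_component_form l0 i0 gW).
  move=> t /= ut.
  have u01 : 0 <= u < 1 by rewrite u0.
  have := draw_err_event q0 u01 ut.
  rewrite -mulrA -/x /k -/(Y t).
  by lra.
rewrite lee_fin ler_wpM2l ?sqrtr_ge0// -sqrt_exprn_powR//.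
have k1 : 0 < 1 + k / (2 * S) by rewrite ltr_pwDl// divr_ge0// mulr_ge0// ltW.
rewrite -(sqrtrV (ltW k1)) lerXn2r ?nnegrE ?sqrtr_ge0// ler_wsqrtr//.
by rewrite zE ler_pdivlMr// mulrC ler_pdivrMr.
Qed.

Let neglog (y : R) : R := Num.max 0 (- ln y).
Let B t := neglog (Y t).

Let mneglog : measurable_fun setT neglog.
Proof. by apply: measurable_maxr => //; apply: measurableT_comp => //; exact: measurable_ln. Qed.

Let mY : measurable_fun setT Y := measurable_sqnorm_top i0 gW.

Let mB : measurable_fun setT B.
Proof. exact: (measurableT_comp mneglog mY). Qed.

Let neglog_ge0 y : 0 <= neglog y. Proof. by rewrite le_max lexx. Qed.

Let tail_neglog s : 0 <= s ->
  (P [set t | (s < B t)%R] <= (expR (- (l%:R / 2 * s)))%:E)%E.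
Proof.
move=> s0; apply: (@le_trans _ _ (P [set t | (Y t <= expR (- (s / 2)) ^+ 2)%R])).
  apply: le_measure; rewrite ?inE; first exact: measurable_gt_set.
    by rewrite -[X in measurable X]setTI; exact: measurable_fun_le.
  move=> t /=; rewrite lt_max ltNge s0/= ltrNr -expRM_natl => lns.
  have Y0 : 0 < Y t by rewrite ltNge; apply/negP => /ln0 Y0; move: lns; rewrite Y0; lra.
  by rewrite -[Y t]lnK ?posrE// ler_expR; lra.
apply: le_trans (sqnorm_top_le i0 gW (expR_ge0 _)) _.
by rewrite -expRM_natl lee_fin ler_expR; lra.
Qed.

(** The error event at u = sqrt err, solved for u. The factor 1 / Y inside
   the logarithm costs at most the positive part B of - ln Y. *)
Lemma draw_err_log q1 q2 t (N := (2 * q2 + 1)%:R)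
    (Q := \sum_(i | i != i0) kap q1 (relpos A r i) * component l0 W i0 i t ^+ 2) :
  (0 < q1 + q2)%N -> 0 < Y t ->
  2 * N * Num.sqrt (draw_err (q1 + q2) t) <= ln (4 + 8 * Q) + B t.
Proof.
move=> q0 Y0; have /andP[e0 e1] := draw_err_bounds (q1 + q2) Y0.
set u := Num.sqrt _.
have u01 : 0 <= u < 1.
  by rewrite sqrtr_ge0/= -(ltr_pXn2r (n := 2)) ?nnegrE ?sqrtr_ge0// sqr_sqrtr// expr1n.
have ue : u ^+ 2 <= draw_err (q1 + q2) t by rewrite sqr_sqrtr.
have Q0 : 0 <= Q.
  by apply: sumr_ge0 => i _; rewrite mulr_ge0 ?sqr_ge0// (kap_ge0 As UU AE gap).
have := draw_err_event q0 u01 ue; rewrite -/N -/Q.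
set E := expR _ => le.
have E0 : 0 < E := expR_gt0 _.
have /andP[l1 _] := loss_ge q1 (N * u).
have EY : E * Y t <= 4 * Y t + 8 * Q.
  have : 0 <= (loss q1 (N * u) - 2^-1) * (E * Y t).
    by rewrite mulr_ge0//; [lra|rewrite mulr_ge0// ltW].
  lra.
rewrite -[leLHS]expRK -/E.
have [Y1|Y1] := leP 1 (Y t).
  apply: (@le_trans _ _ (ln (4 + 8 * Q))); last by rewrite lerDl neglog_ge0.
  rewrite ler_ln ?posrE//; last by lra.
  rewrite -(ler_pM2r Y0); apply: le_trans EY _.
  have : 0 <= 8 * Q * (Y t - 1) by rewrite mulr_ge0//; lra.
  lra.
apply: (@le_trans _ _ (ln (4 + 8 * Q) - ln (Y t))); last first.
  by rewrite lerD2l le_max lexx orbT.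
rewrite -ln_div ?posrE//; last by lra.
rewrite ler_ln ?posrE//; last by rewrite divr_gt0//; lra.
by rewrite ler_pdivlMr//; lra.
Qed.

Let clip q t : R := Num.max 0 (Num.min 1 (draw_err q t)).

Let clip_ge0 q t : 0 <= clip q t. Proof. by rewrite le_max lexx. Qed.

Let mclip q : measurable_fun setT (clip q).
Proof.
by apply: measurable_maxr => //; apply: measurable_minr => //; exact: measurable_draw_err.
Qed.

Let clipE q t : 0 < Y t -> clip q t = draw_err q t.
Proof. by move=> /(draw_err_bounds q) /andP[h /ltW h1]; rewrite /clip min_r// max_r. Qed.

Let Y_gt0 : {ae P, forall t, 0 < Y t} := sqnorm_top_ae_gt0 i0 gW l0.

Let integral_clip q :
  (\int[P]_t (draw_err q t)%:E = \int[P]_t (clip q t)%:E)%E.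
Proof.
apply: ae_eq_integral => //.
- by apply/measurable_EFinP; exact: measurable_draw_err.
- exact/measurable_EFinP.
- by apply: filterS Y_gt0 => t Y0 _; rewrite clipE.
Qed.

Lemma expectation_draw_err_le1 q : (\int[P]_t (draw_err q t)%:E <= 1)%E.
Proof.
rewrite integral_clip; apply: (@le_trans _ _ (\int[P]_t (cst 1%E t))%E).
  apply: ge0_le_integral => //.
  - by move=> t _; rewrite lee_fin.
  - exact/measurable_EFinP.
  - by move=> t _; rewrite lee_fin ge_max ler01 ge_min lexx.
by rewrite integral_cst// mul1e; have /= -> := @probability_setT _ _ _ P.
Qed.

(** By draw_err_log, 4 N ^+ 2 err is at most the square of ln (4 + 8 Q) + B.
   As Q is a weighted sum of squares independent of B with mean at most
   sigma - 1, the tangent line of sqr_ln_le_tangent at 8 sigma bounds the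
   expectation by that of the square of L + B, where L = ln (8 sigma). The
   tail of Y at 0 gives B first and second moments at most 2 / l and 8 / l
   ^+ 2, and L ^+ 2 + 4 L / l + 8 / l ^+ 2 <= (L + 2.70 / l) ^+ 2 because L
   >= 2. *)
Lemma expectation_draw_err_le q1 q2 (N := (2 * q2 + 1)%:R)
    (L := ln (8 * srk A q1%:R)) : (0 < q1 + q2)%N ->
  (\int[P]_t (draw_err (q1 + q2) t)%:E <= (((270 / 100 * l%:R^-1 + L) / (2 * N)) ^+ 2)%:E)%E.
Proof.
move=> q0; set q := (q1 + q2)%N.
have s1 := srk_ge1 q1; set sigma := srk A q1%:R in L s1 *.
have sgt0 : 0 < sigma by lra.
have L2 : 2 <= L.
  by apply: le_trans ln8_ge2 _; rewrite ler_ln ?posrE//; lra.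
have EL : expR L = 8 * sigma by rewrite lnK// posrE; lra.
have N0 : 0 < N by rewrite ltr0n addn1.
rewrite integral_clip.
pose Q t := \sum_(i | i != i0) kap q1 (relpos A r i) * component l0 W i0 i t ^+ 2.
have kap0 i : 0 <= kap q1 (relpos A r i) by rewrite (kap_ge0 As UU AE gap).
have Q0 t : 0 <= Q t by apply: sumr_ge0 => i _; rewrite mulr_ge0 ?sqr_ge0.
have mQ : measurable_fun setT Q := measurable_component_form l0 i0 gW _.
pose F y := L + neglog y.
have F0 y : 0 <= F y by rewrite /F; have := neglog_ge0 y; lra.
have mF : measurable_fun setT F by exact: measurable_funD.
have pointwise t : 0 < Y t ->
    4 * N ^+ 2 * clip q t + (2 * sigma - 1) / sigma * F (Y t) <=
    F (Y t) ^+ 2 + 2 / sigma * (F (Y t) * Q t).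
  move=> Y0; rewrite clipE//.
  have /andP[e0 _] := draw_err_bounds q Y0.
  have h := draw_err_log q0 Y0.
  have z0 : 0 < 4 + 8 * Q t by have := Q0 t; lra.
  have lz : 1 <= ln (4 + 8 * Q t).
    rewrite -[leLHS]expRK ler_ln ?posrE ?expR_gt0//.
    apply: (@le_trans _ _ 4); last by have := Q0 t; lra.
    rewrite -(ler_pXn2r (n := 2)) ?nnegrE ?expR_ge0// -expRM_natl mulr1.
    by apply: le_trans expR2_le8 _; lra.
  have h2 := sqr_ln_le_tangent (le_trans (ler1n R 2) L2) (neglog_ge0 (Y t)) z0 lz.
  have h3 : 4 * N ^+ 2 * draw_err q t <= (ln (4 + 8 * Q t) + B t) ^+ 2.
    rewrite -[X in _ * X](sqr_sqrtr e0).
    rewrite (_ : 4 * N ^+ 2 * _ = (2 * N * Num.sqrt (draw_err q t)) ^+ 2); last by ring.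
    rewrite ler_pXn2r ?nnegrE//; first by rewrite !mulr_ge0 ?sqrtr_ge0// ltW.
    by apply: addr_ge0; [lra|exact: neglog_ge0].
  rewrite -lerBrDr; apply: (le_trans h3); apply: (le_trans h2).
  rewrite EL -/(F (Y t)) le_eqVlt; apply/orP; left; apply/eqP.
  by field; rewrite gt_eqF.
have c0 : 0 < l%:R / 2 :> R by rewrite divr_gt0// ltr0n.
have B0 t : 0 <= B t := neglog_ge0 (Y t).
have mB2 : measurable_fun setT (fun t => B t ^+ 2) by exact: measurable_funX.
have B20 t : 0 <= B t ^+ 2 := sqr_ge0 _.
have [b1 [b10 b1l Eb1]] := ge0_integral_finite B0 (first_moment_le c0 mB B0 tail_neglog).
have [b2 [b20 b2l Eb2]] := ge0_integral_finite B20 (second_moment_le c0 mB B0 tail_neglog).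
have [g [g0 g1 Eg]] : exists g, [/\ 0 <= g, g <= 1 &
    (\int[@normal_prob R 0 1]_x (x ^+ 2)%:E = g%:E)%E].
  by apply: ge0_integral_finite; [move=> x; exact: sqr_ge0|exact: integral_normal_sqr_le1].
have [e1 [_ _ Ee1]] : exists m, [/\ 0 <= m, m <= 1 & (\int[P]_t (clip q t)%:E = m%:E)%E].
  apply: ge0_integral_finite; first exact: clip_ge0.
  by rewrite -integral_clip expectation_draw_err_le1.
have EF : (\int[P]_t (F (Y t))%:E = (L + b1)%:E)%E.
  rewrite -[b1]mul1r -[L + _]addr0 -[X in (_ + X)%:E](mul0r b2).
  rewrite -(integral_affine2 mB B0 mB2 B20 _ _ _ Eb1 Eb2)//; last by lra.
  by apply: eq_integral => t _; congr EFin; rewrite /F -/(B t); ring.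
have EF2 : (\int[P]_t (F (Y t) ^+ 2)%:E = (L ^+ 2 + 2 * L * b1 + b2)%:E)%E.
  rewrite -[b2 in RHS]mul1r.
  rewrite -(integral_affine2 mB B0 mB2 B20 _ _ _ Eb1 Eb2)//; [|exact: sqr_ge0|lra].
  by apply: eq_integral => t _; congr EFin; rewrite /F -/(B t); ring.
have EFQ : (\int[P]_t (F (Y t) * Q t)%:E = ((sigma - 1) * ((L + b1) * g))%:E)%E.
  have mX : measurable_fun [set: R] (fun x : R => x ^+ 2) by exact: measurable_funX.
  have := integral_mixture l0 i0 gW kap0 mF F0 mX (fun x => sqr_ge0 x).
  rewrite EF Eg (sum_kap_others As UU AE ri0 gap) -!EFinM => <-.
  apply: eq_integral => t _; congr EFin; rewrite /Q mulr_sumr.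
  by apply: eq_bigr => i _; rewrite mulrCA.
have mFY : measurable_fun setT (fun t => F (Y t)) by exact: measurableT_comp mF mY.
have mF2 : measurable_fun setT (fun t => F (Y t) ^+ 2) by exact: measurable_funX.
have mFQ : measurable_fun setT (fun t => F (Y t) * Q t) by exact: measurable_funM.
have c1 : 0 <= (2 * sigma - 1) / sigma by rewrite divr_ge0//; lra.
have c2 : 0 <= 2 / sigma by rewrite divr_ge0// ltW.
have c3 : 0 <= 4 * N ^+ 2 by rewrite mulr_ge0// sqr_ge0.
have IL := integral_affine2 (mclip q) (clip_ge0 q) mFY (fun t => F0 (Y t)) (lexx 0) c3 c1 Ee1 EF.
have IR := integral_affine2 mF2 (fun t => sqr_ge0 _) mFQ
  (fun t => mulr_ge0 (F0 (Y t)) (Q0 t)) (lexx 0) ler01 c2 EF2 EFQ.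
have le : 0 + 4 * N ^+ 2 * e1 + (2 * sigma - 1) / sigma * (L + b1) <=
    0 + 1 * (L ^+ 2 + 2 * L * b1 + b2) + 2 / sigma * ((sigma - 1) * ((L + b1) * g)).
  rewrite -lee_fin -IL -IR; apply: ae_ge0_le_integral => //.
  - by move=> t _; rewrite lee_fin add0r addr_ge0// mulr_ge0.
  - by apply/measurable_EFinP; apply: measurable_funD; [apply: measurable_funD => //|]; exact: measurable_funM.
  - by move=> t _; rewrite lee_fin add0r mul1r addr_ge0 ?sqr_ge0// mulr_ge0// mulr_ge0.
  - by apply/measurable_EFinP; apply: measurable_funD; [apply: measurable_funD => //|]; exact: measurable_funM.
  - by apply: filterS Y_gt0 => t Y0 _; rewrite lee_fin !add0r mul1r pointwise.
have m1 : 0 <= L + b1 by lra.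
have gain : 2 / sigma * ((sigma - 1) * ((L + b1) * g)) <= (2 * sigma - 1) / sigma * (L + b1).
  have -> : 2 / sigma * ((sigma - 1) * ((L + b1) * g)) =
      (2 * (sigma - 1) * g) / sigma * (L + b1) by ring.
  rewrite ler_wpM2r// ler_wpM2r ?invr_ge0 1?ltW//.
  have : 0 <= (sigma - 1) * (1 - g) by rewrite mulr_ge0// subr_ge0.
  lra.
have {gain}le : 4 * N ^+ 2 * e1 <= L ^+ 2 + 2 * L * b1 + b2 by lra.
rewrite Ee1 lee_fin expr_div_n ler_pdivlMr ?exprn_gt0 ?mulr_gt0//.
rewrite (_ : e1 * _ = 4 * N ^+ 2 * e1); last by ring.
apply: le_trans le _.
have l0' : 0 < l%:R :> R by rewrite ltr0n.
set a := l%:R^-1.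
have a0 : 0 < a by rewrite invr_gt0.
have a1 : a <= 1 by rewrite invf_le1// ler1n.
have b1a : b1 <= 2 * a by rewrite (_ : 2 * a = (l%:R / 2)^-1)// /a; field; rewrite gt_eqF.
have b2a : b2 <= 8 * a ^+ 2.
  by rewrite (_ : 8 * a ^+ 2 = 2 / (l%:R / 2) ^+ 2)// /a; field; rewrite gt_eqF.
have Lb1 : 2 * L * b1 <= 2 * L * (2 * a) by rewrite ler_wpM2l//; lra.
have La : 2 * a <= L * a by rewrite ler_wpM2r// ltW.
have aa : a ^+ 2 <= a by rewrite expr2 ler_piMl// ltW.
rewrite sqrrD; lra.
Qed.
End gaussian_draw.

Lemma gauss_family_of_normal d (T : measurableType d) (R : realType) (P : probability T R)
    (n l : nat) (X : 'I_n -> 'I_l -> {RV P >-> R}) :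
  standard_normal_matrix X -> gauss_family P (fun ij t => X ij.1 ij.2 t).
Proof.
move=> [law indep]; split=> [i|B mB]; first exact: measurable_funPT.
rewrite indep//; apply: eq_bigr => i _.
exact: (law i.1 i.2 (B i) (mB i)).
Qed.

Theorem theorem1p6 (R : realType) (d : measure_display) (T : measurableType d)
    (P : probability T R) (n l q q1 q2 : nat) (A : 'M[R]_n)
    (X : 'I_n -> 'I_l -> {RV P >-> R}) :
  (0 < n)%N -> (1 <= l)%N -> A^T = A ->
  standard_normal_matrix X ->
  q = (q1 + q2)%N ->
  let err w := relerr A (xi_max A (\matrix_(i, j) X i j w) q) in
  (forall eps : R, 0 <= eps <= 1 ->
     (* for eps = 0 and A a multiple of the identity, the probability is 1 and
        the bound is 0 *)
     (eig_min A = eig_max A -> 0 < eps) ->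
     (P [set w | (eps <= err w)%R] <=
      (Num.min 1 (Num.sqrt 2 *
         (8 * srk A q1%:R * expR (- 2 * (2 * q2%:R + 1) * Num.sqrt eps))
           `^ (l%:R / 2)))%:E)%E) /\
  ('E_P[err] <=
   (Num.min 1
      (((270 / 100 * l%:R^-1 + ln (8 * srk A q1%:R)) /
         (2 * (2 * q2%:R + 1))) ^+ 2))%:E)%E.
Proof.
move=> n0 l0 As nX -> err.
have [U [r [UU AE]]] := symmetric_diag As.
have [i0 ri0] := eig_max_diag As UU AE n0.
have gX := gauss_family_of_normal nX.
pose XX := fun (ij : 'I_n * 'I_l) t => X ij.1 ij.2 t.
have errE t : err t = draw_err A XX (q1 + q2) t.
  by rewrite /err /draw_err; congr (relerr A (xi_max A _ _)).
have NE : (2 * q2 + 1)%:R = 2 * q2%:R + 1 :> R by rewrite natrD natrM.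
have /andP[lo hi] := eig_bounds As UU AE i0.
have [gap|nogap] := ltP (eig_min A) (eig_max A); last first.
  have eq : eig_min A = eig_max A by apply/eqP; rewrite eq_le nogap (le_trans lo hi).
  have err0 t : err t = 0 by rewrite /err /relerr eq subrr invr0 mulr0.
  split=> [eps /andP[eps0 eps1] /(_ eq) eps_gt0|].
    rewrite (_ : [set w | _] = set0).
      by rewrite measure0 lee_fin le_min ler01 mulr_ge0 ?sqrtr_ge0 ?powR_ge0.
    by apply/seteqP; split=> t //=; rewrite err0 leNgt eps_gt0.
  rewrite unlock integral0_eq => [|t _]; last by rewrite err0.
  by rewrite lee_fin le_min ler01 sqr_ge0.
have mdraw : measurable_fun setT (draw_err A XX (q1 + q2)) by exact: (measurable_draw_err As gX).
split=> [eps /andP[eps0 eps1] _|].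
  rewrite (_ : [set w | _] = [set t | (Num.sqrt eps ^+ 2 <= draw_err A XX (q1 + q2) t)]); last first.
    by apply/seteqP; split=> t /=; rewrite errE sqr_sqrtr.
  rewrite EFin_min le_min; apply/andP; split.
    apply: probability_le1.
    by rewrite -[X in measurable X]setTI; exact: measurable_fun_le.
  apply: (draw_err_tail l0 As UU AE ri0 gap gX).
  by rewrite sqrtr_ge0/= -[leRHS]sqrtr1 ler_wsqrtr.
rewrite unlock.
have -> : (\int[P]_t (err t)%:E = \int[P]_t (draw_err A XX (q1 + q2) t)%:E)%E.
  by apply: eq_integral => t _; rewrite errE.
rewrite EFin_min le_min (expectation_draw_err_le1 l0 As UU AE ri0 gap gX)/=.
have [q0|] := posnP (q1 + q2); last first.
  by move=> q0; rewrite -NE (expectation_draw_err_le l0 As UU AE ri0 gap gX q0).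
apply: le_trans (expectation_draw_err_le1 l0 As UU AE ri0 gap gX _) _.
have -> : q2 = 0%N by move/eqP: q0; rewrite addn_eq0 => /andP[_ /eqP].
rewrite mulr0 add0r mulr1 lee_fin.
have s1 := srk_ge1 As UU AE ri0 gap q1.
have L2 : 2 <= ln (8 * srk A q1%:R) by apply: le_trans ln8_ge2 _; rewrite ler_ln ?posrE//; lra.
have a0 : 0 <= l%:R^-1 :> R by rewrite invr_ge0.
by apply: exprn_ege1; lra.
Qed.
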